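(* Fix $\eta\in(0,1)$. There exist constants $C,c>0$ depending only on $\eta$ and, for each $\varepsilon>0$, a constant $C(\varepsilon)$ depending only on $\varepsilon$ and $\eta$, such that: if $1\le m\le n$, if $p\in[0,1]$ satisfies $p\ge n^{-1+\varepsilon}$ for some $\varepsilon>0$, and if the parameter matrix $M$ in the asymmetric model has rank $r$, then the USVT estimator $\hat M$ with tuning parameter $\eta$ satisfies $$\operatorname{MSE}(\hat M)\le C\min\left\{\sqrt{\frac{r}{mp}},\ 1\right\}+C(\varepsilon)e^{-cnp}.$$ Moreover, the same result holds when $M$ and $X$ are symmetric (symmetric model, $m=n$).
   Context: For an estimator $\hat M=(\hat m_{ij})$ of an $m\times n$ matrix $M=(m_{ij})$, $\operatorname{MSE}(\hat M):=\mathbb{E}\big[\frac1{mn}\sum_{i=1}^m\sum_{j=1}^n(\hat m_{ij}-m_{ij})^2\big]$. Asymmetric model: $1\le m\le n$; $M$ is a (deterministic) real $m\times n$ matrix with $|m_{ij}|\le1$; $X$ is a random $m\times n$ matrix with independent entries, $\mathbb{E}(x_{ij})=m_{ij}$ and $|x_{ij}|\le 1$ almost surely; each entry of $X$ is observed with probability $p$ and unobserved with probability $1-p$, independently of everything else. Symmetric model: $m=n$; $M$ and $X$ are symmetric, $|m_{ij}|\le 1$, the entries of $X$ on and above the diagonal are independent with $\mathbb{E}(x_{ij})=m_{ij}$ and $|x_{ij}|\le1$ almost surely; each entry on and above the diagonal is observed with probability $p$, independently of everything else, and for $i<j$ the entry $(j,i)$ is observed if and only if $(i,j)$ is. USVT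 estimator with tuning parameter $\eta\in(0,1)$: let $y_{ij}=x_{ij}$ if $x_{ij}$ is observed and $y_{ij}=0$ otherwise, $Y=(y_{ij})$, with singular value decomposition $Y=\sum_{i=1}^m s_iu_iv_i^T$. Let $\hat p$ be the proportion of observed entries of $X$ (in the symmetric model: the proportion of observed entries among those on and above the diagonal). Let $S:=\{i: s_i\ge(2+\eta)\sqrt{n\hat p}\}$ and $W:=\frac1{\hat p}\sum_{i\in S}s_iu_iv_i^T$ (if $\hat p=0$, put $W:=0$). Finally $\hat m_{ij}$ is the truncation of $w_{ij}$ to $[-1,1]$ ($\hat m_{ij}=w_{ij}$ if $|w_{ij}|\le1$, $1$ if $w_{ij}>1$, $-1$ if $w_{ij}<-1$). *)

(* Defs.v *)
From HB Require Import structures.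
From mathcomp Require Import all_boot all_order all_algebra.
From mathcomp Require Import all_classical all_reals all_analysis.

Set Implicit Arguments.
Unset Strict Implicit.
Unset Printing Implicit Defensive.

Import Order.TTheory GRing.Theory Num.Theory.
Import numFieldNormedType.Exports.

Local Open Scope classical_set_scope.
Local Open Scope ring_scope.

Section Independence.
Context d (T : measurableType d) (R : realType) (P : probability T R).

(* For families of sigma-algebras [F k], the product rule over all subfamilies
   of [D] is mutual independence. *)
Definition mutually_independent (I : finType) (D : {pred I})
    (F : I -> set_system T) : Prop :=
  forall (J : {set I}) (E : I -> set T),
    {subset J <= D} -> (forall k, k \in J -> F k (E k)) ->
    P (\bigcap_(k in [set` J]) E k) = (\prod_(k in J) fine (P (E k)))%:E.

Definition sigma_of d' (T' : measurableType d') (Z : T -> T') : set_system T :=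
  preimage_set_system setT Z measurable.

End Independence.

Section Model.
Context d (T : measurableType d) (R : realType) (P : probability T R).
Variables m n : nat.

(* [D] is the set of positions carrying independent entries: every position in
   the asymmetric model, the upper triangle in the symmetric one.
   [obs i j w] says whether the entry (i, j) is observed.  The index type
   [I + I] puts the entries and the observation indicators in a single family,
   so that all of them are independent. *)
Definition sampling_model (D : {pred 'I_m * 'I_n}) (p : R) (M : 'M[R]_(m, n))
    (X : 'I_m -> 'I_n -> {RV P >-> R}) (obs : 'I_m -> 'I_n -> {RV P >-> bool}) :
    Prop :=
  [/\ forall i j, `|M i j| <= 1,
      forall i j, (i, j) \in D -> ('E_P[X i j] = (M i j)%:E)%E,
      forall i j, (i, j) \in D -> {ae P, forall w, `|X i j w| <= 1},
      forall i j, (i, j) \in D -> P (obs i j @^-1` [set true]) = p%:E &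
      mutually_independent P
        [pred k : 'I_m * 'I_n + 'I_m * 'I_n |
          match k with inl e | inr e => e \in D end]
        (fun k => match k with
                  | inl e => sigma_of (X e.1 e.2)
                  | inr e => sigma_of (obs e.1 e.2)
                  end)].

Definition asymmetric_model := sampling_model predT.

Definition MSE (M : 'M[R]_(m, n)) (Mhat : T -> 'M[R]_(m, n)) : \bar R :=
  ('E_P[(fun w => ((m * n)%:R)^-1 *
          \sum_(i < m) \sum_(j < n) (Mhat w i j - M i j) ^+ 2)%R])%E.

Definition observed_matrix (X : 'I_m -> 'I_n -> {RV P >-> R})
    (obs : 'I_m -> 'I_n -> {RV P >-> bool}) (w : T) : 'M[R]_(m, n) :=
  \matrix_(i, j) (if obs i j w then X i j w else 0).

Definition observed_proportion (D : {pred 'I_m * 'I_n})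
    (obs : 'I_m -> 'I_n -> {RV P >-> bool}) (w : T) : R :=
  (\sum_(e in D) obs e.1 e.2 w)%N%:R / #|D|%:R.

End Model.

Section SymmetricModel.
Context d (T : measurableType d) (R : realType) (P : probability T R).
Variable n : nat.

Definition upper_triangle : {pred 'I_n * 'I_n} := [pred e : 'I_n * 'I_n | (e.1 <= e.2)%N].

Definition symmetric_model p (M : 'M[R]_n) X obs : Prop :=
  [/\ sampling_model (P := P) upper_triangle p M X obs,
      M^T = M,
      forall i j w, X i j w = X j i w &
      forall i j w, obs i j w = obs j i w].

End SymmetricModel.

Section USVT.
Variables (R : realType) (m n : nat).

(* Columns of [U] and [V] are the singular vectors.  For [m <= n] such a
   decomposition always exists; the order of the singular values is
   irrelevant here. *)
Definition is_svd (Y : 'M[R]_(m, n)) (s : 'I_m -> R) (U : 'M[R]_m)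
    (V : 'M[R]_(n, m)) : Prop :=
  [/\ forall i, 0 <= s i, U^T *m U = 1%:M, V^T *m V = 1%:M &
      Y = \sum_(i < m) s i *: (col i U *m (col i V)^T)].

Definition truncate1 (x : R) : R :=
  if x > 1 then 1 else if x < -1 then -1 else x.

Definition usvt_W (eta phat : R) (s : 'I_m -> R) (U : 'M[R]_m)
    (V : 'M[R]_(n, m)) : 'M[R]_(m, n) :=
  if phat == 0 then 0 else
  phat^-1 *: \sum_(i < m | s i >= (2 + eta) * Num.sqrt (n%:R * phat))
               s i *: (col i U *m (col i V)^T).

(* A relation, because the singular vectors are not unique; [Mhat] itself does
   not depend on the decomposition, since equal singular values are kept or
   discarded together. *)
Definition is_usvt (eta phat : R) (Y Mhat : 'M[R]_(m, n)) : Prop :=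
  exists s U V, is_svd Y s U V /\
    Mhat = map_mx truncate1 (usvt_W eta phat s U V).

End USVT.

Definition usvt_bound (R : realType) (C c Ceps : R) (m n r : nat) (p : R) : R :=
  C * Num.min (Num.sqrt (r%:R / (m%:R * p))) 1
  + Ceps * expR (- (c * n%:R * p)).

(* Main.v *)
(* Write Y for the observed matrix and A = Y - p M.  If ||A|| <= t with
   t = (2 + eta/2) sqrt(n p) and phat is close enough to p for t to be below
   the threshold (2 + eta) sqrt(n phat), then at most r = rank M singular values are
   kept, and the error of the estimator is a matrix of rank O(r) and operator
   norm O(sqrt(n p)) plus a multiple of (p - phat) M; this gives a mean squared
   error of order sqrt(r/(m p)) without any nuclear norm.

   The sharp constant 2 in the bound for ||A|| with exponentially small failure
   probability comes from two ingredients.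
   - E ||A||^L is bounded for L of order (n p)^(1/4) by expanding the trace of a
     power of A over walks.  Every edge has to be traversed at least twice.
     Walks are summed one step at a time against a potential which depends only
     on the set of edges traversed exactly once; discovering an edge and
     closing it each contribute a factor sqrt(n p), and all the other steps are
     negligible.
   - The norm is convex and Lipschitz in the entries, so Maurey's
     infimum-convolution inequality bounds E exp(lambda ||A||) by
     exp(lambda E ||A|| + 32 lambda^2).
   Both are carried out on a finite product space: since an entry in [-1, 1] is
   a mean of the signs -1 and 1, a convex function of Y is dominated by its
   average over independent entries with values in {-1, 0, 1}, and the
   expectation of that average only involves products of independent
   variables. *)

(* The obstacle is the sharp constant 2. A moment of order L loses a factor of order n^(1/L), so L
   must exceed log n; but walks of length L keep the rate 2 sqrt(n p) only while L^2 is small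
   against sqrt(n p), because repeated traversals contribute L^2 and discoveries that reach a vertex
   with open edges contribute L^3 / sqrt(n p). A small multiple of (n p)^(1/4) meets both demands,
   being at least a power of n when p >= n^(-1+eps). Markov's inequality at this order would only
   give a tail exp(-c (n p)^(1/4)); hence moments control the mean alone, and the Gaussian tail of
   concentration, at a deviation proportional to sqrt(n p), supplies exp(-c n p).

   The second source of error is phat. Since M may have Frobenius norm sqrt(m n), a relative error x
   of phat costs x^2 in mean square. Taking x^2 of order min(1, (m p)^(-1/2)) is affordable as soon
   as the rank is positive, and with order m n p expected observations the Chernoff exponent m n p
   x^2 is still at least of order n p. *)
Require Import Defs.
From HB Require Import structures.
From mathcomp Require Import all_boot all_order all_algebra.
From mathcomp Require Import all_classical all_reals all_analysis.
From mathcomp Require Import measurable_realfun zify ring lra.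

Set Implicit Arguments.
Unset Strict Implicit.
Unset Printing Implicit Defensive.

Import Order.TTheory GRing.Theory Num.Theory.
Import numFieldNormedType.Exports.

Local Open Scope classical_set_scope.
Local Open Scope ring_scope.

(** * Elementary inequalities and averages over the cube *)

Section Elementary.
Context {R : realType}.
Implicit Types x y s t : R.

Lemma cauchy_schwarz_sum (I : finType) (x y : I -> R) :
  (\sum_i x i * y i) ^+ 2 <= (\sum_i x i ^+ 2) * (\sum_i y i ^+ 2).
Proof.
have H : 0 <= \sum_i \sum_j (x i * y j - x j * y i) ^+ 2.
  by apply: sumr_ge0 => i _; apply: sumr_ge0 => j _; exact: sqr_ge0.
have E : \sum_i \sum_j (x i * y j - x j * y i) ^+ 2 =
   2 * ((\sum_i x i ^+ 2) * (\sum_i y i ^+ 2) - (\sum_i x i * y i) ^+ 2).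
  have S (a b : I -> R) : \sum_i \sum_j a i * b j = (\sum_i a i) * \sum_j b j.
    by rewrite mulr_suml; apply: eq_bigr => i _; rewrite mulr_sumr.
  transitivity (\sum_i \sum_j (x i ^+ 2 * y j ^+ 2 + y i ^+ 2 * x j ^+ 2
      + (- 2 * (x i * y i)) * (x j * y j))).
    by apply: eq_bigr => i _; apply: eq_bigr => j _; ring.
  under eq_bigr => i _ do rewrite !big_split /=.
  rewrite !big_split /= !S -mulr_sumr. ring.
lra.
Qed.

Lemma expR_le_quadratic s : s <= 2^-1 -> expR s <= 1 + s + 2 * s ^+ 2.
Proof.
move=> hs.
have h1 : 1 - s <= expR (- s) by exact: expR_ge1Dx.
have h0 : expR s * expR (- s) = 1 by exact: expRxMexpNx_1.
have hp := expR_gt0 s.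
have h2 : expR s * (1 - s) <= 1 by rewrite -[leRHS]h0 ler_pM2l.
have h3 : 1 <= (1 + s + 2 * s ^+ 2) * (1 - s).
  rewrite (_ : _ * _ = 1 + s ^+ 2 * (1 - 2 * s)); last by ring.
  have : 0 <= s ^+ 2 * (1 - 2 * s) by apply: mulr_ge0; [exact: sqr_ge0 | lra].
  lra.
have h4 : 0 < 1 - s by lra.
by rewrite -(ler_pM2r h4); apply: le_trans h3.
Qed.

Lemma expR_convex_comb s x y : 0 <= s -> s <= 1 ->
  expR ((1 - s) * x + s * y) <= (1 - s) * expR x + s * expR y.
Proof.
move=> s0 s1; set z := _ + _.
have T u : expR z * (1 + (u - z)) <= expR u.
  have -> : expR u = expR z * expR (u - z) by rewrite -expRD subrKC.
  rewrite ler_pM2l ?expR_gt0 //; exact: expR_ge1Dx.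
have hx := ler_wpM2l (_ : 0 <= 1 - s) (T x); have hy := ler_wpM2l s0 (T y).
have E : expR z = (1 - s) * (expR z * (1 + (x - z))) + s * (expR z * (1 + (y - z))).
  by rewrite /z; ring.
rewrite {1}E; apply: lerD; [apply: hx; lra | exact: hy].
Qed.

(** One-point transport estimate: [d] is the height of a point above the minimum, [s] the fraction
    of the way moved towards the minimiser. The cost [s ^+ 2 / 16] is the quadratic cost with
    constant 1/64 between points of [-1, 1], whose squared distance is at most 4. *)
Lemma expR_transport_bound (d : R) : 0 <= d ->
  exists2 s : R, 0 <= s <= 1 & expR (d - s * d + s ^+ 2 / 16) <= 2 - expR (- d).
Proof.
move=> d0; have [dl|dg] := leP d (8^-1).
  (* [s = 8 d] minimises the exponent; it leaves [0, 1] exactly when [d] exceeds 1/8, and then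
     [s = 1] is taken. *)
  exists (8 * d); first by apply/andP; split; lra.
  have -> : d - 8 * d * d + (8 * d) ^+ 2 / 16 = d - 4 * d ^+ 2 by field.
  have h1 := @expR_le_quadratic (- d) _; have h2 := @expR_le_quadratic (d - 4 * d ^+ 2) _.
  have dd : 0 <= d ^+ 2 by exact: sqr_ge0.
  have : (d - 4 * d ^+ 2) ^+ 2 <= d ^+ 2.
    by rewrite ler_sqr ?nnegrE; nra.
  have := h1 ltac:(lra); have := h2 ltac:(nra); rewrite sqrrN; lra.
exists 1; first by apply/andP; split; lra.
have -> : d - 1 * d + 1 ^+ 2 / 16 = 16^-1 :> R by field.
have h1 := @expR_le_quadratic (16^-1) ltac:(lra).
have h2 := @expR_le_quadratic (- 8^-1) ltac:(lra).
have h3 : expR (- d) <= expR (- 8^-1) by rewrite ler_expR; lra.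
lra.
Qed.

End Elementary.

Section CubeAverages.
Context {R : realType} {E K : finType}.
Implicit Types (x y : E -> R) (f g F G : (E -> R) -> R) (l : seq E).

Definition update x e t : E -> R := fun e' => if e' == e then t else x e'.

Definition cube x := forall e, `|x e| <= 1.

Definition convex_comb (s : R) x y : E -> R := fun e => (1 - s) * x e + s * y e.

Definition cube_convex f := forall s x y, 0 <= s -> s <= 1 -> cube x -> cube y ->
  f (convex_comb s x y) <= (1 - s) * f x + s * f y.

Lemma update_cube x e t : cube x -> `|t| <= 1 -> cube (update x e t).
Proof. by move=> cx ct e'; rewrite /update; case: ifP. Qed.

Lemma update_comb s x y e t u :
  update (convex_comb s x y) e ((1 - s) * t + s * u) =
  convex_comb s (update x e t) (update y e u).
Proof. by apply/funext => e'; rewrite /update /convex_comb; case: ifP. Qed.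

Lemma update_same x e : update x e (x e) = x.
Proof. by apply/funext => e'; rewrite /update; case: eqP => // ->. Qed.

Lemma update_update x e t u : update (update x e t) e u = update x e u.
Proof. by apply/funext => e'; rewrite /update; case: eqP. Qed.

Lemma norm_comb_le1 (s t u : R) : 0 <= s -> s <= 1 -> `|t| <= 1 -> `|u| <= 1 ->
  `|(1 - s) * t + s * u| <= 1.
Proof.
move=> s0 s1 t1 u1; apply: (le_trans (ler_normD _ _)).
rewrite !normrM (ger0_norm s0) ger0_norm ?subr_ge0 //.
have := ler_wpM2l s0 u1; have := ler_wpM2l (_ : 0 <= 1 - s) t1.
by move=> /(_ ltac:(lra)); lra.
Qed.

Lemma cube_comb s x y : 0 <= s -> s <= 1 -> cube x -> cube y ->
  cube (convex_comb s x y).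
Proof. by move=> *; move=> e; apply: norm_comb_le1. Qed.

Lemma cube_convex_expR f : cube_convex f -> cube_convex (expR \o f).
Proof.
move=> cf s x y s0 s1 cx cy /=; apply: le_trans (expR_convex_comb _ _ s0 s1).
by rewrite ler_expR; exact: cf.
Qed.

Variable vl : K -> R.
Hypothesis vl1 : forall k, `|vl k| <= 1.

Section Averages.
Variable q : E -> K -> R.
Hypothesis q0 : forall e k, 0 <= q e k.
Hypothesis q1 : forall e, \sum_k q e k = 1.

(** The average is again a function on all of [E -> R], so convexity on the cube still makes sense
    in the remaining coordinates and inequalities tensorise along the list in [avg]. *)
Definition avg1 e F x := \sum_k q e k * F (update x e (vl k)).

Fixpoint avg l F := if l is e :: l' then avg l' (avg1 e F) else F.

Lemma avg1_le e F G x : cube x -> (forall y, cube y -> F y <= G y) ->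
  avg1 e F x <= avg1 e G x.
Proof.
move=> cx FG; apply: ler_sum => k _; apply: ler_wpM2l => //.
exact/FG/update_cube.
Qed.

Lemma avg_le l F G x : cube x -> (forall y, cube y -> F y <= G y) ->
  avg l F x <= avg l G x.
Proof.
elim: l F G => [|e l IH] F G cx FG /=; first exact: FG.
by apply: IH => // y cy; exact: avg1_le.
Qed.

Lemma avg_affine l F (a b : R) x : avg l (fun y => a * F y + b) x = a * avg l F x + b.
Proof.
elim: l F => [//|e l IH] F /=; rewrite -IH; congr (avg l _ x).
apply/funext => y; rewrite /avg1.
under eq_bigr => k _ do rewrite mulrDr mulrCA.
by rewrite big_split /= -mulr_sumr -mulr_suml q1 mul1r.
Qed.

Lemma avg_ge0 l F x : cube x -> (forall y, cube y -> 0 <= F y) -> 0 <= avg l F x.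
Proof.
move=> cx F0; have <- : avg l (fun=> 0) x = 0.
  transitivity (avg l (fun y => 0 * F y + 0) x); last by rewrite avg_affine mul0r addr0.
  by congr (avg l _ x); apply/funext => y; rewrite mul0r addr0.
exact: avg_le.
Qed.

Lemma avg_jensen_expR l F x : cube x -> expR (avg l F x) <= avg l (expR \o F) x.
Proof.
move=> cx; set a := avg l F x.
have <- : avg l (fun y => expR a * F y + (expR a - expR a * a)) x = expR a.
  by rewrite avg_affine -/a; ring.
apply: avg_le => // y _ /=.
  have -> : expR (F y) = expR a * expR (F y - a) by rewrite -expRD subrKC.
have := ler_wpM2l (ltW (expR_gt0 a)) (expR_ge1Dx (F y - a)).
by apply: le_trans; rewrite le_eqVlt; apply/orP; left; apply/eqP; ring.
Qed.

Lemma avg_prod l (g : E -> R -> R) x : uniq l ->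
  avg l (fun y => \prod_e g e (y e)) x =
  \prod_e (if e \in l then \sum_k q e k * g e (vl k) else g e (x e)).
Proof.
elim: l g => [|e l IH] g /=; first by move=> _; apply: eq_bigr.
case/andP=> el ul.
pose g' e' (t : R) := if e' == e then \sum_k q e k * g e (vl k) else g e' t.
transitivity (avg l (fun y => \prod_e' g' e' (y e')) x).
  congr (avg l _ x); apply/funext => y; rewrite /avg1.
  rewrite (bigD1 e) //= {1}/g' eqxx mulr_suml; apply: eq_bigr => k _.
  rewrite -mulrA; congr (_ * _); rewrite (bigD1 e) //= {1}/update eqxx.
  by congr (_ * _); apply: eq_bigr => e' /negbTE ne; rewrite /update /g' ne.
rewrite IH //; apply: eq_bigr => e' _; rewrite inE /g'.
case: eqP => [->|_] /=; last by [].
by rewrite (negbTE el).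
Qed.

Lemma avg_sum l (I : finType) (Fs : I -> (E -> R) -> R) x :
  avg l (fun y => \sum_i Fs i y) x = \sum_i avg l (Fs i) x.
Proof.
elim: l Fs => [//|e l IH] Fs /=; rewrite -IH; congr (avg l _ x).
apply/funext => y; rewrite /avg1 exchange_big; apply: eq_bigr => k _.
by rewrite mulr_sumr.
Qed.

Lemma avg_eq_grid l F G x : uniq l ->
  (forall y, (forall e, e \in l -> exists k, y e = vl k) ->
     (forall e, e \notin l -> y e = x e) -> F y = G y) ->
  avg l F x = avg l G x.
Proof.
elim: l F G => [|e l IH] F G /=; first by move=> _ ->.
case/andP=> el ul FG; apply: IH => // y yl ynl.
apply: eq_bigr => k _; congr (_ * _); apply: FG => e'.
  rewrite inE /update; case: eqP => [_ _|_ /=]; [by exists k | exact: yl].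
rewrite inE negb_or /update => /andP[/negbTE -> /=]; exact: ynl.
Qed.

Definition grid_expectation (F : (E -> R) -> R) :=
  \sum_(w : {ffun E -> K}) (\prod_e q e (w e)) * F (fun e => vl (w e)).

Hypothesis vl_inj : injective vl.

(** On the grid, [F] is a combination of indicators of grid points. Each indicator is a product over
    coordinates, which [avg_prod] evaluates; injectivity of [vl] makes distinct grid points have
    disjoint indicators. *)
Lemma avg_enum F x : avg (enum E) F x = grid_expectation F.
Proof.
pose D (w : {ffun E -> K}) (y : E -> R) := \prod_e ((y e == vl (w e))%:R : R).
transitivity (avg (enum E) (fun y => \sum_(w : {ffun E -> K}) F (fun e => vl (w e)) * D w y) x).
  apply: avg_eq_grid; first exact: enum_uniq.
  move=> y hy _.
  have /(_ _)/cid hy' e : exists k, y e = vl k by apply: hy; rewrite mem_enum.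
  pose w0 : {ffun E -> K} := [ffun e => sval (hy' e)].
  have yE : y = fun e => vl (w0 e).
    by apply/funext => e; rewrite ffunE; case: (hy' e).
  rewrite (bigD1 w0) //= -yE big1 ?addr0.
    rewrite /D big1 ?mulr1 // => e _.
    by rewrite {1}yE eqxx.
  move=> w ww0; have [e he] : exists e, w e != w0 e.
    apply/existsP; rewrite -negb_forall; apply: contra ww0 => /forallP h.
    by apply/eqP/ffunP => e; apply/eqP.
  rewrite /D (bigD1 e) //= yE (inj_eq vl_inj) eq_sym (negbTE he).
  by rewrite mul0r mulr0.
rewrite avg_sum; apply: eq_bigr => w _.
have -> : (fun y => F (fun e => vl (w e)) * D w y) =
          (fun y => F (fun e => vl (w e)) * D w y + 0).
  by apply/funext => y; rewrite addr0.
rewrite avg_affine addr0 mulrC; congr (_ * _).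
rewrite (avg_prod (fun e t => (t == vl (w e))%:R)) ?enum_uniq //.
apply: eq_bigr => e _; rewrite mem_enum /=.
rewrite (bigD1 (w e)) //= eqxx mulr1 big1 ?addr0 // => k /negbTE nk.
by rewrite (inj_eq vl_inj) nk mulr0.
Qed.

End Averages.
End CubeAverages.

(** * Upper tail of convex Lipschitz functions *)

Section ConvexConcentration.
Context {R : realType} {E K : finType}.
Variables (vl : K -> R) (q : E -> K -> R).
Hypothesis vl1 : forall k, `|vl k| <= 1.
Hypothesis q0 : forall e k, 0 <= q e k.
Hypothesis q1 : forall e, \sum_k q e k = 1.
Implicit Types (x y : E -> R) (f g : (E -> R) -> R) (l : seq E).

Let c : R := 64^-1.

(** The infimum is restricted to [-1, 1] so that only the behaviour of [f] on the cube matters;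
    nonnegativity of [f] there bounds the set from below. *)
Let inf_conv1 e f x : R :=
  inf [set f (update x e t) + c * (x e - t) ^+ 2 | t in [set t : R | `|t| <= 1]].

Let nonneg f := forall x, cube x -> 0 <= f x.

Let inf_conv1_le e f x t : nonneg f -> cube x -> `|t| <= 1 ->
  inf_conv1 e f x <= f (update x e t) + c * (x e - t) ^+ 2.
Proof.
move=> f0 cx ct; apply: ge_inf; last by exists t.
exists 0 => _ [u hu <-]; apply: addr_ge0; first exact/f0/update_cube.
by rewrite mulr_ge0 ?sqr_ge0 // invr_ge0.
Qed.

Let le_inf_conv1 e f x z :
  (forall t, `|t| <= 1 -> z <= f (update x e t) + c * (x e - t) ^+ 2) ->
  z <= inf_conv1 e f x.
Proof.
move=> h; apply: lb_le_inf; last by move=> _ [u hu <-]; exact: h.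
by exists (f (update x e 0) + c * (x e - 0) ^+ 2), 0; rewrite //= normr0.
Qed.

Let inf_conv1_ge0 e f : nonneg f -> nonneg (inf_conv1 e f).
Proof.
move=> f0 x cx; apply: le_inf_conv1 => t ct.
apply: addr_ge0; first exact/f0/update_cube.
by rewrite mulr_ge0 ?sqr_ge0 // invr_ge0.
Qed.

(** The convex combination of near-minimisers for [x] and [y] competes in the infimum at the
    combination of [x] and [y]; the total cost is jointly convex. *)
Let inf_conv1_convex e f : nonneg f -> cube_convex f -> cube_convex (inf_conv1 e f).
Proof.
move=> f0 cf s x y s0 s1 cx cy.
have near_inf z (eps : R) : cube z -> 0 < eps -> exists2 t, `|t| <= 1 &
    f (update z e t) + c * (z e - t) ^+ 2 < inf_conv1 e f z + eps.
  move=> cz e0; apply/not_exists2P => H.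
  suff : inf_conv1 e f z + eps <= inf_conv1 e f z by rewrite gerDl leNgt e0.
  apply: le_inf_conv1 => t ht; case: (H t) => // /negP; by rewrite -leNgt.
apply/ler_addgt0Pr => eps e0.
have [t ht lt_t] := near_inf x _ cx e0; have [u hu lt_u] := near_inf y _ cy e0.
have := inf_conv1_le e f0 (cube_comb s0 s1 cx cy) (norm_comb_le1 s0 s1 ht hu).
rewrite update_comb => /le_trans; apply.
have hf := cf s _ _ s0 s1 (update_cube e cx ht) (update_cube e cy hu).
have hq : ((1 - s) * x e + s * y e - ((1 - s) * t + s * u)) ^+ 2 <=
    (1 - s) * (x e - t) ^+ 2 + s * (y e - u) ^+ 2.
  rewrite -subr_ge0 [leRHS](_ : _ = s * (1 - s) * ((x e - t) - (y e - u)) ^+ 2); last by ring.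
  by rewrite mulr_ge0 ?sqr_ge0 ?mulr_ge0 ?subr_ge0.
have hc : c * ((1 - s) * x e + s * y e - ((1 - s) * t + s * u)) ^+ 2 <=
    c * ((1 - s) * (x e - t) ^+ 2 + s * (y e - u) ^+ 2).
  by rewrite ler_wpM2l // invr_ge0.
have h1 := ler_wpM2l (_ : 0 <= 1 - s) (ltW lt_t).
have h2 := ler_wpM2l s0 (ltW lt_u).
have {}h1 := h1 ltac:(by rewrite subr_ge0).
apply: le_trans (lerD hf hc) _.
rewrite (_ : (1 - s) * inf_conv1 e f x + s * inf_conv1 e f y + eps =
  (1 - s) * (inf_conv1 e f x + eps) + s * (inf_conv1 e f y + eps)); last by ring.
by apply: le_trans (lerD h1 h2); rewrite le_eqVlt; apply/orP; left; apply/eqP; ring.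
Qed.

(** Writing an exponential average as the exponential of a new function keeps the induction over
    coordinates inside the class of nonnegative convex functions. *)
Let log_avg1 e f x : R := ln (avg1 vl q e (expR \o f) x).

Let avg1_expR_gt0 e f x : 0 < avg1 vl q e (expR \o f) x.
Proof.
have [k qk] : exists k, 0 < q e k.
  apply/not_existsP => H; have := q1 e; rewrite big1 => [/eqP|k _].
    by rewrite eq_sym oner_eq0.
  by apply/eqP; rewrite eq_le q0 leNgt andbT; apply/negP/H.
rewrite /avg1 (bigD1 k) //=; apply: ltr_pwDl.
  by rewrite mulr_gt0 ?expR_gt0.
by apply: sumr_ge0 => i _; rewrite mulr_ge0 ?expR_ge0.
Qed.

Let log_avg1K e f x : expR (log_avg1 e f x) = avg1 vl q e (expR \o f) x.
Proof. by rewrite /log_avg1 lnK // posrE avg1_expR_gt0. Qed.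

Let log_avg1_ge0 e f : nonneg f -> nonneg (log_avg1 e f).
Proof.
move=> f0 x cx; rewrite -ler_expR expR0 log_avg1K -(q1 e); apply: ler_sum => k _.
by rewrite -[leLHS]mulr1 ler_wpM2l //= -expR0 ler_expR f0 //; exact: update_cube.
Qed.

(** Convexity of log-sum-exp. After normalisation by [a] and [b] both exponential averages equal 1,
    so convexity of [expR] term by term replaces Hölder's inequality. *)
Let log_avg1_convex e f : cube_convex f -> cube_convex (log_avg1 e f).
Proof.
move=> cf s x y s0 s1 cx cy; rewrite -ler_expR log_avg1K.
set a := log_avg1 e f x; set b := log_avg1 e f y; set z := _ + _.
have normed w : \sum_k q e k * expR (f (update w e (vl k)) - log_avg1 e f w) = 1.
  under eq_bigr => k _ do rewrite expRB log_avg1K mulrA.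
  by rewrite -mulr_suml divff // gt_eqF // avg1_expR_gt0.
suff : \sum_k q e k * expR (f (update (convex_comb s x y) e (vl k)) - z) <= 1.
  under eq_bigr => k _ do rewrite expRB mulrA.
  by rewrite -mulr_suml ler_pdivrMr ?expR_gt0 // mul1r.
have comb1 (A B : R) : A = 1 -> B = 1 -> (1 - s) * A + s * B = 1 by move=> -> ->; ring.
have comb2 (r A B : R) : (1 - s) * (r * A) + s * (r * B) = r * ((1 - s) * A + s * B) by ring.
rewrite -[leRHS](comb1 _ _ (normed x) (normed y)).
rewrite !mulr_sumr -big_split; apply: ler_sum => k _ /=.
rewrite comb2.
apply: ler_wpM2l => //; apply: le_trans (expR_convex_comb _ _ s0 s1).
rewrite ler_expR [leRHS](_ : _ = (1 - s) * f (update x e (vl k)) +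
  s * f (update y e (vl k)) - z); last by rewrite /z /a /b; ring.
rewrite lerD2r.
have := cf s _ _ s0 s1 (update_cube e cx (vl1 k)) (update_cube e cy (vl1 k)).
by rewrite -update_comb -mulrDl subrK mul1r.
Qed.

(* The one-dimensional inequality: moving towards a point where [f] is minimal
   bounds [exp] of the infimum convolution by [2 - exp (- (f - min f))], and
   [(2 - u) * u <= 1]. *)
Let inf_conv1_avg1 e f x : nonneg f -> cube_convex f -> cube x ->
  avg1 vl q e (expR \o inf_conv1 e f) x * avg1 vl q e (expR \o (fun y => - f y)) x <= 1.
Proof.
move=> f0 cf cx.
have [k0 _] : exists k : K, true.
  apply/not_existsP => H; have := q1 e; rewrite big1 => [/eqP|k _].
    by rewrite eq_sym oner_eq0.
  by case: (H k).
pose phi k := f (update x e (vl k)).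
pose k1 := [arg min_(i < k0) phi i]%O.
have min_k1 k : phi k1 <= phi k.
  by rewrite /k1; case: arg_minP => // i _; apply.
pose u := \sum_k q e k * expR (- (phi k - phi k1)).
have -> : avg1 vl q e (expR \o (fun y => - f y)) x = expR (- phi k1) * u.
  rewrite mulr_sumr; apply: eq_bigr => k _ /=.
  by rewrite mulrCA -expRD; congr (_ * expR _); rewrite /phi; ring.
have hconv : avg1 vl q e (expR \o inf_conv1 e f) x <= expR (phi k1) * (2 - u).
  rewrite (_ : 2 - u = \sum_k q e k * (2 - expR (- (phi k - phi k1)))); last first.
    under [RHS]eq_bigr => k _ do rewrite mulrBr.
    by rewrite sumrB -mulr_suml q1 mul1r.
  rewrite mulr_sumr; apply: ler_sum => k _ /=; rewrite mulrCA.
  apply: ler_wpM2l => //.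
  have d0 : 0 <= phi k - phi k1 by rewrite subr_ge0.
  have [s /andP[s0 s1] hs] := expR_transport_bound d0.
  apply: le_trans (ler_wpM2l (expR_ge0 _) hs); rewrite -expRD ler_expR.
  have ht := norm_comb_le1 s0 s1 (vl1 k) (vl1 k1).
  apply: le_trans (inf_conv1_le _ f0 (update_cube e cx (vl1 k)) ht) _.
  rewrite update_update -[X in update X]/(x) {2}/update eqxx.
  have xE : x = convex_comb s x x.
    by apply/funext => e'; rewrite /convex_comb; ring.
  rewrite {1}xE update_comb.
  have := cf s _ _ s0 s1 (update_cube e cx (vl1 k)) (update_cube e cx (vl1 k1)).
  rewrite -/(phi k) -/(phi k1) => hf.
  rewrite (_ : vl k - _ = s * (vl k - vl k1)); last by ring.
  rewrite exprMn.
  have hd : (vl k - vl k1) ^+ 2 <= 4.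
    rewrite -[(_ - _) ^+ 2]ger0_norm ?sqr_ge0 // normrX.
    have := ler_normB (vl k) (vl k1); have := vl1 k; have := vl1 k1.
    by have := normr_ge0 (vl k - vl k1); nra.
  have hss : s ^+ 2 * (vl k - vl k1) ^+ 2 <= s ^+ 2 * 4 by rewrite ler_wpM2l ?sqr_ge0.
  rewrite /c; lra.
have u0 : 0 <= u by apply: sumr_ge0 => k _; rewrite mulr_ge0 ?expR_ge0.
have := ler_wpM2r (mulr_ge0 (expR_ge0 (- phi k1)) u0) hconv; move/le_trans; apply.
rewrite [leLHS](_ : _ = (expR (phi k1) * expR (- phi k1)) * ((2 - u) * u)); last by ring.
by rewrite expRxMexpNx_1 mul1r; have := sqr_ge0 (u - 1); lra.
Qed.

(* [g] is any minorant of the infimum convolution of [f] with [c |x - y|^2] in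
   the coordinates of [l]. *)
Lemma maurey_inequality l f g x : uniq l ->
  nonneg f -> cube_convex f ->
  (forall x y, cube x -> cube y -> (forall e, e \notin l -> x e = y e) ->
     g x <= f y + c * \sum_(e <- l) (x e - y e) ^+ 2) ->
  cube x ->
  avg vl q l (expR \o g) x * avg vl q l (expR \o (fun y => - f y)) x <= 1.
Proof.
elim: l f g x => [|e l IH] f g x /=.
  move=> _ f0 cf fg cx; have := fg x x cx cx (fun _ _ => erefl).
  by rewrite big_nil mulr0 addr0 -expRD -(@expR0 R) ler_expR subr_le0.
case/andP=> el ul f0 cf fg cx.
pose h := inf_conv1 e f.
have -> : avg1 vl q e (expR \o g) = expR \o log_avg1 e g.
  by apply/funext => y /=; rewrite log_avg1K.
have IH' := IH (log_avg1 e h) (log_avg1 e g) x ul.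
(* The one-dimensional inequality bounds the average of [exp (- f)] over [e] by
   [exp (- log_avg1 e h)]; the induction hypothesis for [log_avg1 e h] and [log_avg1 e g] handles
   the other coordinates. *)
apply: le_trans (IH' _ _ _ cx).
- apply: ler_wpM2l.
    by apply: (avg_ge0 vl1 q0 q1) => // y _; exact: expR_ge0.
  apply: (avg_le vl1 q0) => // y cy /=.
  rewrite expRN log_avg1K -[leRHS]mul1r ler_pdivlMr ?avg1_expR_gt0 // mulrC.
  exact: inf_conv1_avg1.
- exact/log_avg1_ge0/inf_conv1_ge0.
- exact/log_avg1_convex/inf_conv1_convex.
move=> {IH' cx}x y cx cy xy; rewrite -ler_expR expRD !log_avg1K /avg1 mulr_suml.
apply: ler_sum => k _; rewrite -mulrA; apply: ler_wpM2l => //=.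
rewrite -expRD ler_expR -lerBlDr; apply: le_inf_conv1 => t ht.
rewrite lerBlDr update_update.
have := fg _ _ (update_cube e cx (vl1 k)) (update_cube e cy ht).
move=> /(_ _)/le_trans; apply.
  move=> e'; rewrite inE negb_or /update => /andP[/negbTE -> /=]; exact: xy.
rewrite -addrA lerD2l big_cons -mulrDr /update !eqxx.
rewrite le_eqVlt; apply/orP; left; apply/eqP; congr (_ * (_ + _)).
rewrite big_seq [RHS]big_seq; apply: eq_bigr => e' e'l.
by case: eqP => // ee; rewrite -ee e'l in el.
Qed.

(** With [D] the squared distance, sqrt(b D) <= D / 64 + 16 b, so [f - 16 b] is a minorant of the
    infimum convolution of [f]. Jensen's inequality then bounds the average of [exp (- f)] from
    below by the exponential of minus the mean. *)
Lemma convex_lipschitz_expR l f (b : R) x : uniq l ->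
  nonneg f -> cube_convex f -> 0 <= b -> (forall e, e \in l) ->
  (forall x y, cube x -> cube y -> (f x - f y) ^+ 2 <= b * \sum_e (x e - y e) ^+ 2) ->
  cube x ->
  avg vl q l (expR \o f) x <= expR (avg vl q l f x + 16 * b).
Proof.
move=> ul f0 cf b0 lE fL cx.
have pl : perm_eq l (index_enum E).
  apply: uniq_perm => //; first exact: index_enum_uniq.
  by move=> e; rewrite lE mem_index_enum.
have := @maurey_inequality l f (fun x => f x - 16 * b) x ul f0 cf _ cx.
have -> : (expR \o (fun x => f x - 16 * b)) =
    (fun y => expR (- (16 * b)) * (expR \o f) y + 0).
  by apply/funext => y /=; rewrite addr0 -expRD addrC.
rewrite (avg_affine _ q1) addr0.
set A := avg _ _ _ (expR \o f) x; set B := avg _ _ _ _ x => H.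
have hB : expR (- avg vl q l f x) <= B.
  have -> : - avg vl q l f x = avg vl q l (fun y => - f y) x.
    rewrite -[LHS]mulN1r -[LHS]addr0 -(avg_affine _ q1); congr (avg _ _ _ _ x).
    by apply/funext => y; rewrite mulN1r addr0.
  exact: (avg_jensen_expR vl1 q0 q1).
have A0 : 0 <= A by apply: (avg_ge0 vl1 q0 q1) => // y _; exact: expR_ge0.
have {}H : expR (- (16 * b)) * A * expR (- avg vl q l f x) <= 1.
  apply: le_trans (H _); first by rewrite ler_wpM2l // mulr_ge0 ?expR_ge0.
  move=> x1 y cx1 cy _; rewrite (perm_big _ pl) /= lerBlDr.
  set D := \sum_e _.
  have D0 : 0 <= D by apply: sumr_ge0 => e _; exact: sqr_ge0.
  have h := fL x1 y cx1 cy; rewrite -/D in h.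
  have r0 : 0 <= c * D + 16 * b by rewrite /c; lra.
  rewrite -addrA -lerBlDl; apply: le_trans (ler_norm _) _.
  rewrite -ler_sqr ?nnegrE // real_normK ?num_real //.
  apply: (le_trans h); rewrite -subr_ge0.
  rewrite (_ : _ - _ = (c * D - 16 * b) ^+ 2); first exact: sqr_ge0.
  by rewrite /c; field.
rewrite -[leRHS]mul1r -ler_pdivrMr ?expR_gt0 // -expRN opprD expRD.
by rewrite [expR _ * _]mulrC mulrA [A * _]mulrC.
Qed.

End ConvexConcentration.

(** * Operator norms *)

Section QuadraticForms.
Context {R : realType} {V : finType}.
Implicit Types (x z : V -> R) (A B : V -> V -> R).

Definition dot x z := \sum_u x u * z u.
Definition apply_op A z : V -> R := fun u => \sum_w A u w * z w.
Definition delta (v : V) : V -> R := fun u => (u == v)%:R.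

Lemma dotC x z : dot x z = dot z x.
Proof. by apply: eq_bigr => u _; rewrite mulrC. Qed.

Lemma dot_ge0 x : 0 <= dot x x.
Proof. by apply: sumr_ge0 => u _; rewrite -expr2 sqr_ge0. Qed.

Lemma dot_cauchy_schwarz x z : dot x z ^+ 2 <= dot x x * dot z z.
Proof.
by have := cauchy_schwarz_sum x z; rewrite /dot;
  under [X in _ <= X * _]eq_bigr => u _ do rewrite expr2;
  under [X in _ <= _ * X]eq_bigr => u _ do rewrite expr2.
Qed.

Lemma dot_delta x v : dot x (delta v) = x v.
Proof.
rewrite /dot (bigD1 v) //= /delta eqxx mulr1 big1 ?addr0 // => u /negbTE ->.
by rewrite mulr0.
Qed.

Section Symmetric.
Variable A : V -> V -> R.
Hypothesis Asym : forall u w, A u w = A w u.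

Let pow k z := iter k (apply_op A) z.

Lemma dot_apply_op x z : dot (apply_op A x) z = dot x (apply_op A z).
Proof.
rewrite /dot /apply_op; under eq_bigr => u _ do rewrite mulr_suml.
rewrite exchange_big; apply: eq_bigr => w _ /=; rewrite mulr_sumr.
by apply: eq_bigr => u _; rewrite Asym; ring.
Qed.

Let dot_pow k x z : dot (pow k x) z = dot x (pow k z).
Proof.
by elim: k x z => [//|k IH] x z; rewrite /pow /= dot_apply_op IH /pow -iterSr.
Qed.

Let dot_pow_pow k z : dot (pow k z) (pow k z) = dot z (pow (k + k) z).
Proof. by rewrite dot_pow /pow -iterD. Qed.

(** Spectral theory is replaced by Cauchy-Schwarz: each application doubles the power of [A], whence
    the exponent [2 * 2 ^ j]. Expanding the squared norm of [A^k z] in the basis [delta v] and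
    applying Cauchy-Schwarz to each coordinate produces the trace of [A^(2k)]. *)
Lemma op_power_trace j x z : dot x x <= 1 -> dot z z <= 1 ->
  dot x (apply_op A z) ^+ (2 * 2 ^ j) <=
  \sum_v iter (2 * 2 ^ j) (apply_op A) (delta v) v.
Proof.
move=> hx hz.
have h1 : dot x (apply_op A z) ^+ 2 <= dot (pow 1 z) (pow 1 z).
  apply: le_trans (dot_cauchy_schwarz _ _) _.
  by rewrite -[leRHS]mul1r ler_wpM2r // dot_ge0.
have h2 : dot (pow 1 z) (pow 1 z) ^+ (2 ^ j) <= dot (pow (2 ^ j) z) (pow (2 ^ j) z).
  elim: j => [|j IH]; first by rewrite expn0 expr1.
  rewrite expnS mulnC exprM.
  apply: le_trans (_ : dot (pow (2 ^ j) z) (pow (2 ^ j) z) ^+ 2 <= _).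
    by rewrite ler_sqr ?nnegrE ?exprn_ge0 ?dot_ge0.
  rewrite {1}dot_pow_pow mulnC mul2n -addnn.
  apply: le_trans (dot_cauchy_schwarz _ _) _.
  by rewrite -[leRHS]mul1r ler_wpM2r // dot_ge0.
have h3 k : dot (pow k z) (pow k z) <= \sum_v iter (k + k) (apply_op A) (delta v) v.
  apply: ler_sum => v _; rewrite -expr2.
  rewrite -(dot_delta (iter (k + k) _ _) v) dotC -/(pow (k + k) (delta v)) -dot_pow_pow.
  rewrite -{1}(dot_delta (pow k z) v) dot_pow.
  apply: le_trans (dot_cauchy_schwarz _ _) _.
  by rewrite -[leRHS]mul1r ler_wpM2r // dot_ge0.
rewrite exprM; apply: le_trans (_ : dot (pow 1 z) (pow 1 z) ^+ (2 ^ j) <= _).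
  by rewrite lerXn2r ?nnegrE ?sqr_ge0 ?dot_ge0.
by apply: (le_trans h2); apply: (le_trans (h3 _)); rewrite addnn -mul2n.
Qed.

End Symmetric.

Definition bilinear_values A : set R :=
  [set r | exists x z, [/\ dot x x <= 1, dot z z <= 1 & r = dot x (apply_op A z)]].

(** A supremum of forms linear in [A], so that convexity and the Lipschitz bound in Frobenius norm
    are immediate. *)
Definition opnorm A : R := sup (bilinear_values A).

Definition sqnorm A : R := \sum_u \sum_w A u w ^+ 2.

Lemma sqnorm_ge0 A : 0 <= sqnorm A.
Proof. by apply: sumr_ge0 => u _; apply: sumr_ge0 => w _; exact: sqr_ge0. Qed.

Lemma dot_apply_le_sqnorm A z : dot (apply_op A z) (apply_op A z) <= sqnorm A * dot z z.
Proof.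
rewrite /sqnorm mulr_suml; apply: ler_sum => u _; rewrite -expr2.
apply: le_trans (cauchy_schwarz_sum _ _) _; apply: ler_wpM2l => //.
by apply: sumr_ge0 => w _; exact: sqr_ge0.
Qed.

Lemma bilinear_sqnorm A x z : dot x x <= 1 -> dot z z <= 1 ->
  `|dot x (apply_op A z)| <= Num.sqrt (sqnorm A).
Proof.
move=> hx hz; rewrite -(ler_sqr (normr_ge0 _)) ?nnegrE ?sqrtr_ge0 //.
rewrite real_normK ?num_real // sqr_sqrtr ?sqnorm_ge0 //.
apply: le_trans (dot_cauchy_schwarz _ _) _.
apply: le_trans (_ : 1 * (sqnorm A * 1) <= _); last by rewrite mul1r mulr1.
apply: ler_pM; rewrite ?dot_ge0 //.
apply: le_trans (dot_apply_le_sqnorm _ _) _.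
by rewrite ler_wpM2l ?sqnorm_ge0.
Qed.

Lemma has_sup_bilinear A : has_sup (bilinear_values A).
Proof.
split.
  exists 0, (fun=> 0), (fun=> 0).
  have d0 : dot (fun=> 0) (fun=> 0 : R) = 0 by rewrite /dot big1 // => u _; rewrite mul0r.
  by rewrite d0 ler01; split=> //; rewrite /dot big1 // => u _; rewrite mul0r.
exists (Num.sqrt (sqnorm A)) => _ [x [z [hx hz ->]]].
exact: le_trans (ler_norm _) (bilinear_sqnorm _ hx hz).
Qed.

Lemma le_opnorm A x z : dot x x <= 1 -> dot z z <= 1 ->
  dot x (apply_op A z) <= opnorm A.
Proof.
move=> hx hz; apply: ub_le_sup; first by case: (has_sup_bilinear A).
by exists x, z.
Qed.

Lemma opnorm_le A t : (forall x z, dot x x <= 1 -> dot z z <= 1 ->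
  dot x (apply_op A z) <= t) -> opnorm A <= t.
Proof.
move=> h; apply: ge_sup; first by case: (has_sup_bilinear A).
by move=> _ [x [z [hx hz ->]]]; exact: h.
Qed.

Lemma opnorm_ge0 A : 0 <= opnorm A.
Proof.
apply: le_trans (le_opnorm A (_ : dot (fun=> 0) (fun=> 0) <= 1) (_ : dot (fun=> 0) (fun=> 0) <= 1));
  by rewrite /dot big1 // => u _; rewrite mul0r.
Qed.

Lemma opnorm_comb s A B : 0 <= s -> s <= 1 ->
  opnorm (fun u w => (1 - s) * A u w + s * B u w) <= (1 - s) * opnorm A + s * opnorm B.
Proof.
move=> s0 s1; apply: opnorm_le => x z hx hz.
have -> : dot x (apply_op (fun u w => (1 - s) * A u w + s * B u w) z) =
   (1 - s) * dot x (apply_op A z) + s * dot x (apply_op B z).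
  rewrite /dot !mulr_sumr -big_split; apply: eq_bigr => u _ /=.
  rewrite /apply_op !mulr_sumr -big_split; apply: eq_bigr => w _ /=; ring.
by apply: lerD; apply: ler_wpM2l; rewrite ?subr_ge0 //; exact: le_opnorm.
Qed.

Let opnorm_sub A B :
  opnorm A - opnorm B <= Num.sqrt (sqnorm (fun u w => A u w - B u w)).
Proof.
rewrite lerBlDr; apply: opnorm_le => x z hx hz.
have -> : dot x (apply_op A z) = dot x (apply_op (fun u w => A u w - B u w) z) +
    dot x (apply_op B z).
  rewrite /dot -big_split; apply: eq_bigr => u _ /=.
  rewrite -mulrDr /apply_op -big_split; congr (_ * _); apply: eq_bigr => w _ /=; ring.
apply: lerD; last exact: le_opnorm.
exact: le_trans (ler_norm _) (bilinear_sqnorm _ hx hz).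
Qed.

Lemma opnorm_lipschitz A B :
  (opnorm A - opnorm B) ^+ 2 <= sqnorm (fun u w => A u w - B u w).
Proof.
set D := sqnorm _.
have DE : D = sqnorm (fun u w => B u w - A u w).
  by apply: eq_bigr => u _; apply: eq_bigr => w _; ring.
rewrite -[leRHS]sqr_sqrtr ?sqnorm_ge0 // -real_normK ?num_real //.
rewrite ler_sqr ?nnegrE ?sqrtr_ge0 // ler_norml opnorm_sub andbT.
by rewrite lerNl opprB DE opnorm_sub.
Qed.

Lemma apply_op_opnorm A z :
  dot (apply_op A z) (apply_op A z) <= opnorm A ^+ 2 * dot z z.
Proof.
have [z0|z0] := eqVneq (dot z z) 0.
  have := dot_apply_le_sqnorm A z; rewrite z0 !mulr0.
  by move=> h; apply: h.
have [a0|a0] := eqVneq (dot (apply_op A z) (apply_op A z)) 0.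
  by rewrite a0 mulr_ge0 ?sqr_ge0 ?dot_ge0.
set a := dot (apply_op A z) _ in a0 *; set b := dot z z in z0 *.
have ha : 0 < a by rewrite lt_def a0 dot_ge0.
have hb : 0 < b by rewrite lt_def z0 dot_ge0.
pose sa := Num.sqrt a; pose sb := Num.sqrt b.
have sa0 : 0 < sa by rewrite sqrtr_gt0.
have sb0 : 0 < sb by rewrite sqrtr_gt0.
have saE : sa ^+ 2 = a by rewrite sqr_sqrtr ?ltW.
have sbE : sb ^+ 2 = b by rewrite sqr_sqrtr ?ltW.
have dotZ (k l : R) x y : dot (fun u => k * x u) (fun u => l * y u) = (k * l) * dot x y.
  by rewrite /dot mulr_sumr; apply: eq_bigr => u _; ring.
have opZ (k : R) : apply_op A (fun u => k * z u) = fun u => k * apply_op A z u.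
  by apply/funext => u; rewrite /apply_op mulr_sumr; apply: eq_bigr => w _; ring.
have := @le_opnorm A (fun u => sa^-1 * apply_op A z u) (fun u => sb^-1 * z u).
have e1 : sa^-1 * sa^-1 * a = 1 by rewrite -saE; field; rewrite gt_eqF.
have e2 : sb^-1 * sb^-1 * b = 1 by rewrite -sbE; field; rewrite gt_eqF.
have e3 : sa^-1 * sb^-1 * a = sa / sb by rewrite -saE; field; rewrite !gt_eqF.
rewrite opZ !dotZ -/a -/b e1 e2 e3 => /(_ (lexx _) (lexx _)).
rewrite ler_pdivrMr // => h; rewrite -saE -sbE -exprMn.
by rewrite lerXn2r ?nnegrE ?mulr_ge0 ?opnorm_ge0 ?(ltW sa0) ?(ltW sb0).
Qed.

End QuadraticForms.

(** * The moment method *)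

Section WalkCounting.
Context {V E : finType}.
(** [phi u v] names the random variable sitting at position (u, v) of a symmetric matrix, [None]
    standing for a zero entry. By [phi_inj] a variable occupies at most one position and its
    transpose. This covers the dilation of a rectangular matrix and the symmetric model at once. *)
Variable phi : V -> V -> option E.
Hypothesis phi_inj : forall u v u' v' e, phi u v = Some e -> phi u' v' = Some e ->
  u' = u /\ v' = v \/ u' = v /\ v' = u.
Hypothesis phi_sym : forall u v, phi u v = phi v u.
Implicit Types (h : seq E) (u v w : V).

Definition edge_count h u w : nat :=
  if phi u w is Some e then count_mem e h else 0%N.

Definition is_open h u w : bool := (phi u w != None) && (edge_count h u w == 1%N).

Definition open_degree h u : nat := (\sum_w is_open h u w)%N.

(* Number of open edges at each vertex in excess of what a depth-first
   traversal of a tree leaves open: two on the current branch, and one at its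
   tip [u]. *)
Definition excess h u : nat := (\sum_v (open_degree h v - (v != u) - 1))%N.

Lemma edge_endpoints e : (#|[pred uw : V * V | phi uw.1 uw.2 == Some e]| <= 2)%N.
Proof.
set S := [pred _ | _]; case: (pickP S) => [[u w] /= /eqP uw|S0]; last by rewrite eq_card0.
apply: (@leq_trans #|pred2 (u, w) (w, u)|); last by rewrite card2; case: (_ != _).
apply/subset_leq_card/fintype.subsetP => -[u' w'] /eqP /= uw'; rewrite !inE.
by have [[-> ->]|[-> ->]] := phi_inj uw uw'; rewrite eqxx ?orbT.
Qed.

Lemma edge_multiplicity (R : numDomainType) (d : E -> R) : (forall e, 0 <= d e) ->
  \sum_u \sum_w (if phi u w is Some e then d e else 0) <= 2 * \sum_e d e.
Proof.
move=> d0.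
have -> : \sum_u \sum_w (if phi u w is Some e then d e else 0) =
  \sum_e d e * #|[pred uw : V * V | phi uw.1 uw.2 == Some e]|%:R.
  transitivity (\sum_(uw : V * V) \sum_e d e * (phi uw.1 uw.2 == Some e)%:R).
    rewrite pair_big; apply: eq_bigr => -[u w] _ /=; case: (phi u w) => [e|]; last first.
      by rewrite big1 // => e _; rewrite mulr0.
    rewrite (bigD1 e) //= eqxx mulr1 big1 ?addr0 // => e' /negbTE ne.
    by rewrite (inj_eq (@Some_inj _)) eq_sym ne mulr0.
  rewrite exchange_big; apply: eq_bigr => e _ /=; rewrite -mulr_sumr; congr (_ * _).
  rewrite -sum1_card natr_sum [RHS]big_mkcond; apply: eq_bigr => uw _.
  by rewrite unfold_in /=; case: (_ == _).
rewrite mulr_sumr; apply: ler_sum => e _; rewrite mulrC ler_wpM2r // ler_nat.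
exact: edge_endpoints.
Qed.

Lemma edge_count_cons e h u w v x : phi u w = Some e ->
  edge_count (e :: h) v x =
  (edge_count h v x + ((v == u) && (x == w) || (v == w) && (x == u)))%N.
Proof.
move=> uw; rewrite /edge_count.
case vx: (phi v x) => [e'|].
  rewrite /= addnC; congr (_ + _)%N; congr nat_of_bool.
  apply/eqP/orP => [ee|].
    rewrite -ee in vx.
    by case: (phi_inj uw vx) => -[-> ->]; rewrite !eqxx; [left | right].
  by case=> /andP[/eqP vu /eqP xw]; move: vx; rewrite vu xw ?(phi_sym w u) uw => -[].
rewrite (_ : _ || _ = false) //; apply/negP => /orP[] /andP[/eqP vu /eqP xw];
  by move: vx; rewrite vu xw ?(phi_sym w u) uw.
Qed.

Lemma open_degree_cons e h u w v : phi u w = Some e ->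
  open_degree (e :: h) v =
  if (v == u) || (v == w)
  then (open_degree h v + (count_mem e h == 0) - (count_mem e h == 1))%N
  else open_degree h v.
Proof.
move=> uw; case: ifP => [vuw|/negbT]; last first.
  rewrite negb_or => /andP[/negbTE vu /negbTE vw]; apply: eq_bigr => x _.
  by rewrite /is_open (edge_count_cons _ _ _ uw) vu vw addn0.
pose x := if v == u then w else u.
have vx : phi v x = Some e.
  by rewrite /x; move: vuw; case: eqP => [->|_ /= /eqP ->] //; rewrite phi_sym.
have step y : y != x -> is_open (e :: h) v y = is_open h v y.
  move=> yx; rewrite /is_open (edge_count_cons _ _ _ vx) eqxx /= [y == x](negbTE yx) /=.
  by have [vx'|_] := eqVneq v x; rewrite /= ?vx' ?(negbTE yx) addn0.
rewrite /open_degree (bigD1 x) //= [in RHS](bigD1 x) //=.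
under eq_bigr => y yx do rewrite step //.
rewrite /is_open vx (edge_count_cons _ _ _ vx) !eqxx /= /edge_count vx /=.
by move: (count_mem e h) => [|[|c]] /=; rewrite ?addn0 ?add0n ?subn0 ?addn1 //= ?subn1.
Qed.

Lemma count_open_degree e h u w : phi u w = Some e -> count_mem e h = 1%N ->
  (0 < open_degree h u)%N.
Proof.
move=> uw c1; rewrite /open_degree (bigD1 w) //= /is_open /edge_count uw /=.
by rewrite c1.
Qed.

(** At [u] the new open edge is absorbed by the allowance, which grows from 1 to 2 as the tip moves
    on. At [w] the degree goes up and the allowance down, which costs 2 unless [w] had no open edge
    and simply becomes the tip of a longer branch. *)
Lemma excess_new e h u w : phi u w = Some e -> count_mem e h = 0%N ->
  (excess (e :: h) w <= excess h u + 2 * (0 < open_degree h w))%N.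
Proof.
move=> uw c0; rewrite -[(2 * _)%N](_ : \sum_v (v == w) * (2 * (0 < open_degree h w)) = _)%N; last first.
  by rewrite -big_distrl /= (bigD1 w) //= eqxx big1 ?addn0 ?mul1n // => v /negbTE ->.
rewrite /excess -big_split; apply: leq_sum => v _ /=.
rewrite (open_degree_cons _ _ uw) c0 /=.
by have [->|vw] := eqVneq v w; have [vu|vu] := eqVneq _ u; rewrite ?vu ?orbT /=; lia.
Qed.

(** For [u] different from [w], degree and allowance at [w] drop together, while at [u] the degree
    drops and the allowance grows. So closing one of several open edges releases a unit of excess,
    which pays for the choice among them. *)
Lemma excess_close e h u w : phi u w = Some e -> count_mem e h = 1%N ->
  (excess (e :: h) w + (1 < open_degree h u) <= excess h u)%N.
Proof.
move=> uw c1; rewrite -[nat_of_bool (1 < _)%N](_ : \sum_v (v == u) * (1 < open_degree h u) = _)%N; last first.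
  by rewrite -big_distrl /= (bigD1 u) //= eqxx big1 ?addn0 ?mul1n // => v /negbTE ->.
rewrite /excess -big_split; apply: leq_sum => v _ /=.
rewrite (open_degree_cons _ _ uw) c1 /=.
by have [->|vw] := eqVneq v w; have [vu|vu] := eqVneq _ u; rewrite ?vu ?orbT /=; lia.
Qed.

(** No open degree changes; only the allowance of the new tip [w] can shrink, by one. *)
Lemma excess_repeat e h u w : phi u w = Some e -> (1 < count_mem e h)%N ->
  (excess (e :: h) w <= excess h u + 1)%N.
Proof.
move=> uw c2; rewrite -[1%N](_ : \sum_v (v == w) * 1 = _)%N; last first.
  by rewrite -big_distrl /= (bigD1 w) //= eqxx big1 ?addn0 ?mul1n // => v /negbTE ->.
rewrite /excess -big_split; apply: leq_sum => v _ /=.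
rewrite (open_degree_cons _ _ uw).
case: (count_mem e h) c2 => [|[|c]] //= _.
by have [->|vw] := eqVneq v w; have [vu|vu] := eqVneq _ u; rewrite ?vu ?orbT /=; lia.
Qed.

Lemma is_open_le h u w : (is_open h u w <= edge_count h u w)%N.
Proof. by rewrite /is_open andbC; case: eqP => [->|_] //=; case: (_ != _). Qed.

Lemma edge_count_row h u : (\sum_w edge_count h u w <= size h)%N.
Proof.
elim: h => [|e h IH]; first by rewrite big1 // => w _; rewrite /edge_count; case: phi.
have -> : (\sum_w edge_count (e :: h) u w =
    \sum_w (phi u w == Some e) + \sum_w edge_count h u w)%N.
  rewrite -big_split; apply: eq_bigr => w _; rewrite /edge_count /=.
  by case: (phi u w) => [e'|] //=; rewrite (inj_eq (@Some_inj _)) eq_sym.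
rewrite /= -[(size h).+1]add1n leq_add //; case: (pickP (fun w => phi u w == Some e)) => [w /eqP uw|none].
  rewrite (bigD1 w) //= uw eqxx big1 // => w' ww'; apply/eqP; rewrite eqb0.
  apply: contra ww' => /eqP uw'; apply/eqP.
  by have [[_ ->]|[-> ->]] := phi_inj uw uw'.
by rewrite big1 // => w _; rewrite none.
Qed.

Lemma open_degree_le_size h u : (open_degree h u <= size h)%N.
Proof.
apply: leq_trans (edge_count_row h u).
by apply: leq_sum => w _; exact: is_open_le.
Qed.

Lemma repeat_neighbours h u : (\sum_w (1 < edge_count h u w) <= size h)%N.
Proof.
apply: leq_trans (edge_count_row h u).
by apply: leq_sum => w _; case: edge_count => [|[]].
Qed.

Lemma open_degree_sum h : (\sum_u open_degree h u <= 2 * size h)%N.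
Proof.
apply: (@leq_trans (\sum_u \sum_w edge_count h u w)).
  by apply: leq_sum => u _; apply: leq_sum => w _; exact: is_open_le.
(* [edge_multiplicity] is stated over a numeric domain, so the double count is carried out in the
   integers. *)
have cnt0 e : 0 <= Posz (count_mem e h) by [].
have := edge_multiplicity cnt0.
have -> : \sum_e Posz (count_mem e h) = size h.
  elim: h {cnt0} => [|e h IH]; first by rewrite big1.
  under eq_bigr => e' _ do rewrite /= PoszD.
  rewrite big_split /= IH (bigD1 e) //= eqxx big1 ?addr0 // => e' /negbTE ne.
  by rewrite eq_sym ne.
rewrite -lez_nat PoszM; apply: le_trans; rewrite le_eqVlt; apply/orP; left; apply/eqP.
have PoszS (I : finType) (f : I -> nat) : Posz (\sum_i f i)%N = \sum_i Posz (f i).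
  by elim/big_rec2: _ => // i x y _ <-; rewrite PoszD.
rewrite PoszS; apply: eq_bigr => u _; rewrite PoszS; apply: eq_bigr => w _.
by rewrite /edge_count; case: phi.
Qed.

End WalkCounting.

Section GridExpectation.
Context {R : realType} {E K : finType}.
Variables (vl : K -> R) (q : E -> K -> R).
Implicit Types F G : (E -> R) -> R.

Lemma grid_expectation_sum (I : finType) (Fs : I -> (E -> R) -> R) :
  grid_expectation vl q (fun y => \sum_i Fs i y) = \sum_i grid_expectation vl q (Fs i).
Proof. by rewrite exchange_big; apply: eq_bigr => w _; rewrite mulr_sumr. Qed.

Lemma grid_expectationZ (a : R) F :
  grid_expectation vl q (fun y => a * F y) = a * grid_expectation vl q F.
Proof. by rewrite mulr_sumr; apply: eq_bigr => w _; rewrite mulrCA. Qed.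

Lemma grid_expectation_prod (g : E -> R -> R) :
  grid_expectation vl q (fun y => \prod_e g e (y e)) =
  \prod_e \sum_k q e k * g e (vl k).
Proof.
rewrite bigA_distr_bigA /=; apply: eq_bigr => w _.
by rewrite -big_split.
Qed.

End GridExpectation.

(** * Expected weight of walks, summed one step at a time *)

Section WalkMoments.
Context {R : realType} {V E K : finType}.
Variables (vl : K -> R) (q : E -> K -> R) (phi : V -> V -> option E) (b : E -> R).
Variables (p sigma : R) (deg len : nat).
Hypothesis phi_inj : forall u v u' v' e, phi u v = Some e -> phi u' v' = Some e ->
  u' = u /\ v' = v \/ u' = v /\ v' = u.
Hypothesis phi_sym : forall u v, phi u v = phi v u.
Hypothesis phi_deg : forall u, (\sum_w (phi u w != None) <= deg)%N.
Hypothesis p0 : 0 < p.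
Hypothesis p1 : p <= 1.
Hypothesis sigma1 : 1 <= sigma.
Hypothesis deg_sigma : deg%:R * p <= sigma ^+ 2.
Hypothesis len0 : (0 < len)%N.
Hypothesis q_mean : forall e, \sum_k q e k * (vl k - b e) = 0.
Hypothesis q_moment : forall e j, (1 < j)%N ->
  `|\sum_k q e k * (vl k - b e) ^+ j| <= p * 2 ^+ (j - 2).
Hypothesis q1 : forall e, \sum_k q e k = 1.
Implicit Types (h : seq E) (u v w : V).

Definition edge_matrix (a : E -> R) u w : R := if phi u w is Some e then a e else 0.

(** An edge traversed twice has weight [p]. This price is split as [p / sigma] at discovery and a
    factor [sigma] at closing: with at most [deg] possible discoveries and [deg * p <= sigma ^+ 2],
    both kinds of step then contribute [sigma]. *)
Let weight (c : nat) : R :=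
  if c == 0 then 1 else if c == 1 then p / sigma else p * 2 ^+ (c - 2).

(* The weight of a walk with past [h] and current vertex [u]; [len ^ excess] pays
   for the choice of the edge to close when several are open at [u]. *)
Let bound h u : R :=
  (\prod_e weight (count_mem e h)) * len%:R ^+ excess phi h u.

(** Discoveries and closings give [2 * sigma]. Repeats lead to at most [len] vertices at cost
    [2 * len] each. Discoveries into a vertex with open edges have at most [2 * len] targets and
    cost [len ^+ 2 / sigma] each. *)
Definition walk_rate : R :=
  2 * sigma + 2 * len%:R ^+ 2 + 2 * len%:R ^+ 3 / sigma.

Let sigma0 : 0 < sigma. Proof. exact: lt_le_trans sigma1. Qed.

Let len1 : 1 <= len%:R :> R. Proof. by rewrite ler1n. Qed.

Let weight_ge0 c : 0 <= weight c.
Proof.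
rewrite /weight; case: ifP => // _; case: ifP => _.
  by rewrite mulr_ge0 ?invr_ge0 ?ltW.
by rewrite mulr_ge0 ?exprn_ge0 // ltW.
Qed.

Let bound_ge0 h u : 0 <= bound h u.
Proof. by rewrite mulr_ge0 ?exprn_ge0 // prodr_ge0. Qed.

(** The four terms are: discovery of a vertex without open edges, discovery into a vertex with open
    edges (two units of excess, and [p <= 1]), closing one of the open edges at [u], and a further
    traversal (a factor 2 in [weight] and one unit of excess). Exactly one of them is needed,
    according to how often [e] was used. *)
Let bound_cons e h u w : phi u w = Some e -> (size h <= len)%N ->
  bound (e :: h) w <= bound h u * (p / sigma +
    (0 < open_degree phi h w)%N%:R * (len%:R ^+ 2 / sigma) +
    (is_open phi h u w)%:R * (sigma / (open_degree phi h u)%:R) +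
    (1 < edge_count phi h u w)%N%:R * (2 * len%:R)).
Proof.
move=> uw hlen; pose rest := \prod_(e' | e' != e) weight (count_mem e' h).
have rest0 : 0 <= rest by exact: prodr_ge0.
have bE x : bound h x = weight (count_mem e h) * rest * len%:R ^+ excess phi h x.
  by rewrite /bound (bigD1 e).
have bE' x : bound (e :: h) x =
    weight (count_mem e h).+1 * rest * len%:R ^+ excess phi (e :: h) x.
  rewrite /bound (bigD1 e) //= eqxx add1n; congr (_ * _ * _); apply: eq_bigr => e' ne.
  by rewrite eq_sym (negbTE ne).
have powle i j : (i <= j)%N -> len%:R ^+ i <= len%:R ^+ j :> R by exact: ler_weXn2l.
have ps0 : 0 <= p / sigma by rewrite divr_ge0 // ltW.
have s0 := ltW sigma0; have sl0 : 0 <= len%:R ^+ 2 / sigma by rewrite divr_ge0.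
have so0 : 0 <= sigma / (open_degree phi h u)%:R by rewrite divr_ge0.
have drop (A B C D : R) : 0 <= A -> 0 <= B -> 0 <= C -> 0 <= D ->
  forall x, 0 <= x -> [/\ x * A <= x * (A + B + C + D), x * B <= x * (A + B + C + D),
    x * C <= x * (A + B + C + D) & x * D <= x * (A + B + C + D)].
  by move=> *; split; apply: ler_wpM2l => //; lra.
have [dA dB dC dD] := drop _ _ _ _ ps0
  (mulr_ge0 (ler0n R (0 < open_degree phi h w)) sl0)
  (mulr_ge0 (ler0n R (is_open phi h u w)) so0)
  (mulr_ge0 (ler0n R (1 < edge_count phi h u w)%N) (mulr_ge0 (ler0n R 2) (ler0n R len)))
  _ (bound_ge0 h u).
case c: (count_mem e h) => [|[|c']].
- have := excess_new phi_inj phi_sym uw c.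
  have [ow|ow] : open_degree phi h w = 0%N \/ (0 < open_degree phi h w)%N.
    by case: posnP; [left | right].
    rewrite {1}ow addn0 => ex; apply: le_trans dA; rewrite bE bE' c /weight /= mul1r.
    by rewrite [leRHS]mulrC [leRHS]mulrA ler_wpM2l ?powle // mulr_ge0.
  rewrite {1}ow muln1 => ex; apply: le_trans dB; rewrite ow mul1r.
  rewrite bE bE' c /weight /= mul1r.
  have := powle _ _ ex; rewrite exprD => hp.
  apply: le_trans (ler_wpM2l (mulr_ge0 ps0 rest0) hp) _.
  rewrite [leLHS](_ : _ = p * (rest * len%:R ^+ excess phi h u * (len%:R ^+ 2 / sigma))); last by ring.
  rewrite -[leRHS]mul1r; apply: ler_wpM2r => //; apply: mulr_ge0 => //.
  by apply: mulr_ge0 => //; exact: exprn_ge0.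
- have o0 := count_open_degree uw c.
  have isop : is_open phi h u w by rewrite /is_open /edge_count uw c.
  apply: le_trans dC; rewrite isop mul1r bE bE' c /weight /= expr0 mulr1.
  rewrite [leRHS](_ : _ = p * rest * (len%:R ^+ excess phi h u / (open_degree phi h u)%:R)); last first.
    by field; rewrite pnatr_eq0 -lt0n o0 gt_eqF.
  rewrite ler_wpM2l ?mulr_ge0 ?(ltW p0) // ler_pdivlMr ?ltr0n //.
  (* With several open edges at [u] the released unit of excess is a factor [len], at least their
     number; with a single one there is no choice to pay for. *)
  have := excess_close phi_inj phi_sym uw c; case: ltnP => [_|o1].
    rewrite addn1 => /powle; apply: le_trans; rewrite exprSr ler_wpM2l ?exprn_ge0 //.
    by rewrite ler_nat (leq_trans (open_degree_le_size phi_inj h u)).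
  have -> : open_degree phi h u = 1%N by apply/eqP; rewrite eqn_leq o1.
  by rewrite addn0 mulr1 => /powle.
- have c2 : (1 < count_mem e h)%N by rewrite c.
  have := excess_repeat phi_inj phi_sym uw c2; rewrite addn1 => /powle hp.
  apply: le_trans dD; rewrite /edge_count uw c2 mul1r bE bE' c /weight /= !subSS !subn0.
  apply: le_trans (ler_wpM2l _ hp) _; first by rewrite !mulr_ge0 ?exprn_ge0 ?(ltW p0).
  by rewrite !exprS le_eqVlt; apply/orP; left; apply/eqP; ring.
Qed.

Let bound_step h u : (size h <= len)%N ->
  \sum_w (if phi u w is Some e then bound (e :: h) w else 0) <= walk_rate * bound h u.
Proof.
move=> hlen; rewrite mulrC.
have s0 := ltW sigma0.
apply: (@le_trans _ _ (\sum_w bound h u * ((phi u w != None)%:R * (p / sigma) +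
    (0 < open_degree phi h w)%N%:R * (len%:R ^+ 2 / sigma) +
    (is_open phi h u w)%:R * (sigma / (open_degree phi h u)%:R) +
    (1 < edge_count phi h u w)%N%:R * (2 * len%:R)))).
  apply: ler_sum => w _; case uw: (phi u w) => [e|].
    by rewrite mul1r; exact: bound_cons.
  apply: mulr_ge0 => //; do 3?[apply: addr_ge0]; apply: mulr_ge0;
    by rewrite ?ler0n ?divr_ge0 ?mulr_ge0 ?exprn_ge0 ?(ltW p0).
rewrite -mulr_sumr ler_wpM2l //.
rewrite !big_split /= -!mulr_suml -!natr_sum.
have h1 : (\sum_w (phi u w != None))%N%:R * (p / sigma) <= sigma.
  rewrite mulrA ler_pdivrMr // -expr2; apply: le_trans deg_sigma.
  by rewrite ler_wpM2r ?(ltW p0) // ler_nat.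
have h2 : (\sum_w (0 < open_degree phi h w))%N%:R * (len%:R ^+ 2 / sigma) <=
    2 * len%:R ^+ 3 / sigma.
  rewrite [leRHS](_ : _ = (2 * len%:R) * (len%:R ^+ 2 / sigma)); last by ring.
  rewrite ler_wpM2r ?divr_ge0 ?exprn_ge0 // -natrM ler_nat.
  apply: leq_trans (_ : 2 * size h <= _)%N; last by rewrite leq_mul2l.
  apply: leq_trans (open_degree_sum phi_inj h).
  by apply: leq_sum => w _; case: open_degree.
have h3 : (\sum_w is_open phi h u w)%N%:R * (sigma / (open_degree phi h u)%:R) <= sigma.
  rewrite -/(open_degree phi h u); have [->|o0] := posnP (open_degree phi h u).
    by rewrite mul0r.
  by rewrite mulrCA divff ?mulr1 // pnatr_eq0 -lt0n.
have h4 : (\sum_w (1 < edge_count phi h u w))%N%:R * (2 * len%:R) <= 2 * len%:R ^+ 2 :> R.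
  rewrite mulrCA ler_pM2l // expr2 ler_wpM2r // ler_nat.
  exact: leq_trans (repeat_neighbours phi_inj h u) hlen.
move: (lerD (lerD (lerD h1 h2) h3) h4); rewrite /walk_rate => /le_trans; apply.
by rewrite le_eqVlt; apply/orP; left; apply/eqP; ring.
Qed.

Let monomial h (y : E -> R) : R := \prod_(e <- h) (y e - b e).

Let monomialE h y : monomial h y = \prod_e (y e - b e) ^+ count_mem e h.
Proof.
elim: h => [|e h IH]; first by rewrite /monomial big_nil big1.
rewrite /monomial big_cons -/(monomial h y) IH.
under [RHS]eq_bigr => e' _ do rewrite /= exprD.
rewrite big_split /= [X in _ = X * _](bigD1 e) //= eqxx expr1 [X in _ = _ * X * _]big1 ?mulr1 //.
by move=> e' /negbTE ne; rewrite eq_sym ne expr0.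
Qed.

(** Centering enters here: an edge used exactly once makes the moment vanish, which leaves the value
    [p / sigma] of [weight 1] free to be chosen as a potential. *)
Let monomial_moment h : `|grid_expectation vl q (monomial h)| <=
  \prod_e weight (count_mem e h).
Proof.
have -> : grid_expectation vl q (monomial h) =
    \prod_e \sum_k q e k * (vl k - b e) ^+ count_mem e h.
  rewrite -(grid_expectation_prod vl q (fun e t => (t - b e) ^+ count_mem e h)).
  by apply: eq_bigr => w _; rewrite monomialE.
rewrite normr_prod; apply: ler_prod => e _; rewrite normr_ge0 /=.
case: (count_mem e h) => [|[|c]].
- by under eq_bigr => k _ do rewrite expr0 mulr1; rewrite q1 normr1.
- by under eq_bigr => k _ do rewrite expr1; rewrite q_mean normr0 weight_ge0.
- exact: q_moment.
Qed.

(** Induction on the number [k] of steps still to come, with the past [h] kept as a monomial. Each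
    step of the operator prepends an edge to [h], and [bound_step] sums the bound over the next
    vertex; at [k = 0] the moment of the completed monomial is estimated. *)
Let moment_induction k h u v : (size h + k <= len)%N ->
  `|grid_expectation vl q (fun y => monomial h y *
      iter k (apply_op (edge_matrix (fun e => y e - b e))) (delta v) u)| <=
  bound h u * walk_rate ^+ k.
Proof.
elim: k h u => [|k IH] h u; rewrite ?addn0 ?addnS => hk /=.
  rewrite expr0 mulr1 /delta.
  have -> : (fun y => monomial h y * (u == v)%:R) = (fun y => (u == v)%:R * monomial h y).
    by apply/funext => y; rewrite mulrC.
  rewrite grid_expectationZ normrM.
  apply: le_trans (_ : 1 * \prod_e weight (count_mem e h) <= _).
    apply: ler_pM => //.
    by case: eqP; rewrite ?normr1 // normr0.
  by rewrite mulrC ler_wpM2l ?prodr_ge0 // exprn_ege1.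
pose G w (y : E -> R) : R := if phi u w is Some e then monomial (e :: h) y *
  iter k (apply_op (edge_matrix (fun e => y e - b e))) (delta v) w else 0.
have -> : (fun y => monomial h y * apply_op (edge_matrix (fun e => y e - b e))
    (iter k (apply_op (edge_matrix (fun e => y e - b e))) (delta v)) u) =
  (fun y => \sum_w G w y).
  apply/funext => y; rewrite /apply_op mulr_sumr; apply: eq_bigr => w _.
  rewrite /G {1}/edge_matrix; case: (phi u w) => [e|]; last by rewrite mul0r mulr0.
  by rewrite /monomial big_cons; ring.
rewrite grid_expectation_sum; apply: le_trans (ler_norm_sum _ _ _) _.
have rate0 : 0 <= walk_rate.
  by rewrite /walk_rate !addr_ge0 ?mulr_ge0 ?exprn_ge0 ?invr_ge0 ?(ltW sigma0).
apply: le_trans (_ : \sum_w (if phi u w is Some e then bound (e :: h) w else 0)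
    * walk_rate ^+ k <= _).
  apply: ler_sum => w _; rewrite /G; case: (phi u w) => [e|].
    by apply: IH; rewrite addSn.
  rewrite mul0r (_ : grid_expectation _ _ _ = 0) ?normr0 //.
  by rewrite /grid_expectation big1 // => w' _; rewrite mulr0.
rewrite -mulr_suml exprS mulrA [bound h u * _]mulrC ler_wpM2r ?exprn_ge0 //.
by apply: bound_step; apply: leq_trans hk; rewrite ltnW // ltnS leq_addr.
Qed.

Lemma walk_moment u v :
  grid_expectation vl q (fun y =>
      iter len (apply_op (edge_matrix (fun e => y e - b e))) (delta v) u) <=
  walk_rate ^+ len.
Proof.
have := @moment_induction len [::] u v (leqnn _).
have -> : bound [::] u = 1.
  rewrite /bound big1 // mul1r /excess big1 ?expr0 // => w _.
  by rewrite /open_degree big1 // => x _; rewrite /is_open /edge_count; case: phi.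
rewrite mul1r; apply: le_trans; apply: le_trans (ler_norm _).
by rewrite le_eqVlt; apply/orP; left; apply/eqP; apply: eq_bigr => w _;
   rewrite /monomial big_nil mul1r.
Qed.

End WalkMoments.

(** * Mean and exponential moments of the norm of a random matrix *)

Section RandomEdgeMatrix.
Context {R : realType} {V E K : finType}.
Variables (vl : K -> R) (q : E -> K -> R) (phi : V -> V -> option E) (b : E -> R).
Variables (p sigma : R) (deg : nat).
Hypothesis phi_inj : forall u v u' v' e, phi u v = Some e -> phi u' v' = Some e ->
  u' = u /\ v' = v \/ u' = v /\ v' = u.
Hypothesis phi_sym : forall u v, phi u v = phi v u.
Hypothesis phi_deg : forall u, (\sum_w (phi u w != None) <= deg)%N.
Hypothesis p0 : 0 < p.
Hypothesis p1 : p <= 1.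
Hypothesis sigma1 : 1 <= sigma.
Hypothesis deg_sigma : deg%:R * p <= sigma ^+ 2.
Hypothesis vl1 : forall k, `|vl k| <= 1.
Hypothesis vl_inj : injective vl.
Hypothesis q0 : forall e k, 0 <= q e k.
Hypothesis q1 : forall e, \sum_k q e k = 1.
Hypothesis q_mean : forall e, \sum_k q e k * (vl k - b e) = 0.
Hypothesis q_moment : forall e j, (1 < j)%N ->
  `|\sum_k q e k * (vl k - b e) ^+ j| <= p * 2 ^+ (j - 2).

Definition centered_opnorm (y : E -> R) : R :=
  opnorm (edge_matrix phi (fun e => y e - b e)).

Lemma edge_matrix_sym (a : E -> R) u w : edge_matrix phi a u w = edge_matrix phi a w u.
Proof. by rewrite /edge_matrix phi_sym. Qed.

Lemma grid_expectation_le F G : (forall y, F y <= G y) ->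
  grid_expectation vl q F <= grid_expectation vl q G.
Proof.
by move=> FG; apply: ler_sum => w _; apply: ler_wpM2l => //; exact: prodr_ge0.
Qed.

Lemma grid_expectation_affine (a c : R) F :
  grid_expectation vl q (fun y => a * F y + c) = a * grid_expectation vl q F + c.
Proof. by rewrite -!(avg_enum q1 vl_inj _ (fun=> 0)) (avg_affine _ q1). Qed.

(** Instead of taking a root of the trace moment, the norm is bounded pointwise by
    [t + t * (trace / t ^+ L)] with [L = 2 * 2 ^ j]: either it is at most [t], or its ratio to [t]
    is at most the [L]-th power of that ratio. *)
Lemma expectation_opnorm j t : 0 < t ->
  grid_expectation vl q centered_opnorm <=
  t * (1 + #|V|%:R * (walk_rate sigma (2 * 2 ^ j) / t) ^+ (2 * 2 ^ j)).
Proof.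
move=> t0; pose L := (2 * 2 ^ j)%N; rewrite -/L.
have L0 : (0 < L)%N by rewrite muln_gt0 expn_gt0.
pose trace (y : E -> R) := \sum_v
  iter L (apply_op (edge_matrix phi (fun e => y e - b e))) (delta v) v.
have trace_ge0 y : 0 <= trace y.
  pose zero : V -> R := fun=> 0.
  have dot0 z : dot zero z = 0 by rewrite /dot big1 // => u _; rewrite mul0r.
  have d1 : dot zero zero <= 1 by rewrite dot0.
  have := op_power_trace (edge_matrix_sym (fun e => y e - b e)) j d1 d1.
  by rewrite -/L dot0 expr0n (gtn_eqF L0).
have H y : centered_opnorm y <= t / t ^+ L * trace y + t.
  apply: opnorm_le => x z hx hz; set d := dot _ _.
  have [dt|td] := leP d t.
    by apply: le_trans dt _; rewrite lerDr mulr_ge0 // divr_ge0 ?exprn_ge0 ?ltW.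
  apply: le_trans (_ : t / t ^+ L * trace y <= _); last by rewrite lerDl ltW.
  have := op_power_trace (edge_matrix_sym (fun e => y e - b e)) j hx hz.
  rewrite -/L -/d -/(trace y) => hd; rewrite mulrAC ler_pdivlMr ?exprn_gt0 //.
  apply: le_trans (ler_wpM2l (ltW t0) hd).
  rewrite -(prednK L0) !exprS mulrCA ler_wpM2l ?(ltW t0) //.
  rewrite ler_wpM2l ?(ltW (lt_trans t0 td)) // lerXn2r ?nnegrE ?(ltW t0) ?(ltW td) //.
  exact: ltW (lt_trans t0 td).
apply: le_trans (grid_expectation_le H) _.
rewrite grid_expectation_affine mulrDr mulr1 [leRHS]addrC lerD2r.
rewrite -mulrA ler_wpM2l ?(ltW t0) // exprMn exprVn mulrA [leLHS]mulrC.
rewrite ler_wpM2r ?invr_ge0 ?exprn_ge0 ?(ltW t0) //.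
rewrite grid_expectation_sum -sum1_card natr_sum mulr_suml; apply: ler_sum => v _.
by rewrite mul1r; exact: (@walk_moment _ _ _ _ vl q phi b p sigma deg).
Qed.

Lemma centered_opnorm_convex lam : 0 <= lam ->
  cube_convex (fun y => lam * centered_opnorm y).
Proof.
move=> l0 s x y s0 s1 cx cy.
rewrite mulrCA [s * (_ * _)]mulrCA -mulrDr ler_wpM2l // /centered_opnorm.
apply: le_trans (opnorm_comb _ _ s0 s1); rewrite le_eqVlt; apply/orP; left; apply/eqP.
congr opnorm; apply/funext => u; apply/funext => w.
rewrite /edge_matrix /convex_comb; case: (phi u w) => [e|]; ring.
Qed.

(** The factor 2 appears because a variable occupies up to two positions of the matrix; it turns the
    constant 16 of the concentration inequality into 32. *)
Lemma centered_opnorm_lipschitz lam x y :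
  (lam * centered_opnorm x - lam * centered_opnorm y) ^+ 2 <=
  (2 * lam ^+ 2) * \sum_e (x e - y e) ^+ 2.
Proof.
rewrite -mulrBr exprMn [2 * lam ^+ 2]mulrC -[leRHS]mulrA.
apply: ler_wpM2l; first exact: sqr_ge0.
apply: le_trans (opnorm_lipschitz _ _) _.
apply: le_trans (edge_multiplicity phi_inj (fun e => sqr_ge0 (x e - y e))).
rewrite le_eqVlt; apply/orP; left; apply/eqP.
apply: eq_bigr => u _; apply: eq_bigr => w _; rewrite /edge_matrix.
by case: (phi u w) => [e|]; ring.
Qed.

Lemma opnorm_exp_moment j t lam : 0 < t -> 0 <= lam ->
  grid_expectation vl q (fun y => expR (lam * centered_opnorm y)) <=
  expR (lam * (t * (1 + #|V|%:R * (walk_rate sigma (2 * 2 ^ j) / t) ^+ (2 * 2 ^ j)))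
        + 32 * lam ^+ 2).
Proof.
move=> t0 l0; rewrite -(avg_enum q1 vl_inj _ (fun=> 0)).
have c0 : cube ((fun=> 0) : E -> R) by move=> e; rewrite normr0.
have := @convex_lipschitz_expR R E K vl q vl1 q0 q1 (enum E)
  (fun y => lam * centered_opnorm y) (2 * lam ^+ 2) (fun=> 0) (enum_uniq _).
move=> /(_ _ (centered_opnorm_convex l0) _ _ _ c0) /le_trans; apply.
- by move=> x _; rewrite mulr_ge0 // opnorm_ge0.
- by rewrite mulr_ge0 ?sqr_ge0.
- by move=> e; rewrite mem_enum.
- by move=> x y _ _; exact: centered_opnorm_lipschitz.
rewrite ler_expR (avg_enum q1 vl_inj) grid_expectationZ.
rewrite (_ : 16 * (2 * lam ^+ 2) = 32 * lam ^+ 2); last by ring.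
rewrite lerD2r.
by rewrite ler_wpM2l // expectation_opnorm.
Qed.

End RandomEdgeMatrix.

(** * Products of independent bounded variables *)

Section BoundedExpectation.
Context d (T : measurableType d) (R : realType) (P : probability T R).
Implicit Types f g : T -> R.

Definition bounded_measurable f :=
  measurable_fun [set: T] f /\ exists C, forall w, `|f w| <= C.

Let mean f : R := \int[P]_w f w.

Lemma bounded_measurable_integrable f :
  bounded_measurable f -> P.-integrable [set: T] (EFin \o f).
Proof.
case=> mf [C hC]; apply: measurable_bounded_integrable => //.
  by rewrite (le_lt_trans (probability_le1 P measurableT)) ?ltry.
exists C; split; first exact: num_real.
by move=> M CM w _; exact: le_trans (hC w) (ltW CM).
Qed.

Lemma bounded_measurable_cst (r : R) : bounded_measurable (cst r).
Proof. by split; [exact: measurable_cst | exists `|r|]. Qed.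

Lemma bounded_measurableM f g : bounded_measurable f -> bounded_measurable g ->
  bounded_measurable (fun w => f w * g w).
Proof.
case=> mf [C hC] [mg [D hD]]; split; first exact: measurable_funM.
by exists (C * D) => w; rewrite normrM ler_pM.
Qed.

Lemma bounded_measurableD f g : bounded_measurable f -> bounded_measurable g ->
  bounded_measurable (fun w => f w + g w).
Proof.
case=> mf [C hC] [mg [D hD]]; split; first exact: measurable_funD.
by exists (C + D) => w; apply: le_trans (ler_normD _ _) _; exact: lerD.
Qed.

Lemma bounded_measurable_indic (A : set T) : measurable A ->
  bounded_measurable (\1_A : T -> R).
Proof.
move=> mA; split; first exact: measurable_indic.
by exists 1 => w; rewrite indicE; case: (_ \in _); rewrite ?normr1 ?normr0.
Qed.

Lemma bounded_measurable_sum (I : Type) (s : seq I) (f : I -> T -> R) :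
  (forall i, bounded_measurable (f i)) -> bounded_measurable (fun w => \sum_(i <- s) f i w).
Proof.
move=> bf; elim: s => [|i s IH].
  under eq_fun do rewrite big_nil; exact: bounded_measurable_cst.
under eq_fun do rewrite big_cons; exact: bounded_measurableD.
Qed.

Lemma bounded_measurable_prod (I : Type) (s : seq I) (f : I -> T -> R) :
  (forall i, bounded_measurable (f i)) -> bounded_measurable (fun w => \prod_(i <- s) f i w).
Proof.
move=> bf; elim: s => [|i s IH].
  under eq_fun do rewrite big_nil; exact: bounded_measurable_cst.
under eq_fun do rewrite big_cons; exact: bounded_measurableM.
Qed.

Lemma mean_sum (I : Type) (s : seq I) (f : I -> T -> R) :
  (forall i, bounded_measurable (f i)) ->
  \int[P]_w (\sum_(i <- s) f i w) = \sum_(i <- s) \int[P]_w f i w.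
Proof.
move=> bf; elim: s => [|i s IH].
  under eq_Rintegral do rewrite big_nil.
  by rewrite Rintegral_cst // mul0r big_nil.
under eq_Rintegral do rewrite big_cons.
rewrite RintegralD ?big_cons ?IH //; apply: bounded_measurable_integrable => //.
exact: bounded_measurable_sum.
Qed.

Lemma meanZ f (a : R) : bounded_measurable f ->
  \int[P]_w (a * f w) = a * \int[P]_w f w.
Proof. by move=> bf; rewrite RintegralZl //; exact: bounded_measurable_integrable. Qed.

Lemma mean_cst (r : R) : \int[P]_w r = r.
Proof.
rewrite Rintegral_cst // (_ : fine _ = 1) ?mulr1 //.
by rewrite -[RHS]/(fine 1%E); congr fine; exact: probability_setT.
Qed.

Lemma mean_le f g : bounded_measurable f -> bounded_measurable g ->
  (forall w, f w <= g w) -> \int[P]_w f w <= \int[P]_w g w.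
Proof. by move=> bf bg fg; apply: le_Rintegral => //; exact: bounded_measurable_integrable. Qed.

Lemma mean_indic (A : set T) : measurable A -> \int[P]_w \1_A w = fine (P A).
Proof. by move=> mA; rewrite /Rintegral integral_indic // setIT. Qed.

Lemma mean_dist f g (eps : R) : bounded_measurable f -> bounded_measurable g ->
  (forall w, `|f w - g w| <= eps) -> `|\int[P]_w f w - \int[P]_w g w| <= eps.
Proof.
move=> bf bg fg; rewrite -RintegralB //; try exact: bounded_measurable_integrable.
have bfg : bounded_measurable (fun w => f w - g w).
  have := bounded_measurableD bf (bounded_measurableM (bounded_measurable_cst (-1)) bg).
  by congr bounded_measurable; apply/funext => w; rewrite /= mulN1r.
rewrite ler_norml -[X in X <= _ <= _]mean_cst -[X in _ <= _ <= X]mean_cst.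
apply/andP; split; apply: mean_le => //; try exact: bounded_measurable_cst.
all: by move=> w; have := fg w; rewrite ler_norml => /andP[].
Qed.

Lemma mean_unit_interval f : bounded_measurable f -> (forall w, 0 <= f w <= 1) ->
  0 <= \int[P]_w f w <= 1.
Proof.
move=> bf f01; rewrite -[X in X <= _ <= _]mean_cst -[X in _ <= _ <= X]mean_cst.
apply/andP; split; apply: mean_le => //; try exact: bounded_measurable_cst.
all: by move=> w; have /andP[] := f01 w.
Qed.

End BoundedExpectation.

Lemma prod_dist_le (R : realDomainType) (I : finType) (a b : I -> R) :
  (forall i, 0 <= a i <= 1) -> (forall i, 0 <= b i <= 1) ->
  `|\prod_i a i - \prod_i b i| <= \sum_i `|a i - b i|.
Proof.
move=> a01 b01.
suff : [/\ 0 <= \prod_i a i <= 1, 0 <= \prod_i b i <= 1 &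
   `|\prod_i a i - \prod_i b i| <= \sum_i `|a i - b i|] by case.
elim/big_rec3: _ => [|i s y x _ [/andP[x0 x1] /andP[y0 y1] h]].
  by rewrite subrr normr0 !lexx ler01.
have /andP[a0 a1] := a01 i; have /andP[b0 b1] := b01 i.
split; [by rewrite mulr_ge0 ?mulr_ile1 | by rewrite mulr_ge0 ?mulr_ile1 |].
have -> : a i * x - b i * y = (a i - b i) * x + b i * (x - y) by ring.
apply: le_trans (ler_normD _ _) _; rewrite !normrM (ger0_norm x0) (ger0_norm b0).
apply: lerD; first by rewrite ler_piMr.
by apply: le_trans h; rewrite ler_piMl.
Qed.

Section Discretization.
Context {R : realType}.

(** The sum counts the positive integers up to [y], that is, it is the floor of [y]. *)
Lemma discretize (N : nat) (y : R) : 0 <= y -> y <= N%:R ->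
  y - 1 <= \sum_(j < N) (j.+1%:R <= y)%R%:R <= y.
Proof.
elim: N => [|N IH] y0 yN.
  by rewrite big_ord0; apply/andP; split; lra.
rewrite big_ord_recr /=; have [ge|lt] := leP N.+1%:R y.
  rewrite (eq_bigr (fun=> 1)) => [|i _]; last first.
    by rewrite (le_trans _ ge) // ler_nat ltnW // ltnS ltn_ord.
  rewrite sumr_const card_ord; move: ge yN; rewrite -natr1 -[true%:R]/(1 : R) => ge yN.
  by apply/andP; split; lra.
rewrite addr0; have [yN'|yN'] := leP y N%:R; first exact: IH.
rewrite (eq_bigr (fun=> 1)) => [|i _]; last first.
  by rewrite (le_trans _ (ltW yN')) // ler_nat ltn_ord.
rewrite sumr_const card_ord; move: lt; rewrite -natr1 => lt.
by apply/andP; split; lra.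
Qed.

End Discretization.

Section IndependentProducts.
Context d (T : measurableType d) (R : realType) (P : probability T R).
Variables (I : finType) (Z : I -> T -> R).
Hypothesis mZ : forall i, measurable_fun [set: T] (Z i).
Hypothesis Z01 : forall i w, 0 <= Z i w <= 1.
Hypothesis indepZ : forall t : I -> R,
  P (\bigcap_(i in [set` [set: I]%SET]) [set w | t i <= Z i w]) =
  (\prod_i fine (P [set w | t i <= Z i w]))%:E.

Let level (i : I) (t : R) : set T := [set w | t <= Z i w].

Let mlevel i t : measurable (level i t).
Proof.
have -> : level i t = Z i @^-1` `[t, +oo[.
  by apply/seteqP; split=> w /=; rewrite in_itv /= andbT.
by rewrite -[X in measurable X]setTI; apply: mZ.
Qed.

Let bZ i : bounded_measurable (Z i).
Proof.
split=> //; exists 1 => w; have /andP[z0 z1] := Z01 i w; by rewrite ger0_norm.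
Qed.

Section Approximation.
Variable N : nat.

(** [Z i] rounded down to a multiple of [1 / (N + 1)]. Products of such sums expand into indicators
    of intersections of upper level sets, on which [indepZ] applies; the rounding error vanishes as
    [N] grows. *)
Let approx i w : R := \sum_(j < N.+1) N.+1%:R^-1 * \1_(level i (j.+1%:R / N.+1%:R)) w.

Let approxE i w :
  approx i w = N.+1%:R^-1 * \sum_(j < N.+1) (j.+1%:R <= N.+1%:R * Z i w)%R%:R.
Proof.
rewrite mulr_sumr; apply: eq_bigr => j _; congr (_ * _); rewrite indicE; congr (nat_of_bool _)%:R.
by apply/idP/idP; rewrite ?inE /level /= ler_pdivrMr ?ltr0n // mulrC.
Qed.

Let approx_close i w : `|Z i w - approx i w| <= N.+1%:R^-1.
Proof.
have /andP[z0 z1] := Z01 i w.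
have N0 : 0 < N.+1%:R :> R by rewrite ltr0n.
have y0 : 0 <= N.+1%:R * Z i w by rewrite mulr_ge0.
have yN : N.+1%:R * Z i w <= N.+1%:R by rewrite -[leRHS]mulr1 ler_pM2l.
have := discretize y0 yN; set S := \sum_(j < _) _ => /andP[h1 h2].
rewrite approxE -/S -(ler_pM2l N0) divff ?gt_eqF // -[X in X * _ <= _](gtr0_norm N0) -normrM.
by rewrite mulrBr mulrA divff ?gt_eqF // mul1r ler_norml; apply/andP; split; lra.
Qed.

Let approx01 i w : 0 <= approx i w <= 1.
Proof.
have /andP[z0 z1] := Z01 i w.
have N0 : 0 < N.+1%:R :> R by rewrite ltr0n.
have y0 : 0 <= N.+1%:R * Z i w by rewrite mulr_ge0.
have yN : N.+1%:R * Z i w <= N.+1%:R by rewrite -[leRHS]mulr1 ler_pM2l.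
have /andP[_ h2] := discretize y0 yN.
rewrite approxE mulr_ge0 ?invr_ge0 //=; last by apply: sumr_ge0.
rewrite mulrC ler_pdivrMr // mul1r; apply: le_trans h2 yN.
Qed.

Let blevel (a : R) i t : bounded_measurable (fun w => a * \1_(level i t) w).
Proof.
by apply: bounded_measurableM; [exact: bounded_measurable_cst |
  exact/bounded_measurable_indic/mlevel].
Qed.

Let bapprox i : bounded_measurable (approx i).
Proof. by apply: bounded_measurable_sum. Qed.

Let mean_approx i : \int[P]_w approx i w =
  \sum_(j < N.+1) N.+1%:R^-1 * fine (P (level i (j.+1%:R / N.+1%:R))).
Proof.
rewrite mean_sum //; apply: eq_bigr => j _; rewrite meanZ ?mean_indic //.
exact/bounded_measurable_indic/mlevel.
Qed.

Let mean_approx_prod : \int[P]_w (\prod_i approx i w) = \prod_i \int[P]_w approx i w.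
Proof.
under [RHS]eq_bigr => i _ do rewrite mean_approx.
rewrite bigA_distr_bigA /=.
under eq_Rintegral => w _ do rewrite bigA_distr_bigA /=.
have bprod (f : {ffun I -> 'I_N.+1}) : bounded_measurable (fun w =>
    \prod_i (N.+1%:R^-1 * \1_(level i ((f i).+1%:R / N.+1%:R)) w) : R).
  exact: bounded_measurable_prod.
rewrite mean_sum //; apply: eq_bigr => f _.
rewrite big_split /=.
under eq_Rintegral => w _ do rewrite big_split /=.
rewrite meanZ; last by apply: bounded_measurable_prod => i; exact/bounded_measurable_indic/mlevel.
congr (_ * _).
have mcap : measurable (\bigcap_(i in [set` [set: I]%SET]) level i ((f i).+1%:R / N.+1%:R)).
  by apply: fin_bigcap_measurable.
transitivity (\int[P]_w \1_(\bigcap_(i in [set` [set: I]%SET]) level i ((f i).+1%:R / N.+1%:R)) w).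
  apply: eq_Rintegral => w _; rewrite indicE.
  have [h|h] := boolP (w \in _).
    rewrite big1 // => i _; rewrite indicE.
    by move: h; rewrite inE => /(_ i); rewrite /= finset.in_setT => /(_ isT) hi; rewrite mem_set.
  have [i hi] : exists i, ~ level i ((f i).+1%:R / N.+1%:R) w.
    apply/not_existsP => H; move/negP: h; apply; rewrite inE => i _.
    exact: contrapT (H i).
  by rewrite (bigD1 i) //= indicE memNset // mul0r.
by rewrite mean_indic // indepZ.
Qed.

Lemma mean_prod_approx :
  `|\int[P]_w (\prod_i Z i w) - \prod_i \int[P]_w Z i w| <= 2 * #|I|%:R / N.+1%:R.
Proof.
have sumI (x : I -> R) : (forall i, x i <= N.+1%:R^-1) -> \sum_i x i <= #|I|%:R / N.+1%:R.
  move=> hx; apply: le_trans (_ : \sum_(i : I) N.+1%:R^-1 <= _); first exact: ler_sum.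
  by rewrite sumr_const mulr_natl.
rewrite -(subrK (\int[P]_w \prod_i approx i w) (\int[P]_w \prod_i Z i w)).
rewrite -addrA; apply: le_trans (ler_normD _ _) _.
rewrite (_ : 2 * _ / _ = #|I|%:R / N.+1%:R + #|I|%:R / N.+1%:R); last by ring.
apply: lerD.
  apply: mean_dist; try exact: bounded_measurable_prod.
  move=> w; apply: le_trans (prod_dist_le _ _) _ => //; exact: sumI.
rewrite mean_approx_prod distrC.
apply: le_trans (prod_dist_le _ _) _ => [i|i|]; try exact: mean_unit_interval.
by apply: sumI => i; exact: mean_dist.
Qed.

End Approximation.

Lemma mean_prod_indep : \int[P]_w (\prod_i Z i w) = \prod_i \int[P]_w Z i w.
Proof.
apply/eqP; rewrite -subr_eq0 -normr_le0; apply/ler_addgt0Pr => eps e0.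
rewrite add0r; pose N := Num.truncn (2 * #|I|%:R / eps).
apply: le_trans (mean_prod_approx N) _.
rewrite ler_pdivrMr ?ltr0n // -ler_pdivrMl //.
by rewrite mulrC ltW // truncnS_gt.
Qed.

End IndependentProducts.

(** * Reduction to entries with values in [{-1, 0, 1}] *)

Section ThreePointLaw.
Context {R : realType}.
Implicit Types (o s : bool) (k : option bool) (x p mu : R).

Definition tri_value k : R := if k is Some s then (if s then 1 else - 1) else 0.

Definition value_factor x k : R := if k is Some _ then (1 + tri_value k * x) / 2 else 1.
Definition obs_factor o k : R := if (k != None) == o then 1 else 0.
Definition obs_prob p k : R := if k is Some _ then p else 1 - p.

(** Law of a random rounding of one entry, given its value [x] and its observation indicator [o]. It
    factors in [o] and [x], so independence of the two turns its mean into [tri_law]. *)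
Definition tri_weight o x k : R := obs_factor o k * value_factor x k.
Definition tri_law p mu k : R := obs_prob p k * value_factor mu k.

Lemma sum_option_bool (f : option bool -> R) :
  \sum_k f k = f None + (f (Some true) + f (Some false)).
Proof.
rewrite (bigD1 None) //= (bigD1 (Some true)) //= (bigD1 (Some false)) //=.
by rewrite big1 ?addr0 // => -[[]|].
Qed.

Lemma tri_value_le1 k : `|tri_value k| <= 1.
Proof. by case: k => [[]|] /=; rewrite ?normrN ?normr1 ?normr0. Qed.

Lemma tri_value_inj : injective tri_value.
Proof. by move=> [[]|] [[]|] //= h; exfalso; lra. Qed.

Lemma value_factor01 x k : `|x| <= 1 -> 0 <= value_factor x k <= 1.
Proof.
by rewrite ler_norml => /andP[x0 x1]; case: k => [[]|] /=; apply/andP; split; lra.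
Qed.

Lemma tri_weight_ge0 o x k : `|x| <= 1 -> 0 <= tri_weight o x k.
Proof.
by move=> /(value_factor01 k)/andP[h _]; rewrite mulr_ge0 // /obs_factor; case: ifP.
Qed.

Lemma tri_weight_sum o x : \sum_k tri_weight o x k = 1.
Proof. by rewrite sum_option_bool /tri_weight /=; case: o; rewrite /obs_factor /=; field. Qed.

Lemma tri_law_ge0 p mu k : 0 <= p -> p <= 1 -> `|mu| <= 1 -> 0 <= tri_law p mu k.
Proof.
move=> p0 p1 /(value_factor01 k)/andP[h _]; rewrite mulr_ge0 //.
by case: k {h} => [s|] /=; lra.
Qed.

Lemma tri_law_sum p mu : \sum_k tri_law p mu k = 1.
Proof. by rewrite sum_option_bool /tri_law /=; field. Qed.

Lemma tri_law_mean p mu : \sum_k tri_law p mu k * (tri_value k - p * mu) = 0.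
Proof. by rewrite sum_option_bool /tri_law /=; field. Qed.

(** The variance is [p - (p * mu) ^+ 2], and every further power costs a factor at most 2. *)
Lemma tri_law_moment p mu j : 0 <= p -> p <= 1 -> `|mu| <= 1 -> (1 < j)%N ->
  `|\sum_k tri_law p mu k * (tri_value k - p * mu) ^+ j| <= p * 2 ^+ (j - 2).
Proof.
move=> p0 p1 mu1 j2; apply: le_trans (ler_norm_sum _ _ _) _.
have pmu : `|p * mu| <= 1 by rewrite normrM mulr_ile1 // ger0_norm.
apply: le_trans (_ : \sum_k tri_law p mu k * (tri_value k - p * mu) ^+ 2 * 2 ^+ (j - 2) <= _).
  apply: ler_sum => k _; have q0 := tri_law_ge0 k p0 p1 mu1.
  rewrite normrM ger0_norm // normrX -{1}(subnKC j2) exprD mulrA -normrX.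
  rewrite (ger0_norm (sqr_ge0 _)); apply: ler_wpM2l; first by rewrite mulr_ge0 ?sqr_ge0.
  rewrite lerXn2r ?nnegrE //; apply: le_trans (ler_normB _ _) _.
  by have := tri_value_le1 k; lra.
rewrite -mulr_suml ler_wpM2r ?exprn_ge0 //.
rewrite sum_option_bool /tri_law /=.
rewrite [leLHS](_ : _ = p - (p * mu) ^+ 2); last by field.
by rewrite lerBlDr lerDl sqr_ge0.
Qed.

(* An entry [x] in [-1, 1] is the mean of the values [1] and [- 1] with weights
   [(1 + x) / 2] and [(1 - x) / 2]. *)
Lemma three_point_interpolation (E : finType) (F : (E -> R) -> R)
    (o : E -> bool) (x : E -> R) : cube_convex F -> (forall e, `|x e| <= 1) ->
  F (fun e => (o e)%:R * x e) <=
  grid_expectation tri_value (fun e => tri_weight (o e) (x e)) F.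
Proof.
move=> cF x1; pose w e := tri_weight (o e) (x e).
have w0 e k : 0 <= w e k by exact: tri_weight_ge0.
have w1 e : \sum_k w e k = 1 by exact: tri_weight_sum.
pose y e := (o e)%:R * x e.
have cy : cube y.
  by move=> e; rewrite /y normrM mulr_ile1 //; case: (o e); rewrite ?normr1 ?normr0.
rewrite -(avg_enum w1 tri_value_inj _ y) -/y.
elim: (enum E) F cF => [//|e l IH] F cF /=.
apply: le_trans (IH (avg1 tri_value w e F) _).
  rewrite /avg1 sum_option_bool /w /tri_weight /obs_factor /= -[F y](congr1 F (update_same y e)).
  have ye : y e = (o e)%:R * x e by [].
  move: ye; case: (o e) => /= ye; last first.
    by rewrite ye !mul0r !mul1r addr0 addr0.
  have := x1 e; rewrite ler_norml => /andP[xl xu].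
  pose s : R := (1 + x e) / 2.
  have s0 : 0 <= s by rewrite /s; lra.
  have s1 : s <= 1 by rewrite /s; lra.
  have n1 : `|1 : R| <= 1 by rewrite normr1.
  have n1' : `|- 1 : R| <= 1 by rewrite normrN.
  have yy : convex_comb s y y = y.
    by apply/funext => e'; rewrite /convex_comb -mulrDl subrK mul1r.
  have := cF s _ _ s0 s1 (update_cube e cy n1') (update_cube e cy n1).
  rewrite -update_comb yy (_ : (1 - s) * - 1 + s * 1 = y e); last by rewrite ye /s; field.
  move/le_trans; apply; rewrite /s.
  by rewrite le_eqVlt; apply/orP; left; apply/eqP; field.
move=> s a b s0 s1 ca cb; rewrite /avg1 !mulr_sumr -big_split; apply: ler_sum => k _ /=.
rewrite mulrCA [s * (_ * _)]mulrCA -mulrDr ler_wpM2l //.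
have := cF s _ _ s0 s1 (update_cube e ca (tri_value_le1 k))
  (update_cube e cb (tri_value_le1 k)).
by rewrite -update_comb -mulrDl subrK mul1r.
Qed.

End ThreePointLaw.

(** * Singular value thresholding *)

Section Frobenius.
Context {R : realType}.

Definition frob m n (A : 'M[R]_(m, n)) : R := \sum_i \sum_j A i j ^+ 2.

Lemma frob_ge0 m n (A : 'M[R]_(m, n)) : 0 <= frob A.
Proof. by apply: sumr_ge0 => i _; apply: sumr_ge0 => j _; exact: sqr_ge0. Qed.

Lemma frobE m n (A : 'M[R]_(m, n)) : frob A = \tr (A *m A^T).
Proof.
by apply: eq_bigr => i _; rewrite mxE; apply: eq_bigr => j _; rewrite mxE expr2.
Qed.

Lemma frobT m n (A : 'M[R]_(m, n)) : frob A^T = frob A.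
Proof. by rewrite !frobE trmxK mxtrace_mulC. Qed.

Lemma frob_rows m n (A : 'M[R]_(m, n)) : frob A = \sum_i frob (row i A).
Proof.
apply: eq_bigr => i _; rewrite /frob big_ord1.
by apply: eq_bigr => j _; rewrite mxE.
Qed.

Lemma frob_isometry k m n (Q : 'M[R]_(k, m)) (A : 'M[R]_(m, n)) :
  Q^T *m Q = 1%:M -> frob (Q *m A) = frob A.
Proof.
by move=> QQ; rewrite !frobE trmx_mul mulmxA mxtrace_mulC !mulmxA QQ mul1mx.
Qed.

Lemma frob_isometryr k m n (A : 'M[R]_(m, n)) (Q : 'M[R]_(n, k)) :
  Q *m Q^T = 1%:M -> frob (A *m Q) = frob A.
Proof. by move=> QQ; rewrite -frobT trmx_mul frob_isometry ?frobT // trmxK. Qed.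

Lemma frobZ m n (a : R) (A : 'M[R]_(m, n)) : frob (a *: A) = a ^+ 2 * frob A.
Proof.
rewrite mulr_sumr; apply: eq_bigr => i _; rewrite mulr_sumr; apply: eq_bigr => j _.
by rewrite mxE exprMn.
Qed.

Lemma frobN m n (A : 'M[R]_(m, n)) : frob (- A) = frob A.
Proof. by rewrite -scaleN1r frobZ sqrrN expr1n mul1r. Qed.

Lemma frobD_le m n (A B : 'M[R]_(m, n)) : frob (A + B) <= 2 * (frob A + frob B).
Proof.
rewrite -big_split mulr_sumr; apply: ler_sum => i _ /=.
rewrite -big_split mulr_sumr; apply: ler_sum => j _ /=.
by rewrite mxE; have := sqr_ge0 (A i j - B i j); nra.
Qed.

Lemma frob_eq0 m n (A : 'M[R]_(m, n)) : frob A = 0 -> A = 0.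
Proof.
move=> A0; apply/matrixP => i j; rewrite mxE; apply/eqP; rewrite -sqrf_eq0.
move/eqP: A0; rewrite psumr_eq0 => [/allP/(_ i)|i' _]; last first.
  by apply: sumr_ge0 => j' _; exact: sqr_ge0.
rewrite mem_index_enum psumr_eq0 => [/(_ isT)/allP/(_ j)|j' _]; last exact: sqr_ge0.
by rewrite mem_index_enum => /(_ isT).
Qed.

Lemma mul_row_col_sqr n (x : 'rV[R]_n) (y : 'cV[R]_n) :
  ((x *m y) 0 0) ^+ 2 <= frob x * frob y.
Proof.
rewrite mxE /frob big_ord1.
under [X in _ <= _ * X]eq_bigr => i _ do rewrite big_ord1.
exact: cauchy_schwarz_sum.
Qed.

Definition op_bounded m n (D : 'M[R]_(m, n)) (t : R) : Prop :=
  forall z : 'cV[R]_n, frob (D *m z) <= t ^+ 2 * frob z.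

(** Duality: with [y] the transpose of [x *m D], the squared norm of [x *m D] is [x *m (D *m y)], to
    which Cauchy-Schwarz and the bound on [D *m y] apply. *)
Lemma op_bounded_row m n (D : 'M[R]_(m, n)) t (x : 'rV[R]_m) :
  op_bounded D t -> frob (x *m D) <= t ^+ 2 * frob x.
Proof.
move=> hD; pose y := (x *m D)^T.
have [->|y0] := eqVneq (frob (x *m D)) 0; first by rewrite mulr_ge0 ?sqr_ge0 ?frob_ge0.
have ypos : 0 < frob (x *m D) by rewrite lt_def y0 frob_ge0.
have yE : frob (x *m D) = (x *m (D *m y)) 0 0.
  by rewrite frobE mulmxA [in LHS]trace_mx11.
rewrite -(ler_pM2l ypos) -expr2 {1}yE; apply: le_trans (mul_row_col_sqr _ _) _.
rewrite [leRHS](_ : _ = frob x * (t ^+ 2 * frob (x *m D))); last by ring.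
by rewrite ler_wpM2l ?frob_ge0 // -[X in _ * frob X]trmxK frobT.
Qed.

Lemma op_bounded_mul m n k (D : 'M[R]_(m, n)) t (X : 'M[R]_(n, k)) :
  op_bounded D t -> frob (D *m X) <= t ^+ 2 * frob X.
Proof.
move=> hD; rewrite -frobT frob_rows -[frob X]frobT frob_rows mulr_sumr.
apply: ler_sum => i _; rewrite -!tr_col !frobT colE -mulmxA -colE; exact: hD.
Qed.

Lemma op_bounded_mulr m n k (D : 'M[R]_(m, n)) t (X : 'M[R]_(k, m)) :
  op_bounded D t -> frob (X *m D) <= t ^+ 2 * frob X.
Proof.
move=> hD; rewrite frob_rows [frob X]frob_rows mulr_sumr.
by apply: ler_sum => i _; rewrite row_mul; exact: op_bounded_row.
Qed.

(** [Q] has orthonormal rows spanning a space that contains the rows of [B]. A row whose residual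
    [y] is zero contributes no vector, hence [k <= r]. *)
Lemma gram_schmidt r n (B : 'M[R]_(r, n)) : exists (k : nat) (Q : 'M[R]_(k, n)),
  [/\ (k <= r)%N, Q *m Q^T = 1%:M & B = B *m Q^T *m Q].
Proof.
elim: r B => [|r IH] B.
  by exists 0%N, 0; split=> //; apply/matrixP => -[].
suff step (x : 'rV[R]_n) (B' : 'M[R]_(r, n)) : exists (k : nat) (Q : 'M[R]_(k, n)),
    [/\ (k <= r.+1)%N, Q *m Q^T = 1%:M & col_mx x B' = col_mx x B' *m Q^T *m Q].
  by have := step (usubmx (B : 'M[R]_(1 + r, n))) (dsubmx (B : 'M[R]_(1 + r, n)));
     rewrite vsubmxK.
have [k [Q [kr QQ BQ]]] := IH B'.
pose y := x - x *m Q^T *m Q.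
have yQ : y *m Q^T = 0.
  by rewrite mulmxBl -[x *m Q^T *m Q *m Q^T]mulmxA QQ mulmx1 subrr.
have [y0|y0] := eqVneq (frob y) 0.
  exists k, Q; split=> //; first exact: leqW.
  rewrite mul_col_mx mul_col_mx -BQ; congr col_mx.
  by apply/eqP; rewrite -subr_eq0; apply/eqP/frob_eq0.
have y1 : 0 < frob y by rewrite lt_def y0 frob_ge0.
pose c := (Num.sqrt (frob y))^-1.
have c2 : c * c * frob y = 1.
  by rewrite -expr2 exprVn sqr_sqrtr ?frob_ge0 // mulVf.
have yy : y *m y^T = (frob y)%:M.
  by apply/matrixP => i j; rewrite frobE !ord1 !mxE eqxx mulr1n /mxtrace big_ord1 mxE.
exists (1 + k)%N, (col_mx (c *: y) Q); split=> //.
  rewrite tr_col_mx mul_col_row scalar_mx_block; congr block_mx.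
  - by rewrite linearZ /= -scalemxAl -scalemxAr scalerA yy scale_scalar_mx c2.
  - by rewrite -scalemxAl yQ scaler0.
  - by rewrite -[Q *m _]trmxK trmx_mul trmxK -scalemxAl yQ scaler0 trmx0.
  - exact: QQ.
rewrite -!mulmxA tr_col_mx mul_row_col.
have -> : (c *: y)^T *m (c *: y) = (c * c) *: (y^T *m y).
  by rewrite -scalemxAr (_ : (c *: y)^T = c *: y^T) ?linearZ // -scalemxAl scalerA.
rewrite mulmxDr -scalemxAr !mulmxA !mul_col_mx -BQ scale_col_mx add_col_mx; congr col_mx.
  have xy : x *m y^T = (frob y)%:M.
    rewrite -yy {3}/y mulmxBl -[x *m Q^T *m Q *m _]mulmxA.
    by rewrite -[Q *m y^T]trmxK trmx_mul trmxK yQ trmx0 mulmx0 subr0.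
  by rewrite xy mul_scalar_mx scalerA c2 scale1r subrK.
have By : B' *m y^T = 0.
  by rewrite BQ -mulmxA -[Q *m y^T]trmxK trmx_mul trmxK yQ trmx0 mulmx0.
by rewrite By mul0mx scaler0 add0r.
Qed.

Lemma row_space_basis m n (B : 'M[R]_(m, n)) : exists (k : nat) (Q : 'M[R]_(k, n)),
  [/\ (k <= \rank B)%N, Q *m Q^T = 1%:M & B = B *m Q^T *m Q].
Proof.
have [k [Q [kr QQ BQ]]] := gram_schmidt (row_base B).
exists k, Q; split=> //.
have /submxP[C CE] : (B <= row_base B)%MS by rewrite eq_row_base.
have absorb (A : 'M[R]_(_, n)) : A = A *m Q^T *m Q -> C *m A = C *m A *m Q^T *m Q.
  by move=> AQ; rewrite -!mulmxA [A *m (_ *m _)]mulmxA -AQ.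
by have := absorb _ BQ; rewrite -CE.
Qed.

End Frobenius.

Section SingularValueThresholding.
Context {R : realType} {m n : nat}.
Variables (Y B : 'M[R]_(m, n)) (s : 'I_m -> R) (U : 'M[R]_m) (V : 'M[R]_(n, m)).
Variables (t tau : R).
Hypothesis svd : is_svd Y s U V.
Hypothesis t0 : 0 <= t.
Hypothesis t_tau : t < tau.
Hypothesis noise : op_bounded (Y - B) t.

Definition svd_threshold : 'M[R]_(m, n) :=
  \sum_(i < m | tau <= s i) s i *: (col i U *m (col i V)^T).

Let s_ge0 i : 0 <= s i. Proof. by case: svd. Qed.
Let UU : U^T *m U = 1%:M. Proof. by case: svd. Qed.
Let VV : V^T *m V = 1%:M. Proof. by case: svd. Qed.
Let UU' : U *m U^T = 1%:M. Proof. exact: mulmx1C. Qed.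

Let row_svd_sum (S : pred 'I_m) i :
  row i (U^T *m \sum_(k | S k) s k *: (col k U *m (col k V)^T)) =
  if S i then s i *: (col i V)^T else 0.
Proof.
have e k : row i (U^T *m (s k *: (col k U *m (col k V)^T))) =
    (s k *+ (i == k)) *: (col k V)^T.
  rewrite -scalemxAr mulmxA colE mulmxA UU mul1mx linearZ /= row_mul.
  apply/matrixP => a b; rewrite !mxE big_ord1 !mxE eqxx andbT.
  by case: (i == k); rewrite ?mulr1n ?mulr0n ?mul1r ?mul0r ?mulr0.
rewrite mulmx_sumr linear_sum /=; under eq_bigr => k _ do rewrite e.
case: ifP => Si.
  rewrite (bigD1 i) //= eqxx mulr1n big1 ?addr0 // => k /andP[_ /negbTE ki].
  by rewrite eq_sym ki mulr0n scale0r.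
rewrite big1 // => k Sk; case: eqP => [ik|_]; last by rewrite mulr0n scale0r.
by rewrite ik Sk in Si.
Qed.

Let row_Y i : row i (U^T *m Y) = s i *: (col i V)^T.
Proof. by case: svd => _ _ _ YE; rewrite {1}YE (row_svd_sum predT). Qed.

Let tau0 : 0 < tau. Proof. exact: le_lt_trans t_tau. Qed.

(* More than [\rank B] large singular values would give a combination of the
   left singular vectors annihilated by [B] on which [Y - B] has norm at
   least [tau]. *)
Lemma card_large_singular_values : (#|[pred i | (tau <= s i)%R]| <= \rank B)%N.
Proof.
set S := [pred i | _]; rewrite leqNgt; apply/negP => rS.
pose E : 'M[R]_(#|S|, m) := \matrix_(k, i) (enum_val k == i)%:R.
pose G := E *m (U^T *m B).
have rG : (\rank G < #|S|)%N.
  by apply: leq_ltn_trans rS; rewrite /G mulmxA mxrankM_maxr.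
have ker0 : kermx G != 0 by rewrite kermx_eq0 -row_leq_rank -ltnNge.
pose w := nz_row (kermx G); pose c := w *m E.
have w0 : w != 0 by rewrite nz_row_eq0.
have wG : w *m G = 0 by apply/sub_kermxP; exact: nz_row_sub.
have cS i : i \notin S -> c 0 i = 0.
  move=> iS; rewrite mxE big1 // => k _; rewrite mxE; case: eqP => [ki|_].
    by rewrite -ki enum_valP in iS.
  by rewrite mulr0.
have c0 : 0 < frob c.
  rewrite lt_def frob_ge0 andbT; apply: contra w0 => /eqP/frob_eq0 c0.
  apply/eqP/matrixP => a k; rewrite ord1 [RHS]mxE.
  have := congr1 (fun x : 'rV[R]_m => x 0 (enum_val k)) c0; rewrite !mxE => <-.
  rewrite (bigD1 k) //= mxE eqxx mulr1 big1 ?addr0 // => l lk.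
  by rewrite mxE (inj_eq enum_val_inj) (negbTE lk) mulr0.
have cB : c *m U^T *m B = 0 by rewrite -wG /G /c !mulmxA.
clearbody c; have h1 : frob (c *m U^T *m Y) <= t ^+ 2 * frob c.
  have <- : c *m U^T *m (Y - B) = c *m U^T *m Y.
    by rewrite mulmxBr cB subr0.
  rewrite -[frob c](@frob_isometryr _ _ _ _ _ U^T) ?trmxK //.
  exact: op_bounded_row.
have h2 : tau ^+ 2 * frob c <= frob (c *m U^T *m Y).
  have -> : c *m U^T *m Y = (\row_i (c 0 i * s i)) *m V^T.
    rewrite -mulmxA; apply/matrixP => a b; rewrite !mxE; apply: eq_bigr => i _.
    have := congr1 (fun x : 'rV[R]_n => x 0 b) (row_Y i); rewrite !mxE => ->.
    by rewrite (ord1 a) mulrA.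
  rewrite frob_isometryr ?trmxK // /frob !big_ord1 mulr_sumr; apply: ler_sum => i _.
  rewrite !mxE; have [iS|iS] := boolP (i \in S); last by rewrite cS // expr0n mul0r mulr0 expr0n.
  rewrite exprMn mulrC ler_wpM2l ?sqr_ge0 // lerXn2r ?nnegrE ?(ltW tau0) //.
have : tau ^+ 2 * frob c <= t ^+ 2 * frob c by exact: le_trans h1.
by rewrite ler_pM2r // leNgt ltrXn2r ?nnegrE ?(ltW tau0) // t_tau.
Qed.

(** The error is read in the rows of [U^T]. On the at most [\rank B] kept indices it is a row of
    [U^T (Y - B)], of norm at most [t]. On the others it is a row of [- U^T B]; compressed by [Q^T]
    to at most [\rank B] columns this is [U^T (Y - B) Q^T] minus a row of [V^T Q^T] times
    [s i < tau]. Both matrices are controlled by the norm of [Q], which gives 1 + 4 multiples of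
    [\rank B * tau ^+ 2]. *)
Lemma svd_threshold_error :
  frob (svd_threshold - B) <= 5 * (\rank B)%:R * tau ^+ 2.
Proof.
have [k [Q [kr QQ BQ]]] := row_space_basis B.
have tt : t ^+ 2 <= tau ^+ 2 by rewrite lerXn2r ?nnegrE ?(ltW tau0) // ltW.
have UTU : U^T^T *m U^T = 1%:M by rewrite trmxK.
rewrite -(frob_isometry _ UTU) frob_rows (bigID [pred i | tau <= s i]) /=.
have large : \sum_(i | tau <= s i) frob (row i (U^T *m (svd_threshold - B))) <=
    (\rank B)%:R * tau ^+ 2.
  apply: le_trans (_ : \sum_(i | tau <= s i) tau ^+ 2 <= _).
    apply: ler_sum => i si.
    have -> : row i (U^T *m (svd_threshold - B)) = row i U^T *m (Y - B).
      by rewrite -row_mul !mulmxBr !linearB /= row_Y row_svd_sum si.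
    apply: le_trans (op_bounded_row _ noise) _.
    have -> : frob (row i U^T) = 1.
      transitivity ((U^T *m U) i i); last by rewrite UU mxE eqxx.
      by rewrite mxE /frob big_ord1; apply: eq_bigr => j _; rewrite !mxE expr2.
    by rewrite mulr1.
  rewrite sumr_const -[leLHS]mulr_natl; apply: ler_wpM2r; first exact: sqr_ge0.
  rewrite ler_nat; exact: card_large_singular_values.
have small : \sum_(i | ~~ (tau <= s i)) frob (row i (U^T *m (svd_threshold - B))) <=
    4 * (\rank B)%:R * tau ^+ 2.
  have QT : frob Q^T = k%:R by rewrite frobT frobE QQ mxtrace1.
  apply: le_trans (_ : \sum_(i | ~~ (tau <= s i))
     (2 * (frob (row i (U^T *m ((Y - B) *m Q^T))) + tau ^+ 2 * frob (row i (V^T *m Q^T))))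
     <= _).
    apply: ler_sum => i si.
    have -> : row i (U^T *m (svd_threshold - B)) = - (row i (U^T *m B *m Q^T) *m Q).
      rewrite -row_mul -!mulmxA [B *m (_ *m _)]mulmxA -BQ mulmxBr linearB /= row_svd_sum.
      by rewrite (negbTE si) sub0r.
    rewrite frobN frob_isometryr //.
    have -> : row i (U^T *m B *m Q^T) =
        - row i (U^T *m ((Y - B) *m Q^T)) + s i *: row i (V^T *m Q^T).
      rewrite mulmxA mulmxBr mulmxBl linearB /= opprB.
      rewrite [row i (U^T *m Y *m _)]row_mul row_Y -scalemxAl [row i (V^T *m _)]row_mul.
      by rewrite -tr_col subrK.
    apply: le_trans (frobD_le _ _) _; rewrite frobN frobZ ler_pM2l // lerD2l.
    rewrite ler_wpM2r ?frob_ge0 // lerXn2r ?nnegrE ?(ltW tau0) //.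
    by rewrite ltW // ltNge.
  apply: le_trans (_ : 2 * (frob (U^T *m ((Y - B) *m Q^T)) + tau ^+ 2 * frob (V^T *m Q^T)) <= _).
    rewrite -mulr_sumr ler_pM2l // big_split /= -mulr_sumr.
    apply: lerD; last apply: ler_wpM2l; rewrite ?sqr_ge0 //.
      rewrite [leRHS]frob_rows [leRHS](bigID [pred i | ~~ (tau <= s i)]) /= lerDl.
      by apply: sumr_ge0 => i _; exact: frob_ge0.
    rewrite [leRHS]frob_rows [leRHS](bigID [pred i | ~~ (tau <= s i)]) /= lerDl.
    by apply: sumr_ge0 => i _; exact: frob_ge0.
  have b1 : frob (U^T *m ((Y - B) *m Q^T)) <= tau ^+ 2 * (\rank B)%:R.
    rewrite frob_isometry //; apply: le_trans (op_bounded_mul _ noise) _; rewrite QT.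
    by rewrite ler_pM ?sqr_ge0 ?ler_nat.
  have b2 : frob (V^T *m Q^T) <= (\rank B)%:R.
    have Vop : op_bounded V 1 by move=> z; rewrite frob_isometry // expr1n mul1r.
    rewrite -trmx_mul frobT; apply: le_trans (op_bounded_mulr _ Vop) _.
    by rewrite expr1n mul1r -frobT QT ler_nat.
  have := ler_wpM2l (sqr_ge0 tau) b2; lra.
by apply: le_trans (lerD large small) _; lra.
Qed.

End SingularValueThresholding.

(** * Sampled entries *)

Section SampledEntries.
Context d (T : measurableType d) (R : realType) (P : probability T R) (E : finType).
Variables (X : E -> T -> R) (obs : E -> T -> bool) (p : R) (mu : E -> R).

(** The entries lie in [-1, 1] only almost surely, while rounding weights must be nonnegative
    everywhere; clamping changes the entries on a null set only. *)
Definition clamp (x : R) : R := Num.max (- 1) (Num.min x 1).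

Lemma clamp_le1 x : `|clamp x| <= 1.
Proof. by rewrite ler_norml /clamp le_max lexx /= ge_max ge_min lexx orbT andbT; lra. Qed.

Lemma clamp_id x : `|x| <= 1 -> clamp x = x.
Proof.
rewrite ler_norml => /andP[h1 h2]; rewrite /clamp.
by rewrite (min_idPl h2); apply/max_idPr.
Qed.

Lemma measurable_clamp : measurable_fun [set: R] clamp.
Proof.
apply: measurable_maxr; first exact: measurable_cst.
by apply: measurable_minr; [exact: measurable_id | exact: measurable_cst].
Qed.

Hypothesis mX : forall e, measurable_fun [set: T] (X e).
Hypothesis mobs : forall e, measurable_fun [set: T] (obs e).
Hypothesis p0 : 0 <= p.
Hypothesis p1 : p <= 1.
Hypothesis meanX : forall e, \int[P]_w clamp (X e w) = mu e.
Hypothesis probobs : forall e, P (obs e @^-1` [set true]) = p%:E.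
Hypothesis indep : forall G : E + E -> set T,
  (forall k, (match k with inl e => sigma_of (X e) | inr e => sigma_of (obs e) end) (G k)) ->
  P (\bigcap_(k in [set` [set: E + E]%SET]) G k) = (\prod_k fine (P (G k)))%:E.

Lemma mean_obs (h : bool -> R) e : \int[P]_w h (obs e w) = p * h true + (1 - p) * h false.
Proof.
have mset b : measurable (obs e @^-1` [set b]).
  by rewrite -[X in measurable X]setTI; exact: mobs.
have -> : (fun w => h (obs e w)) =
    (fun w => (h true - h false) * \1_(obs e @^-1` [set true]) w + h false).
  apply/funext => w; rewrite indicE; case: (boolP (obs e w)) => o.
    by rewrite mem_set //= mulr1 subrK.
  by rewrite memNset /= ?mulr0 ?add0r //; apply/negP.
have b1 := bounded_measurable_indic R (mset true).
have b2 : bounded_measurable (fun w => (h true - h false) * \1_(obs e @^-1` [set true]) w).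
  exact: bounded_measurableM (bounded_measurable_cst _ _) b1.
rewrite RintegralD //; try exact: bounded_measurable_integrable.
  rewrite meanZ // mean_indic // probobs mean_cst /=; ring.
exact/bounded_measurable_integrable/bounded_measurable_cst.
Qed.

Lemma mean_prod_sampled (g : E -> R -> R) (h : E -> bool -> R) :
  (forall e, measurable_fun [set: R] (g e)) -> (forall e x, 0 <= g e x <= 1) ->
  (forall e b, 0 <= h e b <= 1) ->
  \int[P]_w (\prod_e (h e (obs e w) * g e (X e w))) =
  \prod_e ((p * h e true + (1 - p) * h e false) * \int[P]_w g e (X e w)).
Proof.
move=> mg g01 h01.
pose Z (k : E + E) w : R := match k with inl e => g e (X e w) | inr e => h e (obs e w) end.
transitivity (\int[P]_w \prod_k Z k w).
  apply: eq_Rintegral => w _; rewrite big_sumType /= big_split mulrC; congr (_ * _).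
rewrite mean_prod_indep.
- rewrite big_sumType /= big_split mulrC; congr (_ * _).
  by apply: eq_bigr => e _; rewrite mean_obs.
- move=> [e|e] /=; first exact: measurableT_comp (mg e) (mX e).
  by apply: measurableT_comp (mobs e).
- by move=> [e|e] w /=.
move=> t; apply: indep => -[e|e] /=.
- exists (g e @^-1` `[t (inl e), +oo[).
    by rewrite -[X in measurable X]setTI; exact: mg.
  by apply/seteqP; split=> w /=; rewrite in_itv /= andbT; [case | split].
- exists [set b | t (inr e) <= h e b]; first by [].
  by apply/seteqP; split=> w /=; [case | split].
Qed.

(** The average of [F] over random roundings of the sample. As a finite sum of products of functions
    of single variables it is measurable, and independence computes its mean. *)
Definition interpolant (F : (E -> R) -> R) (w : T) : R :=
  grid_expectation tri_value (fun e => tri_weight (obs e w) (clamp (X e w))) F.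

Lemma le_interpolant F w : cube_convex F ->
  F (fun e => (obs e w)%:R * clamp (X e w)) <= interpolant F w.
Proof. by move=> cF; apply: three_point_interpolation => // e; exact: clamp_le1. Qed.

Let bfactor e (k : option bool) :
  bounded_measurable (fun w => tri_weight (obs e w) (clamp (X e w)) k).
Proof.
apply: bounded_measurableM; split.
- exact: (measurableT_comp (_ : measurable_fun [set: bool] (obs_factor^~ k)) (mobs e)).
- by exists 1 => w; rewrite /obs_factor; case: ifP; rewrite ?normr1 ?normr0.
- have mc := measurableT_comp measurable_clamp (mX e).
  case: k => [s|] /=; last exact: measurable_cst.
  apply: measurable_funM; last exact: measurable_cst.
  apply: measurable_funD; first exact: measurable_cst.
  by apply: measurable_funM => //; exact: measurable_cst.
- exists 1 => w; have /andP[a b] := value_factor01 k (clamp_le1 (X e w)).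
  by rewrite ger0_norm.
Qed.

Let bterm (u : {ffun E -> option bool}) : bounded_measurable (fun w =>
  \prod_e tri_weight (obs e w) (clamp (X e w)) (u e)).
Proof. exact: bounded_measurable_prod. Qed.

Lemma bounded_measurable_interpolant F : bounded_measurable (interpolant F).
Proof.
apply: bounded_measurable_sum => u.
exact: bounded_measurableM (bterm u) (bounded_measurable_cst _ _).
Qed.

Let mean_value_factor e k : \int[P]_w value_factor (clamp (X e w)) k = value_factor (mu e) k.
Proof.
have bc : bounded_measurable (fun w => clamp (X e w)).
  split; first exact: measurableT_comp measurable_clamp (mX e).
  by exists 1 => w; exact: clamp_le1.
case: k => [s|] /=; last exact: mean_cst.
have -> : (fun w => (1 + (if s then 1 else -1) * clamp (X e w)) / 2) =
    (fun w => ((if s then 1 else -1) / 2) * clamp (X e w) + 2^-1).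
  by apply/funext => w; rewrite mulrDl mul1r addrC mulrAC.
have bs : bounded_measurable (fun w => ((if s then 1 else -1) / 2) * clamp (X e w)).
  exact: bounded_measurableM (bounded_measurable_cst _ _) bc.
rewrite RintegralD //; try exact: bounded_measurable_integrable.
  by rewrite meanZ // meanX mean_cst [RHS]mulrDl mul1r [RHS]addrC [X in X + _]mulrAC.
exact/bounded_measurable_integrable/bounded_measurable_cst.
Qed.

Lemma mean_interpolant F : \int[P]_w interpolant F w =
  grid_expectation tri_value (fun e => tri_law p (mu e)) F.
Proof.
rewrite /interpolant /grid_expectation mean_sum => [|u]; last first.
  exact: bounded_measurableM (bterm u) (bounded_measurable_cst _ _).
apply: eq_bigr => u _; under eq_Rintegral do rewrite mulrC.
rewrite meanZ // mulrC; congr (_ * _).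
rewrite (mean_prod_sampled (g := fun e x => value_factor (clamp x) (u e))
  (h := fun e b => obs_factor b (u e))).
- apply: eq_bigr => e _; rewrite mean_value_factor /tri_law; congr (_ * _).
  by case: (u e) => [s|]; rewrite /obs_factor /=; ring.
- move=> e; case: (u e) => [s|] /=; last exact: measurable_cst.
  apply: measurable_funM; last exact: measurable_cst.
  apply: measurable_funD; first exact: measurable_cst.
  by apply: measurable_funM; [exact: measurable_cst | exact: measurable_clamp].
- by move=> e x; apply: value_factor01; exact: clamp_le1.
- by move=> e b; rewrite /obs_factor; case: ifP; rewrite lexx ler01.
Qed.

Lemma markov_bounded (f : T -> R) (a : R) : bounded_measurable f ->
  (forall w, 0 <= f w) -> 0 < a ->
  measurable [set w | a <= f w] /\
  (P [set w | (a <= f w)%R] <= (\int[P]_w f w / a)%:E)%E.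
Proof.
move=> bf f0 a0; have mA : measurable [set w | a <= f w].
  have -> : [set w | a <= f w] = f @^-1` `[a, +oo[.
    by apply/seteqP; split=> w /=; rewrite in_itv /= andbT.
  by rewrite -[X in measurable X]setTI; apply: bf.1.
split=> //; rewrite -[P _]fineK ?fin_num_measure // lee_fin ler_pdivlMr // mulrC.
rewrite -mean_indic // -meanZ; last exact: bounded_measurable_indic.
apply: mean_le => // [|w].
  exact: bounded_measurableM (bounded_measurable_cst _ _) (bounded_measurable_indic _ _).
rewrite indicE; case: (boolP (w \in _)) => [|_]; last by rewrite mulr0.
by rewrite inE mulr1.
Qed.

Let count_obs w : R := \sum_e (obs e w)%:R.

Lemma chernoff_side (th x : R) : `|th| <= 2^-1 -> 0 <= x ->
  let A := [set w | th * (p * #|E|%:R) + `|th| * (x * p * #|E|%:R) <= th * count_obs w] in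
  measurable A /\
  (P A <= (expR (#|E|%:R * p * (2 * th ^+ 2 - `|th| * x)))%:E)%E.
Proof.
move=> th2 x0 A.
(* Subtracting the absolute value of [th] puts the factors in [0, 1], as [mean_prod_sampled]
   requires. *)
pose h (b : bool) : R := expR (th * b%:R - `|th|).
have hb b : 0 <= h b <= 1.
  rewrite expR_ge0 /= -expR0 ler_expR subr_le0; case: b; rewrite ?mulr1 ?mulr0 //.
  exact: ler_norm.
pose f w : R := \prod_e h (obs e w).
have fE w : f w = expR (th * count_obs w - #|E|%:R * `|th|).
  rewrite /f /h -expR_sum sumrB -mulr_sumr; congr (expR (_ - _)).
  by rewrite sumr_const mulr_natl.
have mh e : measurable_fun [set: T] (fun w => h (obs e w)).
  exact: (measurableT_comp (_ : measurable_fun [set: bool] h) (mobs e)).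
have bf : bounded_measurable f.
  apply: bounded_measurable_prod => e; split=> //.
  by exists 1 => w; have /andP[a b] := hb (obs e w); rewrite ger0_norm.
have meanf : \int[P]_w f w = (p * h true + (1 - p) * h false) ^+ #|E|.
  transitivity (\int[P]_w \prod_e (h (obs e w) * (fun=> 1) (X e w))).
    by apply: eq_Rintegral => w _; apply: eq_bigr => e _; rewrite mulr1.
  rewrite (mean_prod_sampled (g := fun _ _ => 1) (h := fun=> h)) //; last first.
    by move=> _ _; rewrite ler01 lexx.
  by under eq_bigr do rewrite mean_cst mulr1; rewrite prodr_const.
pose a := expR (th * (p * #|E|%:R) + `|th| * (x * p * #|E|%:R) - #|E|%:R * `|th|).
have AE : A = [set w | a <= f w].
  by apply/seteqP; split=> w; rewrite /A /= fE /a ler_expR lerD2r.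
have [mA PA] := markov_bounded bf (fun w => ltac:(by rewrite fE expR_ge0)) (expR_gt0 _ : 0 < a).
rewrite AE; split=> //; apply: (le_trans PA); rewrite lee_fin meanf.
rewrite /a ler_pdivrMr ?expR_gt0 // -expRD.
rewrite [X in expR X](_ : _ = #|E|%:R * (p * (th + 2 * th ^+ 2) - `|th|)); last by ring.
rewrite expRM_natl lerXn2r ?nnegrE ?expR_ge0 //.
  by apply: addr_ge0; rewrite mulr_ge0 ?subr_ge0 //; case/andP: (hb true); case/andP: (hb false).
rewrite /h mulr1 mulr0 add0r !expRD [leLHS](_ : _ = (1 + p * (expR th - 1)) * expR (- `|th|)).
  rewrite ler_wpM2r ?expR_ge0 //; apply: le_trans (expR_ge1Dx _) _; rewrite ler_expR.
  rewrite ler_wpM2l //; have := expR_le_quadratic (le_trans (ler_norm th) th2); lra.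
by ring.
Qed.

(** The two tails use [th] equal to plus and minus [x / 4], for which [2 * th ^+ 2] minus [x] times
    the absolute value of [th] is [- x ^+ 2 / 8]. *)
Lemma chernoff (x : R) : 0 <= x -> x <= 1 ->
  exists A : set T, [/\ measurable A,
    (P A <= (2 * expR (- (#|E|%:R * p * x ^+ 2 / 8)))%:E)%E &
    forall w, ~ A w -> `|count_obs w - p * #|E|%:R| <= x * (p * #|E|%:R)].
Proof.
move=> x0 x1.
have n1 : `|x / 4| = x / 4 by rewrite ger0_norm; lra.
have n2 : `|- (x / 4)| = x / 4 by rewrite normrN.
have [|mA PA] := @chernoff_side (x / 4) x _ x0; first by rewrite n1; lra.
have [|mB PB] := @chernoff_side (- (x / 4)) x _ x0; first by rewrite n2; lra.
set A := [set w | _] in mA PA; set B := [set w | _] in mB PB.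
exists (A `|` B); split; first exact: measurableU.
  apply: le_trans (measureU2 _ mA mB) _; apply: le_trans (leeD PA PB) _.
  rewrite -EFinD lee_fin n1 n2 sqrrN le_eqVlt; apply/orP; left; apply/eqP.
  rewrite (_ : _ * _ * _ = - (#|E|%:R * p * x ^+ 2 / 8)); last by field.
  by ring.
move=> w /not_orP[]; rewrite /A /B /= n1 n2 => hA hB.
(* For [x = 0] the event [A] is the whole space, and its complement is empty. *)
have [x00|x00] := eqVneq x 0; first by case: hA; rewrite x00 !mul0r addr0.
have xp : 0 < x / 4 by rewrite divr_gt0 // lt_def x00.
rewrite -!mulrDr in hA.
move/negP: hA; rewrite -ltNge ltr_pM2l // => hA.
move/negP: hB; rewrite -ltNge => hB.
have {}hB : (p * #|E|%:R) - x * p * #|E|%:R < count_obs w.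
  by rewrite -(ltr_pM2l xp); lra.
by rewrite ler_norml; apply/andP; split; lra.
Qed.

End SampledEntries.

Lemma dyadic_even (R : realType) (y : R) : 2 <= y ->
  exists j : nat, (2 * 2 ^ j)%:R <= y /\ y <= 2 * (2 * 2 ^ j)%:R.
Proof.
move=> y2; pose k := Num.truncn y.
have y0 : 0 <= y by lra.
have k2 : (2 <= k)%N by rewrite truncn_ge_nat.
have k0 : (0 < k)%N by apply: leq_trans k2.
have /andP[h1 h2] := trunc_log_bounds (isT : (1 < 2)%N) k0.
have j0 : (0 < trunc_log 2 k)%N.
  by rewrite lt0n; apply: contraTneq h2 => ->; rewrite -leqNgt.
exists (trunc_log 2 k).-1; rewrite -expnS prednK //; split.
  by rewrite -truncn_ge_nat.
rewrite -[2 in leRHS]/(2%:R) -natrM -expnS ltW //.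
by apply: lt_le_trans (truncnS_gt y) _; rewrite ler_nat.
Qed.

(** * How large the matrix has to be *)

Section SizeThreshold.
Context {R : realType}.

(* [Num.sqrt (Num.sqrt (n * p))] is the length scale of the walks in the moment
   method; the second condition absorbs the factor [n] coming from the trace. *)
Definition large_enough (eta : R) (n : nat) (p : R) : Prop :=
  let q := Num.sqrt (Num.sqrt (n%:R * p)) in
  16 / eta <= q /\ 48 * n%:R / eta <= expR (eta ^+ 2 * q / 640).

(** With [u = ln n], the length scale is at least [exp (eps * u / 4)], hence at least
    [eps ^+ 2 * u ^+ 2 / 32], which outgrows the linear function [A + u] of [u]; and
    [48 n / eta = A exp u <= exp (A + u)]. *)
Lemma large_enough_eventually (eta eps : R) : 0 < eta -> eta < 1 -> 0 < eps ->
  exists N0 : R, forall (n : nat) (p : R), (0 < n)%N -> N0 <= n%:R ->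
    n%:R `^ (-1 + eps) <= p -> large_enough eta n p.
Proof.
move=> eta0 eta1 eps0; pose kap := eta ^+ 2 / 640.
have kap0 : 0 < kap by apply: mulr_gt0; [exact: exprn_gt0 | rewrite invr_gt0 ltr0n].
have kap1 : kap <= 1.
  by have : eta ^+ 2 <= 1; [rewrite exprn_ile1 ?ltW | rewrite /kap; lra].
pose A := 48 / eta.
have A0 : 0 < A by rewrite divr_gt0.
pose u0 := 1 + 32 * (A + 1) / (kap * eps ^+ 2).
exists (expR u0) => n p n0 hn hp.
have nR : 0 < n%:R :> R by rewrite ltr0n.
pose u := ln (n%:R : R).
have uE : n%:R = expR u by rewrite lnK // posrE.
have u0u : u0 <= u by rewrite -ler_expR -uE.
have ke0 : 0 < kap * eps ^+ 2 by rewrite mulr_gt0 // exprn_gt0.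
have u1 : 1 <= u.
  by apply: le_trans u0u; rewrite lerDl divr_ge0 ?(ltW ke0) ?mulr_ge0 //; lra.
have hu : A + 1 <= kap * (eps ^+ 2 * u / 32).
  have : 32 * (A + 1) / (kap * eps ^+ 2) <= u by apply: le_trans u0u; rewrite lerDr.
  by rewrite ler_pdivrMr // => h; lra.
have np : expR (eps * u) <= n%:R * p.
  apply: le_trans (ler_wpM2l (ltW nR) hp); rewrite /powR gt_eqF // -/u {1}uE -expRD.
  by rewrite ler_expR; lra.
have np0 : 0 <= n%:R * p by apply: le_trans np; exact: expR_ge0.
set q := Num.sqrt (Num.sqrt (n%:R * p)).
have q4 : q ^+ 4 = n%:R * p.
  by rewrite -[4%N]/(2 * 2)%N exprM !sqr_sqrtr ?sqrtr_ge0.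
have qe : expR (eps * u / 4) <= q.
  rewrite -(@ler_pXn2r _ 4) ?nnegrE ?expR_ge0 ?sqrtr_ge0 // q4 -expRM_natl.
  by rewrite [X in expR X](_ : _ = eps * u) //; field.
have qu : eps ^+ 2 * u ^+ 2 / 32 <= q.
  apply: le_trans qe; have := @expR_ge1Dxn R (eps * u / 4) 1.
  rewrite (_ : 2`!%:R = 2) // => h.
  have /h : 0 <= eps * u / 4 by rewrite divr_ge0 // mulr_ge0 //; lra.
  rewrite (_ : (eps * u / 4) ^+ 2 / 2 = eps ^+ 2 * u ^+ 2 / 32); last by field.
  by apply: le_trans; rewrite lerDr.
have Auq : A + u <= kap * q.
  have : kap * (eps ^+ 2 * u ^+ 2 / 32) <= kap * q by rewrite ler_pM2l.
  apply: le_trans; apply: le_trans (_ : (A + 1) * u <= _).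
    by rewrite mulrDl mul1r lerD2r ler_peMr // ltW.
  have := ler_wpM2r (_ : 0 <= u) hu => /(_ ltac:(lra)).
  by move/le_trans; apply; rewrite le_eqVlt; apply/orP; left; apply/eqP; ring.
have q0 : 0 <= q by exact: sqrtr_ge0.
split.
  have : kap * q <= q by rewrite ler_piMl.
  have : 16 / eta <= A by rewrite /A ler_pM2r ?invr_gt0 //; lra.
  by rewrite -/q; lra.
rewrite -/q [X in expR X](_ : _ = kap * q); last by rewrite /kap; ring.
apply: le_trans (_ : expR (A + u) <= _); last by rewrite ler_expR.
rewrite expRD -uE (_ : 48 * n%:R / eta = A * n%:R); last by rewrite /A; ring.
by rewrite ler_pM2r //; apply: le_trans (expR_ge1Dx A); lra.
Qed.

End SizeThreshold.

(** * Operator norm of the noise with exponentially small failure probability *)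

Section NoiseEvent.
Context d (T : measurableType d) (R : realType) (P : probability T R) (V E : finType).
Variables (phi : V -> V -> option E) (n : nat) (eta : R).
Variables (X : E -> T -> R) (obs : E -> T -> bool) (p : R) (mu : E -> R).
Hypothesis phi_inj : forall u v u' v' e, phi u v = Some e -> phi u' v' = Some e ->
  u' = u /\ v' = v \/ u' = v /\ v' = u.
Hypothesis phi_sym : forall u v, phi u v = phi v u.
Hypothesis phi_deg : forall u, (\sum_w (phi u w != None) <= n)%N.
Hypothesis card_V : (#|V| <= 2 * n)%N.
Hypothesis eta0 : 0 < eta.
Hypothesis eta1 : eta < 1.
Hypothesis n_large : large_enough eta n p.
Hypothesis mX : forall e, measurable_fun [set: T] (X e).
Hypothesis mobs : forall e, measurable_fun [set: T] (obs e).
Hypothesis p0 : 0 < p.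
Hypothesis p1 : p <= 1.
Hypothesis mu1 : forall e, `|mu e| <= 1.
Hypothesis meanX : forall e, \int[P]_w clamp (X e w) = mu e.
Hypothesis probobs : forall e, P (obs e @^-1` [set true]) = p%:E.
Hypothesis indep : forall G : E + E -> set T,
  (forall k, (match k with inl e => sigma_of (X e) | inr e => sigma_of (obs e) end) (G k)) ->
  P (\bigcap_(k in [set` [set: E + E]%SET]) G k) = (\prod_k fine (P (G k)))%:E.

Lemma noise_event : exists A : set T, [/\ measurable A,
  (P A <= (expR (- (eta ^+ 2 * (n%:R * p) / 2048)))%:E)%E &
  forall w, ~ A w -> centered_opnorm phi (fun e => p * mu e)
      (fun e => (obs e w)%:R * clamp (X e w)) <= (2 + eta / 2) * Num.sqrt (n%:R * p)].
Proof.
have e0 := eta0; have e1 := eta1; have pp0 := p0; have pp1 := p1.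
pose sigma : R := Num.sqrt (n%:R * p); pose q : R := Num.sqrt sigma.
have np0 : 0 <= n%:R * p by rewrite mulr_ge0 // ltW.
have [q16 qexp] : 16 / eta <= q /\ 48 * n%:R / eta <= expR (eta ^+ 2 * q / 640) by [].
have sE : sigma ^+ 2 = n%:R * p by rewrite sqr_sqrtr.
have qE : q ^+ 2 = sigma by rewrite sqr_sqrtr ?sqrtr_ge0.
have q1 : 16 <= q.
  by apply: le_trans q16; rewrite ler_pdivlMr // ler_piMr // ltW.
have q0 : 0 < q by lra.
have s1 : 1 <= sigma by rewrite -qE; nra.
have s0 : 0 < sigma by lra.
(* Traces are available only for exponents [2 * 2 ^ j], so [L] is fixed up to a factor 2. The upper
   bound keeps [walk_rate] below [(2 + eta / 16) * sigma], the lower one makes the [L]-th power beat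
   the dimension. *)
have [L [jL jl ju]] : exists L : nat, [/\ exists j, L = (2 * 2 ^ j)%N,
    L%:R <= eta / 8 * q & eta / 8 * q <= 2 * L%:R].
  have [|j [h1 h2]] := @dyadic_even R (eta / 8 * q).
    by move: q16; rewrite ler_pdivrMr //; lra.
  by exists (2 * 2 ^ j)%N; split=> //; exists j.
have L0 : 0 <= L%:R :> R by exact: ler0n.
pose t : R := (2 + eta / 8) * sigma.
have e8 : 0 < 2 + eta / 8 by lra.
have t0 : 0 < t by exact: mulr_gt0.
have eq0 : 0 <= eta / 8 * q by apply: mulr_ge0; lra.
have hL2 : L%:R ^+ 2 <= eta ^+ 2 / 64 * sigma.
  apply: le_trans (_ : (eta / 8 * q) ^+ 2 <= _); first by rewrite lerXn2r ?nnegrE.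
  by rewrite exprMn qE le_eqVlt; apply/orP; left; apply/eqP; field.
have hL3 : L%:R ^+ 3 / sigma <= eta ^+ 2 / 64 * sigma.
  have Lq : L%:R <= sigma.
    apply: le_trans jl _; rewrite -qE expr2; apply: ler_wpM2r; first exact: ltW.
    lra.
  rewrite ler_pdivrMr // exprSr; apply: ler_pM => //; exact: exprn_ge0.
have ee : eta ^+ 2 <= eta by rewrite expr2 ler_piMl ?ltW.
have rate_t : walk_rate sigma L / t <= 1 - eta / 40.
  rewrite ler_pdivrMr // /walk_rate /t.
  have h1 : 2 * sigma + 2 * L%:R ^+ 2 + 2 * L%:R ^+ 3 / sigma <= (2 + eta / 16) * sigma.
    have : eta ^+ 2 / 64 * sigma <= eta / 64 * sigma by rewrite ler_wpM2r ?(ltW s0) //; lra.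
    rewrite -[2 * L%:R ^+ 3 / sigma]mulrA; lra.
  apply: le_trans h1 _; rewrite mulrA ler_pM2r //.
  by have : eta * eta <= eta; [rewrite -expr2 | lra].
have rate0 : 0 <= walk_rate sigma L / t.
  rewrite divr_ge0 ?(ltW t0) // /walk_rate !addr_ge0 ?mulr_ge0 ?exprn_ge0 ?invr_ge0 ?(ltW s0) //.
have small : #|V|%:R * (walk_rate sigma L / t) ^+ L <= eta / 24.
  have hpow : (walk_rate sigma L / t) ^+ L <= expR (- (eta ^+ 2 * q / 640)).
    apply: le_trans (_ : expR (- (eta / 40)) ^+ L <= _).
      rewrite lerXn2r ?nnegrE ?expR_ge0 //; apply: le_trans rate_t _.
      exact: expR_ge1Dx.
    rewrite -expRM_natl ler_expR mulrN lerN2.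
    apply: le_trans (_ : eta / 16 * q * (eta / 40) <= _).
      by rewrite le_eqVlt; apply/orP; left; apply/eqP; field.
    by rewrite ler_wpM2r; lra.
  apply: le_trans (_ : (2 * n)%:R * expR (- (eta ^+ 2 * q / 640)) <= _).
    by apply: ler_pM; rewrite ?exprn_ge0 ?ler_nat.
  rewrite expRN ler_pdivrMr ?expR_gt0 // natrM.
  rewrite -[leLHS](_ : eta / 24 * (48 * n%:R / eta) = _); last by field; rewrite gt_eqF.
  by rewrite ler_wpM2l //; lra.
(* The mean is at most [(2 + eta / 4) * sigma], so a gap of [eta / 4 * sigma] is left; this [lam]
   minimises [32 * lam ^+ 2 - lam * (eta / 4 * sigma)], with minimum
   [- eta ^+ 2 * sigma ^+ 2 / 2048]. *)
pose b e := p * mu e; pose lam := eta * sigma / 256.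
have lam0 : 0 < lam by apply: mulr_gt0; [exact: mulr_gt0 | rewrite invr_gt0 ltr0n].
pose F (y : E -> R) := expR (lam * centered_opnorm phi b y).
have cF : cube_convex F.
  exact/cube_convex_expR/(centered_opnorm_convex _ _ (ltW lam0)).
have [j LE] := jL.
have := @opnorm_exp_moment R V E (option bool) tri_value (fun e => tri_law p (mu e))
  phi b p sigma n phi_inj phi_sym phi_deg p0 p1 s1 (_ : n%:R * p <= sigma ^+ 2)
  tri_value_le1 tri_value_inj (fun e k => tri_law_ge0 k (ltW p0) p1 (mu1 e))
  (fun e => tri_law_sum p (mu e)) (fun e => tri_law_mean p (mu e))
  (fun e jj => @tri_law_moment R p (mu e) jj (ltW p0) p1 (mu1 e)) j t lam.
rewrite sE -LE => /(_ (lexx _) t0 (ltW lam0)) moment.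
have f0 w : 0 <= interpolant X obs F w.
  by apply: le_trans (le_interpolant X obs w cF); exact: expR_ge0.
pose a := expR (lam * ((2 + eta / 2) * sigma)).
have [mA PA] := markov_bounded P (bounded_measurable_interpolant mX mobs F) f0
  (expR_gt0 _ : 0 < a).
(* Markov's inequality is applied to the interpolant, which dominates the exponential of the norm at
   the clamped sample. *)
exists [set w | a <= interpolant X obs F w]; split=> //.
  apply: le_trans PA _; rewrite lee_fin.
  rewrite (mean_interpolant mX mobs meanX probobs indep) ler_pdivrMr ?expR_gt0 //.
  apply: le_trans moment _; rewrite -expRD ler_expR.
  have ht : t * (1 + #|V|%:R * (walk_rate sigma L / t) ^+ L) <= (2 + eta / 4) * sigma.
    rewrite /t -mulrA [sigma * _]mulrC mulrA ler_pM2r //.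
    apply: le_trans (_ : (2 + eta / 8) * (1 + eta / 24) <= _).
      by rewrite ler_pM2l ?lerD2l //; lra.
    by have : eta * eta <= eta; [rewrite -expr2 | lra].
  have := ler_wpM2l (ltW lam0) ht => h.
  rewrite -sE; apply: le_trans (lerD h (lexx _)) _; rewrite /lam.
  by rewrite le_eqVlt; apply/orP; left; apply/eqP; field.
move=> w /= /negP; rewrite -ltNge => hw.
have := le_lt_trans (le_interpolant X obs w cF) hw.
by rewrite /F /a ltr_expR ltr_pM2l // => /ltW.
Qed.

End NoiseEvent.

(** * The mean squared error *)

Section Assembly.
Context d (T : measurableType d) (R : realType) (P : probability T R).

(* No measurability of [f] is needed: the integral of a nonnegative function is
   a supremum over the simple functions below it. *)
Lemma expectation_le_outside (f : T -> R) (A : set T) (K a : R) :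
  measurable A -> (forall w, 0 <= f w) -> 0 <= K -> 0 <= a ->
  (forall w, ~ A w -> f w <= K) -> (forall w, f w <= K + a) ->
  ('E_P[f] <= (K + a * fine (P A))%:E)%E.
Proof.
move=> mA f0 K0 a0 fK fKa; pose g w : R := a * \1_A w + K.
have bg1 : bounded_measurable (fun w => a * \1_A w : R).
  exact: bounded_measurableM (bounded_measurable_cst _ _) (bounded_measurable_indic _ mA).
have bg : bounded_measurable g by exact: bounded_measurableD bg1 (bounded_measurable_cst _ _).
have g0 w : 0 <= g w by rewrite addr_ge0 // mulr_ge0 // indicE ler0n.
have -> : (K + a * fine (P A))%:E = (\int[P]_w (g w)%:E)%E.
  rewrite -[RHS]fineK; last first.
    exact: integrable_fin_num (bounded_measurable_integrable P bg).
  congr (_%:E); rewrite -/(Rintegral P setT g) /g RintegralD //; last 2 first.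
  - exact: bounded_measurable_integrable.
  - exact/bounded_measurable_integrable/bounded_measurable_cst.
  by rewrite mean_cst meanZ ?mean_indic 1?addrC //; exact: bounded_measurable_indic.
rewrite unlock !ge0_integralTE; try by move=> w; rewrite lee_fin.
apply: le_ereal_sup => _ [h hf <-]; exists h => // w; apply: le_trans (hf w) _.
rewrite lee_fin /g indicE; case: (boolP (w \in A)) => [_|wA].
  by rewrite mulr1 addrC.
by rewrite mulr0 add0r; apply: fK => Aw; rewrite mem_set in wA.
Qed.

Lemma truncate1_le1 (x : R) : `|truncate1 x| <= 1.
Proof. by rewrite /truncate1 ler_norml; do 2?case: ltP => ?; lra. Qed.

Lemma truncate1_dist (x y : R) : `|y| <= 1 -> (truncate1 x - y) ^+ 2 <= (x - y) ^+ 2.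
Proof.
rewrite ler_norml /truncate1 => /andP[y1 y2]; do 2?case: ltP => ? //; nra.
Qed.

Variables m n : nat.
Implicit Types (M W : 'M[R]_(m, n)).

Definition mean_square_error M (Mhat : 'M[R]_(m, n)) : R :=
  ((m * n)%:R)^-1 * \sum_(i < m) \sum_(j < n) (Mhat i j - M i j) ^+ 2.

Lemma mean_square_error_ge0 M W : 0 <= mean_square_error M W.
Proof.
rewrite mulr_ge0 ?invr_ge0 ?ler0n //.
by apply: sumr_ge0 => i _; apply: sumr_ge0 => j _; exact: sqr_ge0.
Qed.

Lemma mean_square_error_le4 M (W : 'M[R]_(m, n)) : (0 < m * n)%N ->
  (forall i j, `|M i j| <= 1) -> mean_square_error M (map_mx (@truncate1 R) W) <= 4.
Proof.
move=> mn0 M1; rewrite /mean_square_error mulrC ler_pdivrMr ?ltr0n //.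
apply: le_trans (_ : \sum_(i < m) \sum_(j < n) 4 <= _).
  apply: ler_sum => i _; apply: ler_sum => j _; rewrite mxE.
  have := truncate1_le1 (W i j); have := M1 i j; rewrite !ler_norml.
  by move=> /andP[a1 a2] /andP[b1 b2]; nra.
by rewrite !sumr_const !card_ord -mulrnA mulnC mulr_natr.
Qed.

(** [x <= eta / 10] puts the noise level strictly below the threshold. Then [phat (W - M)] is the
    thresholding error plus [(p - phat) M]; with [q] the square root of [r / (m p)] the first part
    contributes [100 * q ^+ 2], and the bound on [x ^+ 2] makes the second at most [q]. For [q > 1]
    the trivial bound 4 is used. *)
Lemma usvt_error (eta p phat x : R) (Y M Mhat : 'M[R]_(m, n)) :
  0 < eta -> eta < 1 -> 0 < p -> p <= 1 -> (0 < m)%N -> (0 < n)%N ->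
  (forall i j, `|M i j| <= 1) ->
  0 <= x -> x <= eta / 10 -> x ^+ 2 <= eta ^+ 2 / 100 * Num.sqrt ((m%:R * p)^-1) ->
  `|phat - p| <= x * p ->
  op_bounded (Y - p *: M) ((2 + eta / 2) * Num.sqrt (n%:R * p)) ->
  is_usvt eta phat Y Mhat ->
  mean_square_error M Mhat <= 101 * Num.min (Num.sqrt ((\rank M)%:R / (m%:R * p))) 1.
Proof.
move=> e0 e1 p0 p1 m0 n0 M1 x0 x1 x2 hph hop [s [U [V [svd ->]]]].
have mR : 0 < m%:R :> R by rewrite ltr0n.
have nR : 0 < n%:R :> R by rewrite ltr0n.
have mp0 : 0 < m%:R * p by exact: mulr_gt0.
have np0 : 0 < n%:R * p by exact: mulr_gt0.
have xp : x * p <= p / 10 by have : x * p <= eta / 10 * p; [rewrite ler_pM2r | nra].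
move: (hph); rewrite ler_norml => /andP[ph1 ph2].
have phat9 : 9 / 10 * p <= phat by lra.
have phat0 : 0 < phat by lra.
set W := usvt_W _ _ _ _ _; set r := \rank M; set q := Num.sqrt (r%:R / _).
have le4 : mean_square_error M (map_mx (@truncate1 R) W) <= 4.
  by apply: mean_square_error_le4 => //; rewrite muln_gt0 m0.
have q0 : 0 <= q by exact: sqrtr_ge0.
suff err : mean_square_error M (map_mx (@truncate1 R) W) <= 100 * q ^+ 2 + q.
  have [ql|qg] := leP q 1.
    by apply: (le_trans err); have : q ^+ 2 <= q; [rewrite expr2 ler_piMl | lra].
  by apply: (le_trans le4); lra.
have q2 : q ^+ 2 = r%:R / (m%:R * p).
  by rewrite sqr_sqrtr // divr_ge0 // ltW.
pose tau := (2 + eta) * Num.sqrt (n%:R * phat).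
pose t := (2 + eta / 2) * Num.sqrt (n%:R * p).
have tau0 : 0 <= tau by rewrite mulr_ge0 ?sqrtr_ge0 //; lra.
have t0 : 0 <= t by rewrite mulr_ge0 ?sqrtr_ge0 //; lra.
have tau2 : tau ^+ 2 = (2 + eta) ^+ 2 * (n%:R * phat).
  by rewrite exprMn sqr_sqrtr // mulr_ge0 // ltW.
have t_tau : t < tau.
  rewrite -ltr_sqr ?nnegrE // tau2 exprMn sqr_sqrtr ?(ltW np0) //.
  have h1 : n%:R * ((1 - eta / 10) * p) <= n%:R * phat.
    rewrite ler_pM2l //; have : x * p <= eta / 10 * p by rewrite ler_pM2r.
    by lra.
  have h2 : (2 + eta / 2) ^+ 2 < (2 + eta) ^+ 2 * (1 - eta / 10) by nra.
  apply: lt_le_trans (_ : (2 + eta) ^+ 2 * (1 - eta / 10) * (n%:R * p) <= _).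
    by rewrite ltr_pM2r.
  have := ler_wpM2l (sqr_ge0 (2 + eta)) h1; apply: le_trans.
  by rewrite le_eqVlt; apply/orP; left; apply/eqP; ring.
have thr := svd_threshold_error svd t0 t_tau hop.
set S := svd_threshold _ _ _ _ in thr.
have WE : W = phat^-1 *: S by rewrite /W /usvt_W gt_eqF.
have rankpM : (\rank (p *: M)%R <= r)%N by exact: mxrank_scale.
have {}thr : frob (S - p *: M) <= 45 * r%:R * (n%:R * phat).
  apply: (le_trans thr); rewrite tau2 mulrA.
  rewrite ler_pM2r ?mulr_gt0 //.
  have h9 : (2 + eta) ^+ 2 <= 9 by nra.
  have hr : (\rank (p *: M))%:R <= r%:R :> R by rewrite ler_nat.
  rewrite [leRHS](_ : _ = 5 * r%:R * 9); last by ring.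
  by apply: ler_pM; rewrite ?sqr_ge0 // ?ler_pM2l // mulr_ge0.
(* For [r = 0] the target is 0, so the bias term has to vanish as well; the boolean factor records
   this and lets [rq] compare with [q] in all cases. *)
have frobM : frob M <= (m * n)%:R * (0 < r)%N%:R.
  have [r0|rpos] := posnP r.
    have /eqP -> : M == 0 by rewrite -mxrank_eq0 -/r r0.
    by rewrite mulr0 /frob big1 // => i _; rewrite big1 // => j _; rewrite mxE expr0n.
  rewrite mulr1; apply: le_trans (_ : \sum_(i < m) \sum_(j < n) 1 <= _).
    apply: ler_sum => i _; apply: ler_sum => j _.
    by rewrite -real_normK ?num_real // exprn_ile1.
  by rewrite !sumr_const !card_ord -mulrnA mulnC.
have rq : Num.sqrt ((m%:R * p)^-1) * (0 < r)%N%:R <= q.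
  have [r0|rpos] := posnP r; first by rewrite mulr0.
  rewrite mulr1 ler_sqrt ?divr_ge0 ?(ltW mp0) //.
  by rewrite -[leLHS]mul1r ler_pM2r ?invr_gt0 // ler1n.
have decomp : phat *: (W - M) = (S - p *: M) + (p - phat) *: M.
  by rewrite WE scalerBr scalerA divff ?gt_eqF // scale1r scalerBl addrA subrK.
have frobW : frob (W - M) <= 100 * r%:R * n%:R / p + (m * n)%:R * q.
  have h1 : phat ^+ 2 * frob (W - M) <=
      2 * (45 * r%:R * (n%:R * phat) + (p - phat) ^+ 2 * ((m * n)%:R * (0 < r)%N%:R)).
    rewrite -frobZ decomp; apply: le_trans (frobD_le _ _) _.
    rewrite ler_pM2l // frobZ; apply: lerD => //.
    by apply: ler_wpM2l => //; exact: sqr_ge0.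
  have h2 : (p - phat) ^+ 2 * (0 < r)%N%:R <= 10^-2 * q * p ^+ 2.
    have h3 : (p - phat) ^+ 2 <= x ^+ 2 * p ^+ 2.
      rewrite -exprMn -[(p - phat) ^+ 2]real_normK ?num_real // distrC.
      by rewrite lerXn2r ?nnegrE // mulr_ge0 // ltW.
    have h4 : x ^+ 2 <= 10^-2 * Num.sqrt ((m%:R * p)^-1).
      apply: (le_trans x2); rewrite ler_wpM2r ?sqrtr_ge0 //.
      have : eta ^+ 2 <= 1 by rewrite exprn_ile1 // ltW.
      by move=> h; have -> : 10^-2 = 100^-1 :> R; [field | lra].
    apply: le_trans (_ : x ^+ 2 * p ^+ 2 * (0 < r)%N%:R <= _).
      by rewrite ler_wpM2r.
    apply: le_trans (_ : 10^-2 * Num.sqrt ((m%:R * p)^-1) * p ^+ 2 * (0 < r)%N%:R <= _).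
      by rewrite ler_wpM2r // ler_wpM2r // sqr_ge0.
    have := ler_wpM2l (_ : 0 <= 10^-2 * p ^+ 2) rq.
    rewrite mulr_ge0 ?sqr_ge0 ?invr_ge0 ?exprn_ge0 // => /(_ isT) h5.
    rewrite [leRHS](_ : _ = 10^-2 * p ^+ 2 * q); last by ring.
    by apply: le_trans h5; rewrite le_eqVlt; apply/orP; left; apply/eqP; ring.
  have pp : 81 / 100 * p ^+ 2 <= phat ^+ 2.
    have -> : 81 / 100 * p ^+ 2 = (9 / 10 * p) ^+ 2 by field.
    rewrite lerXn2r ?nnegrE ?(ltW phat0) // mulr_ge0 ?(ltW p0) //; lra.
  have part1 : 90 * r%:R * n%:R / phat <= 100 * r%:R * n%:R / p.
    have c0 : 0 <= r%:R * n%:R :> R by rewrite mulr_ge0.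
    rewrite -![_ * r%:R * _]mulrA.
    rewrite ler_pdivrMr // mulrAC ler_pdivlMr //.
    by have := ler_wpM2l c0 phat9; lra.
  rewrite -(ler_pM2l (_ : 0 < phat ^+ 2)); last by rewrite exprn_gt0.
  apply: (le_trans h1); rewrite mulrDr [leRHS]mulrDr; apply: lerD.
    have := ler_wpM2l (_ : 0 <= phat ^+ 2) part1; rewrite sqr_ge0 => /(_ isT).
    apply: le_trans; rewrite le_eqVlt; apply/orP; left; apply/eqP.
    by field; rewrite gt_eqF.
  have mn0 : 0 <= (m * n)%:R :> R by exact: ler0n.
  rewrite [leLHS](_ : _ = (m * n)%:R * (2 * ((p - phat) ^+ 2 * (0 < r)%N%:R))); last by ring.
  rewrite [leRHS](_ : _ = (m * n)%:R * (phat ^+ 2 * q)); last by ring.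
  apply: ler_wpM2l => //; apply: le_trans (_ : (2 * (10^-2 * q * p ^+ 2)) <= _).
    by rewrite ler_pM2l.
  have := ler_wpM2r q0 pp; have : 0 <= q * p ^+ 2 by rewrite mulr_ge0 ?sqr_ge0.
  have -> : 10^-2 = 100^-1 :> R by field.
  by lra.
have mnR : 0 < (m * n)%:R :> R by rewrite ltr0n muln_gt0 m0.
apply: le_trans (_ : ((m * n)%:R)^-1 * frob (W - M) <= _).
  rewrite ler_pM2l ?invr_gt0 //; apply: ler_sum => i _; apply: ler_sum => j _.
  by rewrite !mxE; exact: truncate1_dist.
rewrite mulrC ler_pdivrMr //; apply: (le_trans frobW).
rewrite q2 natrM le_eqVlt; apply/orP; left; apply/eqP.
by field; rewrite !gt_eqF.
Qed.

End Assembly.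

Lemma big_sub_index (R : Type) (idx : R) (op : Monoid.com_law idx) (I : finType)
    (D : {pred I}) (F : I -> R) :
  \big[op/idx]_(i in D) F i = \big[op/idx]_(u : {i | i \in D}) F (val u).
Proof.
rewrite (reindex_omap (fun u : {i | i \in D} => val u) insub) => [|i Di]; last by rewrite insubT.
by apply: eq_bigl => u; rewrite valK eqxx andbT; exact: valP.
Qed.

(** * The mean squared error for an abstract layout of the independent entries *)

Section SamplingModel.
Context d (T : measurableType d) (R : realType) (P : probability T R).
Variables (m n : nat) (D : {pred 'I_m * 'I_n}) (p : R) (M : 'M[R]_(m, n)).
Variables (X : 'I_m -> 'I_n -> {RV P >-> R}) (obs : 'I_m -> 'I_n -> {RV P >-> bool}).

Let E : finType := {e : 'I_m * 'I_n | e \in D}.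

Definition entry (e : E) : T -> R := X (val e).1 (val e).2.
Definition observed (e : E) : T -> bool := obs (val e).1 (val e).2.
Definition parameter (e : E) : R := M (val e).1 (val e).2.

Hypothesis model : sampling_model D p M X obs.

Let entry_in_D (e : E) : ((val e).1, (val e).2) \in D.
Proof. by rewrite -surjective_pairing; exact: valP. Qed.

Lemma entry_independence (G : E + E -> set T) :
  (forall k, (match k with inl e => sigma_of (entry e) | inr e => sigma_of (observed e) end) (G k)) ->
  P (\bigcap_(k in [set` [set: E + E]%SET]) G k) = (\prod_k fine (P (G k)))%:E.
Proof.
move=> hG; have [_ _ _ _ indep] := model.
pose J : {set 'I_m * 'I_n + 'I_m * 'I_n} :=
  [set k | match k with inl e | inr e => e \in D end]%SET.
pose G' (k : 'I_m * 'I_n + 'I_m * 'I_n) : set T :=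
  match k with
  | inl e => if insub e is Some u then G (inl u) else setT
  | inr e => if insub e is Some u then G (inr u) else setT
  end.
have := indep J G' _ _.
have -> : \bigcap_(k in [set` J]) G' k = \bigcap_(k in [set` [set: E + E]%SET]) G k.
  apply/seteqP; split=> w hw.
    move=> [u|u] _.
      have := hw (inl (val u)); rewrite /= /G' valK; apply.
      by rewrite finset.inE; exact: valP.
    have := hw (inr (val u)); rewrite /= /G' valK; apply.
    by rewrite finset.inE; exact: valP.
  move=> [e|e] /=; rewrite finset.inE => eD; rewrite /G' insubT.
    by apply: (hw (inl (Sub e eD))); rewrite /= finset.inE.
  by apply: (hw (inr (Sub e eD))); rewrite /= finset.inE.
move=> ->.
- congr (_%:E); rewrite big_mkcond [RHS]big_sumType big_sumType /=.
  congr (_ * _).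
    rewrite (eq_bigr (fun e => if e \in D then fine (P (G' (inl e))) else 1)) => [|e _]; last first.
      by rewrite finset.inE.
    by rewrite -big_mkcond big_sub_index; apply: eq_bigr => u _; rewrite /G' valK.
  rewrite (eq_bigr (fun e => if e \in D then fine (P (G' (inr e))) else 1)) => [|e _]; last first.
    by rewrite finset.inE.
  by rewrite -big_mkcond big_sub_index; apply: eq_bigr => u _; rewrite /G' valK.
- by move=> [e|e]; rewrite finset.inE.
- move=> [e|e]; rewrite finset.inE => eD; rewrite /G' insubT; first exact: (hG (inl (Sub e eD))).
  exact: (hG (inr (Sub e eD))).
Qed.

Lemma measurable_entry e : measurable_fun [set: T] (entry e).
Proof. exact: measurable_funPT. Qed.

Lemma measurable_observed e : measurable_fun [set: T] (observed e).
Proof. exact: measurable_funPT. Qed.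

Lemma entry_bounded_event : exists N : set T, [/\ measurable N, P N = 0%E &
  forall w, ~ N w -> forall e, `|entry e w| <= 1].
Proof.
have [_ _ bX _ _] := model.
have : {ae P, forall w, forall e : E, `|entry e w| <= 1}.
  by apply: filter_forall => e; exact: bX (entry_in_D e).
case=> N [mN PN sub]; exists N; split=> // w Nw; apply: contrapT => h.
by apply: Nw; apply: sub => /= h'; apply: h.
Qed.

Lemma mean_clamp_entry e : \int[P]_w clamp (entry e w) = parameter e.
Proof.
have [_ EX bX _ _] := model.
have hE := EX _ _ (entry_in_D e); have hb := bX _ _ (entry_in_D e).
rewrite /Rintegral /parameter -[RHS]/(fine (M (val e).1 (val e).2)%:E) -hE.
congr fine; rewrite unlock; apply: ae_eq_integral => //.
- apply/measurable_EFinP.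
  exact: (measurableT_comp (measurable_clamp (R := R)) (measurable_entry e)).
- by apply/measurable_EFinP; exact: measurable_entry.
case: hb => N [mN PN sub]; exists N; split=> // w /= h; apply: sub => /= h'.
by apply: h => _; rewrite clamp_id.
Qed.

Lemma observed_proportionE w :
  observed_proportion D obs w = (\sum_e (observed e w)%:R) / #|{: E}|%:R.
Proof.
rewrite /observed_proportion card_sig -natr_sum; congr (_%:R / _).
by rewrite big_sub_index.
Qed.

(** Interface shared by the two models: [pos] sends a position of the matrix to the independent
    entry displayed there, and [phi] arranges these entries in a symmetric matrix whose norm
    controls the original one through [phi_op]. *)
Variables (V : finType) (phi : V -> V -> option E) (pos : 'I_m -> 'I_n -> E).
Hypothesis phi_inj : forall u v u' v' e, phi u v = Some e -> phi u' v' = Some e ->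
  u' = u /\ v' = v \/ u' = v /\ v' = u.
Hypothesis phi_sym : forall u v, phi u v = phi v u.
Hypothesis phi_deg : forall u, (\sum_w (phi u w != None) <= n)%N.
Hypothesis card_V : (#|V| <= 2 * n)%N.
Hypothesis phi_op : forall (a : E -> R) (t : R), 0 <= t ->
  opnorm (edge_matrix phi a) <= t -> op_bounded (\matrix_(i, j) a (pos i j)) t.
Hypothesis X_pos : forall i j w, X i j w = entry (pos i j) w.
Hypothesis obs_pos : forall i j w, obs i j w = observed (pos i j) w.
Hypothesis M_pos : forall i j, M i j = parameter (pos i j).
Hypothesis m0 : (0 < m)%N.
Hypothesis mn : (m <= n)%N.
Hypothesis card_D : (m * n <= 2 * #|D|)%N.
Hypothesis p0 : 0 < p.
Hypothesis p1 : p <= 1.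

Variables (eta : R) (Mhat : T -> 'M[R]_(m, n)).
Hypothesis eta0 : 0 < eta.
Hypothesis eta1 : eta < 1.
Hypothesis usvt : forall w,
  is_usvt eta (observed_proportion D obs w) (observed_matrix X obs w) (Mhat w).

Let n0 : (0 < n)%N. Proof. exact: leq_trans mn. Qed.

Lemma MSE_le4 : (MSE P M Mhat <= 4%:E)%E.
Proof.
have [M1 _ _ _ _] := model.
have le4 w : mean_square_error M (Mhat w) <= 4.
  have [s [U [V' [_ ->]]]] := usvt w.
  by apply: mean_square_error_le4 => //; rewrite muln_gt0 m0.
have le4' w : mean_square_error M (Mhat w) <= 4 + 0 by rewrite addr0.
have := expectation_le_outside P measurable0 (fun w => mean_square_error_ge0 M (Mhat w))
  (ler0n R 4) (lexx 0) (fun w _ => le4 w) le4'.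
by rewrite mul0r addr0.
Qed.

Lemma MSE_large : large_enough eta n p ->
  (MSE P M Mhat <= (101 * Num.min (Num.sqrt ((\rank M)%:R / (m%:R * p))) 1 +
    12 * expR (- (eta ^+ 2 * (n%:R * p) / 2048)))%:E)%E.
Proof.
move=> large; have [M1 _ _ probobs _] := model.
have e0 := eta0; have e1 := eta1; have pp0 := p0; have pp1 := p1.
have mR : 1 <= m%:R :> R by rewrite ler1n.
have nR : 0 < n%:R :> R by rewrite ltr0n.
have mp0 : 0 < m%:R * p by apply: mulr_gt0 => //; lra.
have np0 : 0 < n%:R * p by exact: mulr_gt0.
have mu1 e : `|parameter e| <= 1 by exact: M1.
have pobs e : P (observed e @^-1` [set true]) = p%:E.
  exact: probobs (entry_in_D e).
(* The largest relative error of [phat] that [usvt_error] tolerates. Since [m * z >= 1], the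
   Chernoff exponent, of order [m * n * p * z], is still at least of order [n * p]. *)
pose y := Num.sqrt ((m%:R * p)^-1); pose z := Num.min 1 y; pose x := eta / 10 * Num.sqrt z.
have y0 : 0 < y by rewrite sqrtr_gt0 invr_gt0.
have z0 : 0 <= z by rewrite le_min ler01 ltW.
have z1 : z <= 1 by rewrite ge_min lexx.
have zy : z <= y by rewrite ge_min lexx orbT.
have mz : 1 <= m%:R * z.
  rewrite /z; case: (leP 1 y) => _; first by rewrite mulr1.
  rewrite -(@ler_pXn2r _ 2) ?nnegrE // ?mulr_ge0 ?(ltW y0) // expr1n exprMn.
  rewrite sqr_sqrtr ?invr_ge0 ?(ltW mp0) // ler_pdivlMr // mul1r expr2.
  by rewrite ler_pM2l; lra.
have x2 : x ^+ 2 = eta ^+ 2 / 100 * z by rewrite exprMn sqr_sqrtr //; field.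
have x0 : 0 <= x by rewrite mulr_ge0 ?sqrtr_ge0 //; lra.
have xe : x <= eta / 10.
  rewrite /x -[leRHS]mulr1 ler_wpM2l //; first by lra.
  by rewrite -[leRHS]sqrtr1 ler_wsqrtr.
have x1 : x <= 1 by lra.
have [A1 [mA1 PA1 hA1]] := noise_event phi_inj phi_sym phi_deg card_V eta0 eta1 large
  measurable_entry measurable_observed p0 p1 mu1 mean_clamp_entry pobs entry_independence.
have [A2 [mA2 PA2 hA2]] := chernoff measurable_entry measurable_observed
  (ltW p0) p1 pobs entry_independence x0 x1.
have [A3 [mA3 PA3 hA3]] := entry_bounded_event.
pose A := A1 `|` A2 `|` A3.
have mA12 : measurable (A1 `|` A2) by exact: measurableU.
have mA : measurable A by exact: measurableU.
have EcardE : #|{: E}| = #|D| by rewrite card_sig.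
have cardE : m%:R * n%:R / 2 <= #|{: E}|%:R :> R.
  by rewrite EcardE ler_pdivrMr // [leRHS]mulrC -!natrM ler_nat.
have cardE0 : 0 < #|{: E}|%:R :> R.
  by apply: lt_le_trans cardE; rewrite divr_gt0 // mulr_gt0 //; lra.
pose tail := expR (- (eta ^+ 2 * (n%:R * p) / 2048)).
(* One [tail] comes from the noise and two from Chernoff; multiplied by the trivial error 4 this is
   the constant 12. *)
have PA : fine (P A) <= 3 * tail.
  have h2 : 2 * expR (- (#|{: E}|%:R * p * x ^+ 2 / 8)) <= 2 * tail.
    rewrite ler_pM2l // ler_expR lerN2 x2.
    apply: le_trans (_ : m%:R * n%:R / 2 * p * (eta ^+ 2 / 100 * z) / 8 <= _); last first.
      rewrite ler_pM2r ?invr_gt0 //; apply: ler_wpM2r; last by rewrite ler_pM2r.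
      by apply: mulr_ge0 => //; rewrite divr_ge0 ?sqr_ge0.
    apply: le_trans (_ : eta ^+ 2 * (n%:R * p) / 1600 * 1 <= _).
      rewrite mulr1; apply: ler_wpM2l; first by rewrite mulr_ge0 ?sqr_ge0 // ltW.
      by lra.
    apply: le_trans (_ : eta ^+ 2 * (n%:R * p) / 1600 * (m%:R * z) <= _).
      apply: ler_wpM2l; last exact: mz.
      by apply: divr_ge0; [apply: mulr_ge0; [exact: sqr_ge0 | exact: ltW] | exact: ler0n].
    by rewrite le_eqVlt; apply/orP; left; apply/eqP; field.
  rewrite -lee_fin fineK ?fin_num_measure //.
  have PA3' : (P A3 <= 0%:E)%E by rewrite PA3.
  apply: le_trans (measureU2 _ mA12 mA3) _.
  apply: le_trans (leeD (measureU2 _ mA1 mA2) (lexx _)) _.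
  apply: le_trans (leeD (leeD PA1 PA2) PA3') _; rewrite -!EFinD lee_fin.
  by move: h2; rewrite -/tail; lra.
have good w : ~ A w -> mean_square_error M (Mhat w) <=
    101 * Num.min (Num.sqrt ((\rank M)%:R / (m%:R * p))) 1.
  move=> /not_orP[/not_orP[/hA1 noise /hA2 count] /hA3 bounded].
  apply: (usvt_error eta0 eta1 p0 p1 m0 n0 M1 x0 xe _ _ _ (usvt w)).
  - by rewrite x2 ler_wpM2l ?divr_ge0 ?sqr_ge0 ?ler0n.
  - rewrite observed_proportionE -(ler_pM2r cardE0) -[X in _ * X <= _](gtr0_norm cardE0).
    by rewrite -normrM mulrBl divfK ?gt_eqF // -mulrA.
  have -> : observed_matrix X obs w - p *: M =
      \matrix_(i, j) ((observed (pos i j) w)%:R * clamp (entry (pos i j) w) -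
                      p * parameter (pos i j)).
    apply/matrixP => i j; rewrite !mxE M_pos obs_pos X_pos clamp_id //.
    by case: (observed _ _); rewrite ?mul1r ?mul0r.
  apply: (phi_op (a := fun e => (observed e w)%:R * clamp (entry e w) - p * parameter e)).
    by rewrite mulr_ge0 ?sqrtr_ge0 //; lra.
  exact: noise.
have K0 : 0 <= 101 * Num.min (Num.sqrt ((\rank M)%:R / (m%:R * p))) 1.
  by rewrite mulr_ge0 // le_min sqrtr_ge0 ler01.
apply: le_trans (expectation_le_outside P mA _ K0 (_ : 0 <= 4) good _) _ => //.
- by move=> w; exact: mean_square_error_ge0.
- move=> w; have [s [U [V' [_ ->]]]] := usvt w.
  apply: le_trans (_ : 4 <= _); last by rewrite lerDr.
  by apply: mean_square_error_le4 => //; rewrite muln_gt0 m0.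
rewrite lee_fin lerD2l; apply: le_trans (_ : 4 * (3 * tail) <= _).
  by rewrite ler_pM2l.
by rewrite mulrA -natrM.
Qed.

End SamplingModel.

(** * The layouts of the asymmetric and of the symmetric model *)

Section Layouts.
Context {R : realType}.

Section Bipartite.
Variables m n : nat.

Let E : finType := {e : 'I_m * 'I_n | e \in predT}.

Definition bipartite_pos (i : 'I_m) (j : 'I_n) : E := exist _ (i, j) isT.

(* [edge_matrix bipartite_edge] is the dilation of a rectangular matrix to a
   symmetric one of size [m + n]. *)
Definition bipartite_edge (u v : 'I_m + 'I_n) : option E :=
  match u, v with
  | inl i, inr j | inr j, inl i => Some (bipartite_pos i j)
  | _, _ => None
  end.

Lemma bipartite_edge_sym u v : bipartite_edge u v = bipartite_edge v u.
Proof. by case: u v => [i|j] [i'|j']. Qed.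

Lemma bipartite_edge_inj u v u' v' e :
  bipartite_edge u v = Some e -> bipartite_edge u' v' = Some e ->
  u' = u /\ v' = v \/ u' = v /\ v' = u.
Proof.
by case: u v u' v' => [i|j] [i1|j1] [i2|j2] [i3|j3] //= [<-] [-> ->]; [left|right|right|left].
Qed.

Lemma bipartite_edge_deg u : (m <= n)%N -> (\sum_w (bipartite_edge u w != None) <= n)%N.
Proof.
move=> mn; rewrite big_sumType /=; case: u => [i|j] /=.
  by rewrite big1 // add0n sum1_card card_ord.
by rewrite [X in (_ + X)%N]big1 // addn0 sum1_card card_ord.
Qed.

Lemma bipartite_op_bounded (a : E -> R) (t : R) : 0 <= t ->
  opnorm (edge_matrix bipartite_edge a) <= t ->
  op_bounded (\matrix_(i, j) a (bipartite_pos i j)) t.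
Proof.
move=> t0 ht z; pose x (u : 'I_m + 'I_n) : R := if u is inr j then z j 0 else 0.
have xz : dot x x = frob z.
  rewrite /dot big_sumType /= big1 ?add0r; last by move=> i _; rewrite mulr0.
  by apply: eq_bigr => j _; rewrite big_ord1 expr2.
have -> : frob ((\matrix_(i, j) a (bipartite_pos i j)) *m z) =
    \sum_i apply_op (edge_matrix bipartite_edge a) x (inl i) ^+ 2.
  apply: eq_bigr => i _; rewrite big_ord1 mxE /apply_op big_sumType /=.
  rewrite [X in _ = (X + _) ^+ 2]big1 ?add0r => [|i' _]; last by rewrite mulr0.
  by congr (_ ^+ 2); apply: eq_bigr => j _; rewrite mxE.
rewrite -xz; apply: le_trans (_ : dot (apply_op (edge_matrix bipartite_edge a) x)
    (apply_op (edge_matrix bipartite_edge a) x) <= _).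
  rewrite /dot big_sumType /=; under [X in _ <= X + _]eq_bigr do rewrite -expr2.
  by rewrite lerDl; apply: sumr_ge0 => j _; rewrite -expr2 sqr_ge0.
apply: le_trans (apply_op_opnorm _ _) _; rewrite ler_wpM2r ?dot_ge0 //.
by rewrite lerXn2r ?nnegrE ?opnorm_ge0.
Qed.

End Bipartite.

Section Symmetrized.
Variable n : nat.

Let E : finType := {e : 'I_n * 'I_n | e \in @upper_triangle n}.

Definition sorted_pair (i j : 'I_n) : 'I_n * 'I_n := if (i <= j)%N then (i, j) else (j, i).

Lemma sorted_pair_upper i j : sorted_pair i j \in @upper_triangle n.
Proof. by rewrite /sorted_pair; case: (leqP i j) => h; rewrite inE /= ?h ?(ltnW h). Qed.

Definition symmetric_pos (i j : 'I_n) : E :=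
  exist (fun e => e \in @upper_triangle n) _ (sorted_pair_upper i j).

(** The matrix is already symmetric, so no dilation is made: every pair of indices is an edge, and
    diagonal entries are loops. *)
Definition symmetric_edge (i j : 'I_n) : option E := Some (symmetric_pos i j).

Lemma sorted_pairC i j : sorted_pair i j = sorted_pair j i.
Proof.
rewrite /sorted_pair; case: (ltngtP i j) => // /val_inj ->; by [].
Qed.

Lemma symmetric_edge_sym i j : symmetric_edge i j = symmetric_edge j i.
Proof. by congr Some; apply: val_inj; rewrite /= sorted_pairC. Qed.

Lemma symmetric_edge_inj u v u' v' e :
  symmetric_edge u v = Some e -> symmetric_edge u' v' = Some e ->
  u' = u /\ v' = v \/ u' = v /\ v' = u.
Proof.
move=> <- /(congr1 (omap val)) /= []; rewrite /sorted_pair.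
by case: ifP; case: ifP => _ _ -[-> ->]; by [left | right].
Qed.

Lemma symmetric_edge_deg u : (\sum_w (symmetric_edge u w != None) <= n)%N.
Proof. by rewrite sum1_card card_ord. Qed.

Lemma card_upper_triangle : (n * n <= 2 * #|@upper_triangle n|)%N.
Proof.
have cardE : #|@upper_triangle n| = (\sum_(i < n) \sum_(j < n) (i <= j))%N.
  rewrite pair_big -sum1_card big_mkcond; apply: eq_bigr => e _.
  by rewrite inE; case: (_ <= _)%N.
rewrite mul2n -addnn {2}cardE exchange_big cardE -big_split /=.
have {1}-> : (n * n = \sum_(i < n) \sum_(j < n) 1)%N.
  by rewrite !sum_nat_const card_ord muln1.
apply: leq_sum => i _; rewrite -big_split; apply: leq_sum => j _ /=.
by case: (leqP i j) => // /ltnW ->.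
Qed.

Lemma symmetric_op_bounded (a : E -> R) (t : R) : 0 <= t ->
  opnorm (edge_matrix symmetric_edge a) <= t ->
  op_bounded (\matrix_(i, j) a (symmetric_pos i j)) t.
Proof.
move=> t0 ht z; pose x (j : 'I_n) := z j 0.
have -> : frob z = dot x x.
  by apply: eq_bigr => j _; rewrite big_ord1 expr2.
have -> : frob ((\matrix_(i, j) a (symmetric_pos i j)) *m z) =
    dot (apply_op (edge_matrix symmetric_edge a) x)
        (apply_op (edge_matrix symmetric_edge a) x).
  apply: eq_bigr => i _; rewrite big_ord1 mxE -expr2; congr (_ ^+ 2).
  by apply: eq_bigr => j _; rewrite mxE.
apply: le_trans (apply_op_opnorm _ _) _; rewrite ler_wpM2r ?dot_ge0 //.
by rewrite lerXn2r ?nnegrE ?opnorm_ge0.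
Qed.

End Symmetrized.
End Layouts.

(* The matrices with [n < N0] are absorbed in the constant [C(eps)], since
   [MSE <= 4] and [n * p <= N0]. *)
Lemma usvt_bound_of_large (R : realType) (eta N0 p : R) (m n r : nat) (x : \bar R) :
  0 < eta -> 0 < p -> p <= 1 -> (x <= 4%:E)%E ->
  (N0 <= n%:R -> (x <= (101 * Num.min (Num.sqrt (r%:R / (m%:R * p))) 1 +
    12 * expR (- (eta ^+ 2 * (n%:R * p) / 2048)))%:E)%E) ->
  (x <= (usvt_bound 101 (eta ^+ 2 / 2048) (12 * expR (eta ^+ 2 / 2048 * `|N0|))
     m n r p)%:E)%E.
Proof.
move=> eta0 p0 p1 x4 xlarge.
have c0 : 0 <= eta ^+ 2 / 2048 by rewrite divr_ge0 ?sqr_ge0 ?ler0n.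
have [hn|hn] := leP N0 n%:R.
  apply: le_trans (xlarge hn) _; rewrite lee_fin /usvt_bound lerD2l.
  rewrite [X in expR (- X)](_ : _ = eta ^+ 2 / 2048 * n%:R * p); last by ring.
  rewrite ler_wpM2r ?expR_ge0 // ler_peMr // -[leLHS]expR0 ler_expR.
  exact: mulr_ge0.
apply: (le_trans x4); rewrite lee_fin /usvt_bound.
apply: le_trans (_ : 0 + 12 <= _); first by rewrite add0r ler_nat.
apply: lerD; first by rewrite mulr_ge0 ?ler0n // le_min sqrtr_ge0 ler01.
rewrite -mulrA ler_peMr // -expRD -[leLHS]expR0 ler_expR subr_ge0 -mulrA.
rewrite ler_wpM2l //; apply: le_trans (ler_norm N0); apply: le_trans (ltW hn).
by rewrite ler_piMr.
Qed.

Theorem theorem2p1 (R : realType) (eta : R) (heta0 : 0 < eta) (heta1 : eta < 1) :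
  exists C c : R, exists Ceps : R -> R,
  [/\ 0 < C, 0 < c,
   forall (m n : nat) (p eps : R), (1 <= m)%N -> (m <= n)%N ->
     0 <= p -> p <= 1 -> 0 < eps -> n%:R `^ (-1 + eps) <= p ->
     forall (d : measure_display) (T : measurableType d) (P : probability T R)
       (M : 'M[R]_(m, n)) (X : 'I_m -> 'I_n -> {RV P >-> R})
       (obs : 'I_m -> 'I_n -> {RV P >-> bool}) (Mhat : T -> 'M[R]_(m, n)),
     asymmetric_model p M X obs ->
     (forall w, is_usvt eta (observed_proportion predT obs w)
                        (observed_matrix X obs w) (Mhat w)) ->
     (MSE P M Mhat <= (usvt_bound C c (Ceps eps) m n (\rank M) p)%:E)%E &
   forall (n : nat) (p eps : R), (1 <= n)%N ->
     0 <= p -> p <= 1 -> 0 < eps -> n%:R `^ (-1 + eps) <= p ->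
     forall (d : measure_display) (T : measurableType d) (P : probability T R)
       (M : 'M[R]_n) (X : 'I_n -> 'I_n -> {RV P >-> R})
       (obs : 'I_n -> 'I_n -> {RV P >-> bool}) (Mhat : T -> 'M[R]_n),
     symmetric_model p M X obs ->
     (forall w, is_usvt eta (observed_proportion (@upper_triangle n) obs w)
                        (observed_matrix X obs w) (Mhat w)) ->
     (MSE P M Mhat <= (usvt_bound C c (Ceps eps) n n (\rank M) p)%:E)%E].
Proof.
(* [Ceps] must be fixed before [m], [n] and [p], so the size threshold is chosen as a function of
   [eps] alone; nonpositive [eps] get the default 0. *)
have /choice[N0 hN0] : forall eps : R, exists N0 : R, 0 < eps ->
    forall (n : nat) (p : R), (0 < n)%N -> N0 <= n%:R -> n%:R `^ (-1 + eps) <= p ->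
    large_enough eta n p.
  move=> eps; have [e0|_] := ltP 0 eps; last by exists 0.
  by have [N0 h] := large_enough_eventually heta0 heta1 e0; exists N0.
exists 101, (eta ^+ 2 / 2048), (fun eps => 12 * expR (eta ^+ 2 / 2048 * `|N0 eps|)); split.
- by rewrite ltr0n.
- by rewrite divr_gt0 ?exprn_gt0 ?ltr0n.
- move=> m n p eps m1 mn _ p1 eps0 hp d T P M X obs Mhat model usvt.
  have n0 : (0 < n)%N by exact: leq_trans mn.
  have p0 : 0 < p by apply: lt_le_trans hp; rewrite powR_gt0 // ltr0n.
  apply: usvt_bound_of_large => //.
    exact (MSE_le4 model m1 mn usvt).
  move=> hn; apply: (MSE_large model (@bipartite_edge_inj m n) (@bipartite_edge_sym m n)
    (fun u => bipartite_edge_deg u mn) _ (@bipartite_op_bounded R m n)) => //.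
  + by rewrite card_sum !card_ord mul2n -addnn leq_add2r.
  + by rewrite card_prod !card_ord mul2n -addnn leq_addr.
  + exact: hN0 eps0 _ _ n0 hn hp.
- move=> n p eps n0 _ p1 eps0 hp d T P M X obs Mhat [model Msym Xsym obssym] usvt.
  have p0 : 0 < p by apply: lt_le_trans hp; rewrite powR_gt0 // ltr0n.
  have nn := leqnn n.
  apply: usvt_bound_of_large => //.
    exact (MSE_le4 model n0 nn usvt).
  move=> hn; apply: (MSE_large model (@symmetric_edge_inj n) (@symmetric_edge_sym n)
    (@symmetric_edge_deg n) _ (@symmetric_op_bounded R n)) => //.
  + by rewrite card_ord mul2n -addnn leq_addr.
  + by move=> i j w; rewrite /entry /= /sorted_pair; case: ifP => //= _; rewrite Xsym.
  + by move=> i j w; rewrite /observed /= /sorted_pair; case: ifP => //= _; rewrite obssym.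
  + by move=> i j; rewrite /parameter /= /sorted_pair; case: ifP => //= _; rewrite -[in LHS]Msym mxE.
  + exact: card_upper_triangle.
  + exact: hN0 eps0 _ _ n0 hn hp.
Qed.
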